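(* Let $\zeta_L(s)=\mathrm{Tr}(\rho(L)^s)=\sum_{k\ge1}m_kM_k^{-s}$. (i) If $N_L$ is asymptotically continuous, then $\zeta_L$ is well defined on the half-plane $\{s\in\mathbb{C}:\mathrm{Re}(s)>1\}$ and $$\lim_{s\in\mathbb{R},\ s\downarrow1}(s-1)\,\mathrm{Tr}(\rho(L)^s)=1.$$ (ii) If $\sum_k\frac{m_k^2}{M_k^2}<+\infty$, then $\zeta_L$ is analytic on $\{s\in\mathbb{C}:\mathrm{Re}(s)>1\}$ and $$\lim_{s\in\mathbb{C},\ \mathrm{Re}(s)>1,\ s\to1}(s-1)\,\mathrm{Tr}(\rho(L)^s)=1.$$ (iii) If $\sum_k\frac{m_k^2}{M_k^{1+\alpha}}<+\infty$ for some $\alpha\in(0,1)$, then $\zeta_L$ extends to a meromorphic function on the half-plane $\{s\in\mathbb{C}:\mathrm{Re}(s)>\alpha\}$ with a simple pole at $s=1$ and residue $1$ there.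
   Context: Let $h$ be a Hilbert space and $(L,D(L))$ a densely defined, nonnegative, unbounded self-adjoint operator on $h$ with spectral measure $E^L$, having discrete spectrum off its kernel: $sp(L)\setminus\{0\}$ is discrete in the sense that $L^{-1}$ (defined as $0$ on $\ker L$ and as the inverse of $L$ on $(\ker L)^\perp$) is compact. Functions of $L$ are taken to be $0$ on $\ker L$ and given by the usual functional calculus on $(\ker L)^\perp$. Write $0<\widetilde\lambda_1<\widetilde\lambda_2<\cdots$ for the distinct nonzero eigenvalues of $L$ (tending to $+\infty$), $m_k=\mathrm{Tr}(E^L(\{\widetilde\lambda_k\}))$ for the multiplicities, $M_k=\sum_{j=1}^k m_j$. The eigenvalue counting function is $N_L(x)=\mathrm{Tr}(E^L((0,x]))$. $N_L$ is asymptotically continuous if there is a continuous $\varphi:\mathbb{R}_+\to\mathbb{R}_+$ with $N_L(x)\sim\varphi(x)$ as $x\to+\infty$. The spectral weight of $L$ is $\rho(L):=N_L(L)^{-1}$, i.e. the operator that is $0$ on $\ker L$ and $1/M_k$ on the eigenspace of $\widetilde\lambda_k$. The $\zeta$-function $\zeta_L(s)$ is defined for those $s\in\mathbb{C}$ for which the series $\sum_{k\ge1}m_kM_k^{-s}$ converges. *)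

(* Defs.v *)
From HB Require Import structures.
From mathcomp Require Import all_boot all_order all_algebra finmap.
From mathcomp Require Import sesquilinear.
From mathcomp.real_closed Require Import complex.
From mathcomp Require Import all_classical all_reals all_analysis.
From mathcomp.analysis.showcase Require summability.

Set Implicit Arguments.
Unset Strict Implicit.
Unset Printing Implicit Defensive.

Import Order.TTheory GRing.Theory Num.Theory.
Import numFieldNormedType.Exports.

Local Open Scope classical_set_scope.
Local Open Scope ring_scope.
Local Open Scope complex_scope.

(* The structure numClosedFieldType is declared explicitly: topology and norm
   are inferred from it, and would not be found on [complex R] itself. *)
Definition Cplx (R : realType) : numClosedFieldType := R[i].

(* [inner] is linear in its first argument. *)
Record hilbertType (R : realType) := HilbertType {
  hspace :> completeNormedModType (Cplx R);
  inner : {dot hspace for (@Num.conj (Cplx R))};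
  inner_norm : forall x : hspace, `|x| ^+ 2 = inner x x }.

Section operators.
Context {R : realType} {h : hilbertType R}.
Local Notation C := (Cplx R).

(* The values of [lop] outside [dom] are irrelevant. *)
Record linear_op := LinearOp {
  dom : set h;
  lop :> h -> h;
  dom0 : dom 0;
  domP : forall (a : C) x y, dom x -> dom y -> dom (a *: x + y);
  lopP : forall (a : C) x y, dom x -> dom y ->
    lop (a *: x + y) = a *: lop x + lop y }.

Definition bounded_op (L : linear_op) :=
  exists M : C, forall x, dom L x -> `|L x| <= M * `|x|.

(* (y, z) lies in the graph of the adjoint of L *)
Definition adjoint_graph (L : linear_op) (y z : h) :=
  forall x, dom L x -> inner h (L x) y = inner h x z.

Definition self_adjoint (L : linear_op) :=
  dense (dom L) /\
  forall y z, adjoint_graph L y z <-> dom L y /\ L y = z.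

Definition nonnegative_op (L : linear_op) :=
  forall x, dom L x -> 0 <= inner h (L x) x.

Definition ker (L : linear_op) : set h := [set x | dom L x /\ L x = 0].

Definition orthogonal_set (A : set h) : set h :=
  [set x | forall y, A y -> inner h x y = 0].

Definition compact_op (K : {linear h -> h}) :=
  precompact (K @` [set x | `|x| <= 1]).

(* K is 0 on ker L and inverts L on the orthogonal complement of ker L *)
Definition is_inverse_off_ker (L : linear_op) (K : {linear h -> h}) :=
  (forall x, ker L x -> K x = 0) /\
  (forall y, orthogonal_set (ker L) y ->
     [/\ dom L (K y), orthogonal_set (ker L) (K y) & L (K y) = y]).

Definition discrete_off_ker (L : linear_op) :=
  exists K : {linear h -> h}, is_inverse_off_ker L K /\ compact_op K.

Definition eigenvalue_op (L : linear_op) (z : C) :=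
  exists x, [/\ dom L x, x != 0 & L x = z *: x].

(* lam 0 < lam 1 < ... lists the distinct nonzero eigenvalues of L *)
Definition enumerates_eigenvalues (L : linear_op) (lam : R^nat) :=
  {homo lam : m n / (m < n)%N >-> m < n} /\
  [set z | z != 0 /\ eigenvalue_op L z] = range (fun k => (lam k)%:C : C).

(* Projection-valued Borel measures on the real line; [scalar_measure x] is the
   measure A |-> <E(A) x, x>. *)
Record spectral_measure := SpectralMeasure {
  proj :> set (measurableTypeR R) -> {linear h -> h};
  projK : forall A x, measurable A -> proj A (proj A x) = proj A x;
  proj_sym : forall A x y, measurable A ->
    inner h (proj A x) y = inner h x (proj A y);
  projT : forall x, proj setT x = x;
  projI : forall A B x, measurable A -> measurable B ->
    proj (A `&` B) x = proj A (proj B x);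
  proj_sigma_additive : forall (F : (set (measurableTypeR R))^nat) x,
    (forall n, measurable (F n)) -> trivIset setT F ->
    (\sum_(k < n) proj (F k) x) @[n --> \oo] --> proj (\bigcup_n F n) x;
  scalar_measure : h -> {measure set (measurableTypeR R) -> \bar R};
  scalar_measureE : forall x A, measurable A ->
    scalar_measure x A = (complex.Re (inner h (proj A x) x))%:E }.

(* L = \int t dE(t) *)
Definition is_spectral_measure_of (L : linear_op) (E : spectral_measure) :=
  (forall x, dom L x <->
     (\int[scalar_measure E x]_t (t ^+ 2)%:E < +oo)%E) /\
  (forall x, dom L x ->
     inner h (L x) x = (\int[scalar_measure E x]_t t)%:C).

(* T = f(L), taken to be 0 on the kernel of L, for L nonnegative with spectral
   measure E and f such that f(L) is bounded; by polarization the quadratic form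
   of T determines T. *)
Definition is_functional_calculus (E : spectral_measure)
    (f : measurableTypeR R -> C) (T : h -> h) :=
  [/\ linear T,
      exists M : C, forall x, `|T x| <= M * `|x| &
      forall x,
      let mu := scalar_measure E x in
      [/\ mu.-integrable `]0, +oo[ (fun t => (complex.Re (f t))%:E),
          mu.-integrable `]0, +oo[ (fun t => (complex.Im (f t))%:E) &
          inner h (T x) x = (\int[mu]_(t in `]0%R, +oo[) complex.Re (f t)) +i*
                            (\int[mu]_(t in `]0%R, +oo[) complex.Im (f t))]].

Definition functional_calculus (E : spectral_measure)
    (f : measurableTypeR R -> C) : h -> h :=
  xget (fun=> 0) [set T | is_functional_calculus E f T].

Definition orthonormal_basis (B : set h) :=
  [/\ forall e, B e -> inner h e e = 1,
      forall e e', B e -> B e' -> e != e' -> inner h e e' = 0 &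
      orthogonal_set B = [set 0]].

(* The diagonal of T is unconditionally summable, with sum t, in every
   orthonormal basis; for bounded T this says that T is of trace class with
   trace t. *)
Definition is_trace (T : h -> h) (t : C) :=
  forall B : set h, orthonormal_basis B ->
    summability.partial_sum
      (fun e : h => if e \in B then inner h (T e) e else 0)
      @ summability.totally --> t.

Definition Tr (T : h -> h) : C := xget 0 [set t | is_trace T t].

Definition eigenvalue_counting (E : spectral_measure) (x : R) : R :=
  complex.Re (Tr (E `]0, x]%classic)).

(* x ^ s for x >= 0 *)
Definition cpow (x : R) (s : C) : C :=
  (x `^ complex.Re s)%:C *
  (cos (complex.Im s * ln x) +i* sin (complex.Im s * ln x)).

(* rho(L)^s with rho(L) = N_L(L)^-1 *)
Definition weight_pow (E : spectral_measure) (s : C) : h -> h :=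
  functional_calculus E (fun t => cpow (eigenvalue_counting E t)^-1 s).

(* m_{k+1} and M_{k+1} in the numbering starting at 1 *)
Definition mult (E : spectral_measure) (lam : R^nat) (k : nat) : R :=
  complex.Re (Tr (E [set lam k])).

Definition cumul (E : spectral_measure) (lam : R^nat) (k : nat) : R :=
  \sum_(j < k.+1) mult E lam j.

Definition zeta_series (E : spectral_measure) (lam : R^nat) (s : C) : C^nat :=
  series (fun k => (mult E lam k)%:C * cpow (cumul E lam k) (- s)).

Definition zeta_defined (E : spectral_measure) (lam : R^nat) (s : C) :=
  cvgn (zeta_series E lam s).

Definition zeta (E : spectral_measure) (lam : R^nat) (s : C) : C :=
  limn (zeta_series E lam s).

End operators.
Arguments linear_op {R} h.
Arguments spectral_measure {R} h.

Definition asymptotically_continuous {R : realType} (N : R -> R) :=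
  exists phi : R -> R,
    [/\ {within `[0, +oo[, continuous phi},
        forall x, 0 <= x -> 0 <= phi x &
        N x / phi x @[x --> +oo] --> (1 : R)].

Section complex_analysis.
Context {R : realType}.
Local Notation C := (Cplx R).

Definition half_plane (a : R) : set C := [set s | a < complex.Re s].

Definition holomorphic_on (U : set C) (f : C -> C) :=
  forall z, U z -> derivable (f : C^o -> C^o) z 1.

(* p is a pole of order n of f, and c is the coefficient of (z - p)^-n in the
   Laurent expansion of f at p; for n = 1, c is the residue. *)
Definition pole (f : C -> C) (p : C) (n : nat) (c : C) :=
  [/\ (0 < n)%N, c != 0 &
      exists (U : set C) (g : C -> C),
      [/\ open_nbhs p U, holomorphic_on U g, g p = c &
          forall z, U z -> z != p -> f z = g z / (z - p) ^+ n]].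

Definition meromorphic_on (U : set C) (f : C -> C) :=
  exists P : set C,
    [/\ P `<=` U, forall z, U z -> ~ limit_point P z,
        holomorphic_on (U `\` P) f &
        forall p, P p -> exists n c, pole f p n c].

End complex_analysis.

(* Main.v *)
Require Import Defs.
From HB Require Import structures.
From mathcomp Require Import all_boot all_order all_algebra.
From mathcomp.real_closed Require Import complex.
From mathcomp Require Import all_classical all_reals all_analysis.
From mathcomp Require Import ring lra.
From mathcomp Require Import finmap sesquilinear measurable_realfun.
From mathcomp.analysis.showcase Require summability.

(* With t_k = ln (M_k / M_(k-1)) and w = s - 1,
     w m_k M_k^(-s) = M_(k-1)^(-w) - M_k^(-w) + M_k^(-w) phi(w, t_k),
     phi(w, t) = w (1 - e^(-t)) + 1 - e^(t w) = O(|w| t^2).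
   The first two terms telescope, so w zeta(s) is an explicit entire function
   with value 1 at s = 1 plus the series of the M_k^(-w) phi(w, t_k). The
   hypotheses of (ii) and (iii) say that t_k^2 M_k^(1 - alpha) is summable, and
   second-order Taylor bounds on the summands then give holomorphy. In (i),
   asymptotic continuity forces m_k / M_k -> 0, and the series is o(1) times
   w zeta(s).
   On the operator side, compactness of the inverse of L bounds the size of the
   orthonormal families in the range of E(]0, c]); hence E has finite rank there
   and is carried by the eigenvalues, rho(L)^s is the sum of the
   M_k^(-s) E({lam_k}), and Parseval gives its trace in any basis. *)

Import Order.TTheory GRing.Theory Num.Theory.
Import numFieldNormedType.Exports.

Local Open Scope classical_set_scope.
Local Open Scope ring_scope.
Local Open Scope complex_scope.

Set Implicit Arguments.
Unset Strict Implicit.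
Unset Printing Implicit Defensive.

(** The function [phi] arises from m_k / M_k = 1 - e^(-t_k) and M_(k-1)^(-w) = M_k^(-w) e^(w t_k).
    In its expansion the terms w t_k cancel, which leaves order t_k^2; it also vanishes at w = 0, so
    the series adds nothing to the residue. In (ii) the derivative bounds hold only for Re s > 1, so
    holomorphy does not reach s = 1, and the limit there comes from the factor |w| in the bound on
    [phi]. In (i) no summability of t_k^2 is at hand; there s is real, m_k M_k^(-s) is its own
    modulus, and the sum of these moduli is O(1/w). The hypotheses relate L and E only through the
    domain and the quadratic form <L x, x>. Off-diagonal information is recovered by polarization,
    with y and i y, and spectral information by bounding the form on the range of E(A) by the bounds
    of A. [Tr] and [functional_calculus] are choices by [xget], so each needs existence and
    uniqueness of the chosen object. *)

Lemma cvg_bigsum (K : numFieldType) (V : normedModType K) T (F : set_system T)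
  (FF : Filter F) I (r : seq I) (f : I -> T -> V) (l : I -> V) :
  (forall i, f i x @[x --> F] --> l i) ->
  \sum_(i <- r) f i x @[x --> F] --> \sum_(i <- r) l i.
Proof.
move=> fl; elim: r => [|i r ih].
  rewrite big_nil; under eq_fun do rewrite big_nil.
  exact: cvg_cst.
rewrite big_cons; under eq_fun do rewrite big_cons.
exact: (@cvgD K V _ _ _ _ _ _ _ (fl i) ih).
Qed.

(** * Complex numbers with real-valued norms *)

Section real_norm.
Context {R : realType}.
Local Notation C := (Cplx R).
Implicit Types (z w : C) (a b : R).

Lemma cReD z w : complex.Re (z + w : C) = complex.Re z + complex.Re w.
Proof. by case: z w => ? ? []. Qed.
Lemma cImD z w : complex.Im (z + w : C) = complex.Im z + complex.Im w.
Proof. by case: z w => ? ? []. Qed.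
Lemma cReN z : complex.Re (- z : C) = - complex.Re z.
Proof. by case: z. Qed.
Lemma cImN z : complex.Im (- z : C) = - complex.Im z.
Proof. by case: z. Qed.
Lemma cReM z w : complex.Re (z * w : C) =
  complex.Re z * complex.Re w - complex.Im z * complex.Im w.
Proof. by case: z w => ? ? []. Qed.
Lemma cImM z w : complex.Im (z * w : C) =
  complex.Re z * complex.Im w + complex.Im z * complex.Re w.
Proof. by case: z w => ? ? []. Qed.
Lemma Cext z w : complex.Re z = complex.Re w -> complex.Im z = complex.Im w ->
  z = w.
Proof. by case: z w => ? ? [? ?] /= -> ->. Qed.

(** Norms over [Cplx R] are complex numbers; a real-valued copy opens them to [lra], [nra] and the
    theory of real series. *)
Definition rnorm (V : normedZmodType C) (x : V) : R := complex.Re `|x|.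

Lemma rnormE (V : normedZmodType C) (x : V) : `|x| = (rnorm x)%:C.
Proof.
apply: Cext => //=; rewrite (ger0_Im _)//; exact: (normr_ge0 x).
Qed.

Lemma lecRC a b : ((a%:C : C) <= b%:C) = (a <= b).
Proof. exact: lecR. Qed.
Lemma ltcRC a b : ((a%:C : C) < b%:C) = (a < b).
Proof. exact: ltcR. Qed.

Lemma rnorm_ge0 (V : normedZmodType C) (x : V) : 0 <= rnorm x.
Proof. by rewrite -lecRC -rnormE normr_ge0. Qed.
Lemma rnorm0 (V : normedZmodType C) : rnorm (0 : V) = 0.
Proof. by rewrite /rnorm normr0. Qed.
Lemma rnorm_eq0 (V : normedZmodType C) (x : V) : (rnorm x == 0) = (x == 0).
Proof.
by rewrite -[RHS]normr_eq0 rnormE; apply/eqP/eqP => [->//|[]].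
Qed.
Lemma rnormN (V : normedZmodType C) (x : V) : rnorm (- x) = rnorm x.
Proof. by rewrite /rnorm normrN. Qed.
Lemma rdistC (V : normedZmodType C) (x y : V) : rnorm (x - y) = rnorm (y - x).
Proof. by rewrite /rnorm distrC. Qed.
Lemma ler_rnormD (V : normedZmodType C) (x y : V) :
  rnorm (x + y) <= rnorm x + rnorm y.
Proof.
rewrite -lecRC (_ : (_ + _)%:C = `|x| + `|y|); last by rewrite !rnormE rmorphD.
by rewrite -rnormE ler_normD.
Qed.
Lemma ler_rnormB (V : normedZmodType C) (x y : V) :
  rnorm (x - y) <= rnorm x + rnorm y.
Proof. by rewrite (le_trans (ler_rnormD _ _))// rnormN. Qed.
Lemma rnormM z w : rnorm (z * w) = rnorm z * rnorm w.
Proof. by apply: complexI; rewrite rmorphM/= -!rnormE normrM. Qed.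
Lemma rnormV z : rnorm z^-1 = (rnorm z)^-1.
Proof. by apply: complexI; rewrite fmorphV/= -!rnormE normfV. Qed.
Lemma rnormZ (V : normedModType C) z (x : V) : rnorm (z *: x) =
  rnorm z * rnorm x.
Proof. by apply: complexI; rewrite rmorphM/= -!rnormE normrZ. Qed.
Lemma rnorm_sum (V : normedZmodType C) I (r : seq I) (P : pred I) (F : I -> V) :
  rnorm (\sum_(i <- r | P i) F i) <= \sum_(i <- r | P i) rnorm (F i).
Proof.
elim/big_ind2 : _ => [|x y u v xy uv|//]; first by rewrite rnorm0.
by rewrite (le_trans (ler_rnormD _ _))// lerD.
Qed.
Lemma rnormR a : rnorm (a%:C : C) = `|a|.
Proof. by rewrite /rnorm normc_def /= expr0n addr0 sqrtr_sqr. Qed.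
Lemma rnorm_sqr z : rnorm z ^+ 2 = complex.Re z ^+ 2 + complex.Im z ^+ 2.
Proof. by rewrite /rnorm normc_def /= sqr_sqrtr// addr_ge0 ?sqr_ge0. Qed.
Lemma ler_Re_rnorm z : `|complex.Re z| <= rnorm z.
Proof.
rewrite -(ler_pXn2r (_ : (0 < 2)%N))// ?nnegrE ?rnorm_ge0//.
by rewrite rnorm_sqr real_normK ?num_real// lerDl sqr_ge0.
Qed.
Lemma ler_Im_rnorm z : `|complex.Im z| <= rnorm z.
Proof.
rewrite -(ler_pXn2r (_ : (0 < 2)%N))// ?nnegrE ?rnorm_ge0//.
by rewrite rnorm_sqr real_normK ?num_real// lerDr sqr_ge0.
Qed.
Lemma rnorm_le_ReIm z : rnorm z <= `|complex.Re z| + `|complex.Im z|.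
Proof.
rewrite -(ler_pXn2r (_ : (0 < 2)%N))// ?nnegrE ?rnorm_ge0 ?addr_ge0//.
rewrite rnorm_sqr sqrrD !real_normK ?num_real// lerD2r lerDl.
by rewrite mulrn_wge0// mulr_ge0.
Qed.

Lemma gt0_C (e : C) : 0 < e -> exists2 r : R, 0 < r & e = r%:C.
Proof.
move=> e0; have : e \is Num.real by rewrite ger0_real// ltW.
move=> /complex_realP[r er]; exists r => //.
by rewrite -ltcRC -er.
Qed.

Lemma rcvgP {V : normedModType C} {T} {F : set_system T} {FF : Filter F}
  (f : T -> V) (l : V) :
  f @ F --> l <-> forall e : R, 0 < e -> \forall x \near F, rnorm (l - f x) < e.
Proof.
split=> [/cvgrPdist_lt fl e e0|fl].
  have := fl e%:C; rewrite ltcRC => /(_ e0); apply: filterS => x.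
  by rewrite rnormE ltcRC.
apply/cvgrPdist_lt => e /gt0_C[r r0 ->].
by have := fl _ r0; apply: filterS => x; rewrite rnormE ltcRC.
Qed.

Lemma rcvg0P {V : normedModType C} {T} {F : set_system T} {FF : Filter F}
  (f : T -> V) (l : V) :
  f @ F --> l <-> rnorm (l - f x) @[x --> F] --> (0:R).
Proof.
rewrite rcvgP; split=> [fl|/cvgrPdist_lt fl e e0].
  apply/cvgrPdist_lt => e e0; have := fl e e0; apply: filterS => x.
  by rewrite sub0r normrN ger0_norm// rnorm_ge0.
have := fl e e0; apply: filterS => x.
by rewrite sub0r normrN ger0_norm// rnorm_ge0.
Qed.

Lemma rcvg_squeeze {V : normedModType C} {T} {F : set_system T} {FF : Filter F}
  (f : T -> V) (l : V) (g : T -> R) :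
  g @ F --> 0 -> (\forall x \near F, rnorm (l - f x) <= g x) -> f @ F --> l.
Proof.
move=> g0 fg; apply/rcvgP => e e0.
move/cvgrPdist_lt : g0 => /(_ _ e0); apply: filterS2 fg => x fgx;
  rewrite sub0r normrN => ge.
by rewrite (le_lt_trans fgx)// (le_lt_trans (ler_norm _)).
Qed.

Lemma rcvg_unique {V : normedModType C} {T} {F : set_system T}
  {FF : ProperFilter F} (f : T -> V) (a b : V) :
  f @ F --> a -> f @ F --> b -> a = b.
Proof. exact: (@norm_cvg_unique C V). Qed.

Lemma near_rnorm_lt {V : normedModType C} (x : V) (e : R) : 0 < e ->
  \forall y \near x, rnorm (x - y) < e.
Proof.
move=> e0; apply/nbhs_ballP; exists e%:C => /=; first by rewrite ltcRC.
by move=> y; rewrite -ball_normE /= rnormE ltcRC.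
Qed.

Lemma cvg_rdist {V : normedModType C} (x : V) :
  rnorm (x - y) @[y --> x] --> (0 : R).
Proof.
pose f (y : V) := rnorm (x - y); suff : f y @[y --> x] --> (0 : R) by [].
apply/cvgrPdist_lt => e e0; apply: filterS (near_rnorm_lt x e0) => y.
by rewrite sub0r normrN /f ger0_norm ?rnorm_ge0.
Qed.

Lemma cvg_rnorm {V : normedModType C} {T} {F : set_system T} {FF : Filter F}
  (f : T -> V) (l : V) :
  f @ F --> l -> rnorm (f x) @[x --> F] --> rnorm l.
Proof.
move=> /rcvgP fl; apply/cvgrPdist_lt => e e0.
have := fl e e0; apply: filterS => x; apply: le_lt_trans.
have := ler_rnormD l (f x - l); have := ler_rnormD (f x) (l - f x).
rewrite !subrKC (rdistC (f x)) ler_norml => h1 h2; apply/andP; split; lra.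
Qed.

Lemma cvg_Re {T} {F : set_system T} {FF : Filter F} (f : T -> C) (l : C) :
  f @ F --> l -> complex.Re (f x) @[x --> F] --> complex.Re l.
Proof.
move=> /rcvgP fl; apply/cvgrPdist_lt => e e0.
have := fl e e0; apply: filterS => x; apply: le_lt_trans.
by rewrite -cReN -cReD ler_Re_rnorm.
Qed.

Lemma cvg_complex {T} {F : set_system T} {FF : Filter F} (f : T ->
  C) (a b : R) :
  complex.Re (f x) @[x --> F] --> a -> complex.Im (f x) @[x --> F] --> b ->
  f @ F --> (a +i* b : C).
Proof.
move=> /cvgrPdist_lt fa /cvgrPdist_lt fb; apply/rcvgP => e e0.
have e2 : 0 < e / 2 by lra.
apply: filterS2 (fa _ e2) (fb _ e2) => x ha hb.
apply: (le_lt_trans (rnorm_le_ReIm _)); rewrite !(cReD, cImD, cReN, cImN) /=;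
  lra.
Qed.

Lemma ccvgD {V : normedModType C} {T} {F : set_system T} {FF : Filter F}
  (f g : T -> V) (a b : V) : f x @[x --> F] --> a -> g x @[x --> F] --> b ->
  f x + g x @[x --> F] --> a + b.
Proof. exact: (@cvgD C V). Qed.

Lemma ccvgB {V : normedModType C} {T} {F : set_system T} {FF : Filter F}
  (f g : T -> V) (a b : V) : f x @[x --> F] --> a -> g x @[x --> F] --> b ->
  f x - g x @[x --> F] --> a - b.
Proof. exact: (@cvgB C V). Qed.

Lemma ccvgM {T} {F : set_system T} {FF : Filter F}
  (f g : T -> C) (a b : C) : f x @[x --> F] --> a -> g x @[x --> F] --> b ->
  f x * g x @[x --> F] --> a * b.
Proof. exact: (@cvgM C). Qed.

Lemma cvg_RC {T} {F : set_system T} {FF : Filter F} (f : T -> R) (a : R) :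
  f @ F --> a -> ((f x)%:C : C) @[x --> F] --> (a%:C : C).
Proof. by move=> fa; apply: cvg_complex => //=; exact: cvg_cst. Qed.

Lemma cvg_series_rnorm {V : completeNormedModType C} (u : V^nat) :
  cvgn (series (fun k => rnorm (u k))) -> cvgn (series u).
Proof.
move=> cu; apply/cauchy_cvgP/cauchy_seriesP => e /gt0_C[r r0 ->].
move/cauchy_cvgP/cauchy_seriesP : cu => /(_ r r0).
apply: filterS => n un; rewrite rnormE ltcRC; apply: le_lt_trans un.
by rewrite (le_trans (rnorm_sum _ _ _))// ler_norm.
Qed.

(** Scalar counterpart of [cvg_series_rnorm], reduced to the real and imaginary parts, where
    completeness of [R] suffices. *)
Lemma cvg_cseries_rnorm (u : C^nat) :
  cvgn (series (fun k => rnorm (u k))) -> cvgn (series u).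
Proof.
move=> cu.
have cre : cvgn (series (fun k => complex.Re (u k))).
  apply: normed_cvg; apply: series_le_cvg cu => // k;
    rewrite /= ?normr_ge0 ?rnorm_ge0//.
  by rewrite ler_Re_rnorm.
have cim : cvgn (series (fun k => complex.Im (u k))).
  apply: normed_cvg; apply: series_le_cvg cu => // k;
    rewrite /= ?normr_ge0 ?rnorm_ge0//.
  by rewrite ler_Im_rnorm.
apply/cvg_ex; eexists; apply: cvg_complex.
- have -> : (fun x => complex.Re (series u x)) =
    series (fun k => complex.Re (u k)).
    apply/funext => n; rewrite /series/=.
    by elim/big_ind2 : _ => // x y z t <- <-; rewrite cReD.
  exact: cre.
- have -> : (fun x => complex.Im (series u x)) =
    series (fun k => complex.Im (u k)).
    apply/funext => n; rewrite /series/=.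
    by elim/big_ind2 : _ => // x y z t <- <-; rewrite cImD.
  exact: cim.
Qed.

Lemma rnorm_lim_series {V : normedModType C} (u : V^nat) (b : R^nat) :
  cvgn (series u) -> cvgn (series b) -> (forall k, rnorm (u k) <= b k) ->
  rnorm (limn (series u)) <= limn (series b).
Proof.
move=> cu cb ub.
have cn : rnorm (series u x) @[x --> \oo] --> rnorm (limn (series u)).
  exact: (cvg_rnorm cu).
rewrite -(cvg_lim _ cn)//; apply: ler_lim => //; first by apply: cvgP cn.
apply: nearW => n; rewrite /series/= (le_trans (rnorm_sum _ _ _))//.
by apply: ler_sum => i _; exact: ub.
Qed.

End real_norm.

(** * Taylor bounds for the complex exponential *)

Section complex_exponential.
Context {R : realType}.
Local Notation C := (Cplx R).
Implicit Types (z w : C) (x y t : R).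

Lemma expR_leM x : expR x - 1 <= x * expR x.
Proof.
have := expR_ge1Dx (- x); have := expR_gt0 x => ex h.
have := ler_wpM2l (ltW ex) h; rewrite -expRD subrr expR0; lra.
Qed.

Lemma ler_dist_expR1 x : `|expR x - 1| <= `|x| * expR `|x|.
Proof.
have h1 := expR_ge1Dx x; have h2 := expR_leM x.
have h3 : 1 <= expR `|x| by have := expR_ge1Dx `|x|; have := normr_ge0 x; lra.
have [x0|x0] := leP 0 x.
  by rewrite (ger0_norm x0) ger0_norm//; lra.
rewrite ler0_norm; last by rewrite (le_trans h2)// nmulr_rle0// ltW// expR_gt0.
rewrite ltr0_norm//; rewrite ltr0_norm// in h3.
have : - x * 1 <= - x * expR (- x) by rewrite ler_wpM2l// oppr_ge0 ltW.
lra.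
Qed.

(** By [expR_leM] the remainder is at most x (e^x - 1), to which the first-order bound applies. *)
Lemma ler_expR_taylor1 x : `|expR x - 1 - x| <= x ^+ 2 * expR `|x|.
Proof.
have h1 := expR_ge1Dx x; have h2 := expR_leM x.
rewrite ger0_norm; last by lra.
apply: (@le_trans _ _ (x * (expR x - 1))); first by lra.
apply: (le_trans (ler_norm _)); rewrite normrM -real_normK ?num_real// expr2.
by rewrite -mulrA ler_wpM2l// ler_dist_expR1.
Qed.

Lemma MVT_sin a b : a <= b ->
  exists2 c, c \in `[a, b]%R & sin b - sin a = cos c * (b - a) :> R.
Proof.
move=> ab; apply: (@MVT_segment R sin cos) => //.
by apply: continuous_subspaceT => x; exact: continuous_sin.
Qed.

Lemma ler_norm_sin y : `|sin y| <= `|y|.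
Proof.
wlog y0 : y / 0 < y => [H|].
  have [y0|y0|<-] := ltgtP 0 y; [exact: H| |by rewrite sin0].
  by have := H (- y); rewrite oppr_gt0 sinN !normrN; exact.
have [c] := MVT_sin (ltW y0).
move=> c0y; rewrite sin0 !subr0 => ->; rewrite normrM.
by rewrite ler_piMl// cos_max.
Qed.

Lemma ler_dist_cos1 y : `|cos y - 1| <= y ^+ 2.
Proof.
have -> : y = (y / 2) *+ 2 by rewrite -mulr_natr divfK.
set u := y / 2; rewrite cos_mulr2n cos2sin2.
have -> : (1 - sin u ^+ 2) *+ 2 - 1 - 1 = - (2 * sin u ^+ 2).
  by ring.
have h1 := ler_norm_sin u; have h2 := normr_ge0 (sin u).
rewrite normrN ger0_norm; last by rewrite mulr_ge0 ?sqr_ge0.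
rewrite -[sin u ^+ 2]real_normK ?num_real//.
rewrite -(mulr_natr u) exprMn -[u ^+ 2]real_normK ?num_real//; nra.
Qed.

(** For |y| <= 1 the quadratic bound suffices; otherwise one of the two factors sin (y / 2) of the
    half-angle formula is bounded by 1. *)
Lemma ler_dist_cos1_lin y : `|cos y - 1| <= `|y|.
Proof.
have [y1|y1] := leP `|y| 1.
  rewrite (le_trans (ler_dist_cos1 y))// -real_normK ?num_real// expr2.
  by rewrite ler_piMl.
have -> : y = (y / 2) *+ 2 by rewrite -mulr_natr divfK.
set u := y / 2; rewrite cos_mulr2n cos2sin2.
have -> : (1 - sin u ^+ 2) *+ 2 - 1 - 1 = - (2 * sin u ^+ 2).
  by ring.
have h1 := ler_norm_sin u; have h2 := normr_ge0 (sin u); have h3 := sin_max u.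
rewrite normrN ger0_norm; last by rewrite mulr_ge0 ?sqr_ge0.
rewrite -[sin u ^+ 2]real_normK ?num_real//.
rewrite -(mulr_natr u) normrM (@ger0_norm _ 2%:R)//; nra.
Qed.

(** By the mean value theorem sin y - y = (cos c - 1) y with c between 0 and y, and
    [ler_dist_cos1_lin] applies at c. *)
Lemma ler_dist_sin y : `|sin y - y| <= y ^+ 2.
Proof.
wlog y0 : y / 0 < y => [H|].
  have [y0|y0|<-] := ltgtP 0 y; [exact: H| |by rewrite sin0 subrr normr0
    sqr_ge0].
  by have := H (- y); rewrite oppr_gt0 sinN -opprD normrN sqrrN; exact.
have [c] := MVT_sin (ltW y0).
rewrite in_itv/= => /andP[c0 cy]; rewrite sin0 !subr0 => ->.
have -> : cos c * y - y = (cos c - 1) * y by ring.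
rewrite normrM (ger0_norm (ltW y0)) expr2 ler_wpM2r ?(ltW y0)//.
by rewrite (le_trans (ler_dist_cos1_lin c))// ger0_norm.
Qed.

Definition cexp z : C :=
  (expR (complex.Re z) * cos (complex.Im z)) +i*
  (expR (complex.Re z) * sin (complex.Im z)).

Lemma Re_cexp z : complex.Re (cexp z) = expR (complex.Re z) * cos (complex.Im
  z).
Proof. by []. Qed.

Lemma Im_cexp z : complex.Im (cexp z) = expR (complex.Re z) * sin (complex.Im
  z).
Proof. by []. Qed.

Lemma cexpD z w : cexp (z + w) = cexp z * cexp w.
Proof.
apply: Cext; rewrite ?(cReM, cImM) !(Re_cexp, Im_cexp) cReD cImD expRD ?cosD
  ?sinD.
all: ring.
Qed.

Lemma cexpR x : cexp x%:C = (expR x)%:C.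
Proof. by apply: Cext; rewrite ?(Re_cexp, Im_cexp) /= ?cos0 ?sin0; ring. Qed.

Lemma cexp0 : cexp 0 = 1.
Proof. by rewrite -[0]/(0%:C) cexpR expR0. Qed.

Lemma rnorm_cexp z : rnorm (cexp z) = expR (complex.Re z).
Proof.
apply/eqP; rewrite -(@eqrXn2 _ 2)// ?rnorm_ge0 ?expR_ge0//; apply/eqP.
rewrite rnorm_sqr Re_cexp Im_cexp !exprMn -mulrDr cos2Dsin2 mulr1//.
Qed.

Lemma rnorm_cexp_le z : rnorm (cexp z) <= expR (rnorm z).
Proof.
by rewrite rnorm_cexp ler_expR (le_trans (ler_norm _))// ler_Re_rnorm.
Qed.

(** The constant counts pieces: e^x - 1, e^x (cos y - 1) and e^x sin y are each at most |z| e^|z|.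
    In [cexp_taylor1] there are four, two in each of the real and imaginary parts. *)
Lemma cexp_taylor0 z : rnorm (cexp z - 1) <= 3 * rnorm z * expR (rnorm z).
Proof.
apply: (le_trans (rnorm_le_ReIm _)); rewrite cReD cImD cReN cImN Re_cexp Im_cexp
  /= subr0.
set x := complex.Re z; set y := complex.Im z.
have -> : expR x * cos y - 1 = (expR x - 1) + expR x * (cos y - 1) by ring.
have xz : `|x| <= rnorm z by exact: ler_Re_rnorm.
have yz : `|y| <= rnorm z by exact: ler_Im_rnorm.
have ez : expR `|x| <= expR (rnorm z) by rewrite ler_expR.
have exz : expR x <= expR (rnorm z).
  by rewrite ler_expR (le_trans (ler_norm _)).
have e0 := expR_gt0 x; have e1 := expR_gt0 `|x|.
have r0 := rnorm_ge0 z.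
have h1 : `|expR x - 1| <= rnorm z * expR (rnorm z).
  by rewrite (le_trans (ler_dist_expR1 x))// ler_pM// ltW.
have h2 : `|expR x * (cos y - 1)| <= rnorm z * expR (rnorm z).
  rewrite normrM (gtr0_norm e0) mulrC ler_pM// ?(ltW e0)//.
  by rewrite (le_trans (ler_dist_cos1_lin y)).
have h3 : `|expR x * sin y| <= rnorm z * expR (rnorm z).
  rewrite normrM (gtr0_norm e0) mulrC ler_pM// ?(ltW e0)//.
  by rewrite (le_trans (ler_norm_sin y)).
have := ler_normD (expR x - 1) (expR x * (cos y - 1)); lra.
Qed.

Lemma cexp_taylor1 z : rnorm (cexp z - 1 - z) <=
  4 * rnorm z ^+ 2 * expR (rnorm z).
Proof.
apply: (le_trans (rnorm_le_ReIm _)).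
rewrite !cReD !cImD !cReN !cImN Re_cexp Im_cexp /= subr0.
set x := complex.Re z; set y := complex.Im z.
have -> : expR x * cos y - 1 - x = (expR x - 1 - x) + expR x * (cos y - 1)
  by ring.
have -> : expR x * sin y - y = expR x * (sin y - y) + (expR x - 1) * y by ring.
have xz : `|x| <= rnorm z by exact: ler_Re_rnorm.
have yz : `|y| <= rnorm z by exact: ler_Im_rnorm.
have ez : expR `|x| <= expR (rnorm z) by rewrite ler_expR.
have exz : expR x <= expR (rnorm z).
  by rewrite ler_expR (le_trans (ler_norm _)).
have e0 := expR_gt0 x; have e1 := expR_gt0 `|x|.
have r0 := rnorm_ge0 z.
have y2 : y ^+ 2 <= rnorm z ^+ 2.
  by rewrite -real_normK ?num_real// lerXn2r// nnegrE.
have x2 : x ^+ 2 <= rnorm z ^+ 2.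
  by rewrite -real_normK ?num_real// lerXn2r// nnegrE.
have h1 : `|expR x - 1 - x| <= rnorm z ^+ 2 * expR (rnorm z).
  by rewrite (le_trans (ler_expR_taylor1 x))// ler_pM ?sqr_ge0// ltW.
have h2 : `|expR x * (cos y - 1)| <= rnorm z ^+ 2 * expR (rnorm z).
  rewrite normrM (gtr0_norm e0) mulrC ler_pM// ?(ltW e0)//.
  by rewrite (le_trans (ler_dist_cos1 y)).
have h3 : `|expR x * (sin y - y)| <= rnorm z ^+ 2 * expR (rnorm z).
  rewrite normrM (gtr0_norm e0) mulrC ler_pM// ?(ltW e0)//.
  by rewrite (le_trans (ler_dist_sin y)).
have h4 : `|(expR x - 1) * y| <= rnorm z ^+ 2 * expR (rnorm z).
  rewrite normrM expr2 -mulrA mulrC ler_pM//.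
  by rewrite (le_trans (ler_dist_expR1 x))// ler_pM// ltW.
have := ler_normD (expR x - 1 - x) (expR x * (cos y - 1)).
have := ler_normD (expR x * (sin y - y)) ((expR x - 1) * y); lra.
Qed.

Lemma cpow_cexp x (s : C) : 0 < x -> cpow x s = cexp (s * (ln x)%:C).
Proof.
move=> x0; rewrite /cpow /cexp cReM cImM /= /powR gt_eqF//.
by apply: Cext => /=; rewrite !mulr0 ?subr0 ?add0r ?mul0r ?subr0 ?addr0.
Qed.

End complex_exponential.

(** * Complex differentiability of series from second-order Taylor bounds *)

Section termwise_differentiation.
Context {R : realType}.
Local Notation C := (Cplx R).

Lemma derivable_taylor (F : C -> C) (z L : C) (B d : R) : 0 < d ->
  (forall v : C, rnorm v <= d -> rnorm (F (z + v) - F z - L * v) <=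
    rnorm v ^+ 2 * B) ->
  derivable (F : C^o -> C^o) z 1.
Proof.
move=> d0 FB; apply/cvg_ex; exists L; apply/rcvgP => e e0.
have B1 : 0 < `|B| + 1 by rewrite ltr_wpDl.
near=> v.
have v0 : v != 0 by near: v; exact: nbhs_dnbhs_neq.
have vd : rnorm v <= d.
  rewrite -lecRC -rnormE; near: v; apply: dnbhs0_le; by rewrite ltcRC.
have ve : rnorm v < e / (`|B| + 1).
  rewrite -ltcRC -rnormE; near: v; apply: dnbhs0_lt; by rewrite ltcRC divr_gt0.
rewrite /= (_ : v *: 1 + z = z + v); last by rewrite addrC /GRing.scale/= mulr1.
rewrite rdistC (_ : _ - L = v^-1 * (F (z + v) - F z - L * v)); last first.
  by rewrite [RHS]mulrBr (mulrC L) mulKf.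
have rv0 : 0 < rnorm v by rewrite lt_neqAle eq_sym rnorm_eq0 v0 rnorm_ge0.
rewrite rnormM rnormV (@le_lt_trans _ _ (rnorm v * (`|B| + 1)))//; last first.
  by rewrite -ltr_pdivlMr.
rewrite ler_pdivrMl// mulrA -expr2.
apply: (le_trans (FB v vd)).
by rewrite ler_wpM2l ?sqr_ge0// (le_trans (ler_norm _))// lerDl.
Unshelve. all: by end_near. Qed.

(** The same summable majorant [b] controls the values, the candidate derivatives and the
    second-order remainders, so the remainder bounds add up to one for the sum and
    [derivable_taylor] applies. *)
Lemma derivable_series (f : nat -> C -> C) (d : C^nat) (b : R^nat) (z : C) (e :
  R) :
  0 < e -> cvgn (series b) ->
  (forall k, rnorm (f k z) <= b k) ->
  (forall k, rnorm (d k) <= b k) ->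
  (forall k (v : C), rnorm v <= e ->
    rnorm (f k (z + v) - f k z - d k * v) <= rnorm v ^+ 2 * b k) ->
  derivable ((fun s => limn (series (fun k => f k s))) : C^o -> C^o) z 1.
Proof.
move=> e0 cb fb db tb.
have b0 k : 0 <= b k by rewrite (le_trans _ (fb k))// rnorm_ge0.
have cf : cvgn (series (fun k => f k z)).
  apply: cvg_cseries_rnorm; apply: series_le_cvg cb => // k; exact: rnorm_ge0.
have cd : cvgn (series d).
  apply: cvg_cseries_rnorm; apply: series_le_cvg cb => // k; exact: rnorm_ge0.
apply: (@derivable_taylor _ z (limn (series d)) (limn (series b)) e) => // v ve.
pose r k := f k (z + v) - f k z - d k * v.
have cbv : cvgn (series (fun k => rnorm v ^+ 2 * b k)).
  exact: is_cvg_seriesZ.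
have cr : cvgn (series r).
  apply: cvg_cseries_rnorm; apply: series_le_cvg cbv => k; rewrite ?rnorm_ge0//.
  - by rewrite mulr_ge0 ?sqr_ge0.
  - exact: tb.
have h : series (fun k => f k (z + v)) @ \oo -->
    limn (series r) + limn (series (fun k => f k z)) + limn (series d) * v.
  have -> : series (fun k => f k (z + v)) = (fun n => series r n +
      series (fun k => f k z) n + series d n * v).
    apply/funext => n; rewrite /series/= mulr_suml -!big_split/=.
    by apply: eq_bigr => i _; rewrite /r; ring.
  apply: (ccvgD (ccvgD cr cf)).
  by apply: (ccvgM cd); exact: cvg_cst.
rewrite (cvg_lim _ h)// (_ : _ - _ = limn (series r)); last by ring.
have -> : rnorm v ^+ 2 * limn (series b) = limn (series (fun k => rnorm v ^+ 2 *
  b k)).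
  by rewrite lim_seriesZ.
by apply: (rnorm_lim_series cr cbv) => k; exact: tb.
Qed.

End termwise_differentiation.

(** * Analytic continuation of Dirichlet series *)

Section euler_term.
Context {R : realType}.
Local Notation C := (Cplx R).
Implicit Types (w v : C) (t l W T : R).

Definition phi w t : C := w * (1 - expR (- t))%:C + 1 - cexp (w * t%:C).
Definition dphi w t : C := (1 - expR (- t))%:C - t%:C * cexp (w * t%:C).
(** [W] bounds the modulus of [w] and [T] bounds [t]; the [W + 1] in the exponent leaves room for an
    increment of [w] of modulus at most 1. *)
Definition phi_cst W T := 8 * (1 + W) * expR (T * (W + 1)).

Lemma phi_cst_ge0 W T : 0 <= W -> 0 <= phi_cst W T.
Proof. by move=> W0; rewrite mulr_ge0 ?expR_ge0// mulr_ge0// addr_ge0. Qed.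

Lemma sqr_phi_cst_ge0 t W T : 0 <= W -> 0 <= t ^+ 2 * phi_cst W T.
Proof. by move=> W0; rewrite mulr_ge0 ?sqr_ge0// phi_cst_ge0. Qed.

Lemma expR_le_mul t W T u : 0 <= t <= T -> u <= W + 1 -> 0 <= u ->
  expR (t * u) <= expR (T * (W + 1)).
Proof.
by move=> /andP[t0 tT] uW u0; rewrite ler_expR ler_pM.
Qed.

Lemma expRN_taylor t T W : 0 <= t <= T -> 0 <= W ->
  rnorm ((1 - expR (- t) - t)%:C : C) <= t ^+ 2 * expR (T * (W + 1)).
Proof.
move=> tT W0; rewrite rnormR -normrN.
have -> : - (1 - expR (- t) - t) = expR (- t) - 1 - - t by ring.
apply: (le_trans (ler_expR_taylor1 _)); rewrite sqrrN normrN ler_wpM2l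
  ?sqr_ge0//.
have t0 : 0 <= t by case/andP : tT.
rewrite ger0_norm//.
by rewrite -{1}(mulr1 t); apply: expR_le_mul => //; rewrite lerDr.
Qed.

(** The factor [rnorm w] is kept outside the constant because both limits at s = 1 rest on it. *)
Lemma phi_bound w t W T : 0 <= t <= T -> rnorm w <= W ->
  rnorm (phi w t) <= rnorm w * (t ^+ 2 * phi_cst W T).
Proof.
move=> tT wW; have W0 : 0 <= W := le_trans (rnorm_ge0 w) wW.
have /andP[t0 _] := tT.
(* The linear terms [w * t] of the two brackets cancel, so only second-order remainders are left to
   bound. *)
have -> : phi w t = w * (1 - expR (- t) - t)%:C - (cexp (w * t%:C) - 1 - w *
  t%:C).
  by rewrite /phi !rmorphB/=; ring.
apply: (le_trans (ler_rnormB _ _)); rewrite rnormM.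
have h1 := expRN_taylor tT W0.
have h2 := cexp_taylor1 (w * t%:C).
rewrite rnormM rnormR ger0_norm// in h2.
have h3 : expR (rnorm w * t) <= expR (T * (W + 1)).
  by rewrite mulrC expR_le_mul ?rnorm_ge0// (le_trans wW)// lerDl.
rewrite /phi_cst; set E := expR (T * (W + 1)) in h1 h3 *.
have E0 : 0 <= E := expR_ge0 _.
have r0 := rnorm_ge0 w.
have h4 : rnorm w * rnorm ((1 - expR (- t) - t)%:C : C) <=
  rnorm w * (t ^+ 2 * E).
  by rewrite ler_wpM2l.
have h5 : rnorm (cexp (w * t%:C) - 1 - w * t%:C) <=
  rnorm w * (t ^+ 2 * (4 * W * E)).
  apply: (le_trans h2).
  apply: (@le_trans _ _ (4 * (rnorm w * t) ^+ 2 * E)).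
    by rewrite ler_wpM2l// mulr_ge0// sqr_ge0.
  have -> : 4 * (rnorm w * t) ^+ 2 * E = (rnorm w * (t ^+ 2 * (4 * E))) * rnorm
    w by ring.
  have -> : rnorm w * (t ^+ 2 * (4 * W * E)) = (rnorm w * (t ^+ 2 * (4 * E))) *
    W by ring.
  by rewrite ler_wpM2l// mulr_ge0// mulr_ge0 ?sqr_ge0// mulr_ge0.
apply: (le_trans (lerD h4 h5)); rewrite -mulrDr -mulrDr.
rewrite ler_wpM2l// ler_wpM2l ?sqr_ge0//.
have : 0 <= W * E by rewrite mulr_ge0.
by rewrite mulrDr mulrDl; lra.
Qed.

Lemma dphi_bound w t W T : 0 <= t <= T -> rnorm w <= W ->
  rnorm (dphi w t) <= t ^+ 2 * phi_cst W T.
Proof.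
move=> tT wW; have W0 : 0 <= W := le_trans (rnorm_ge0 w) wW.
have /andP[t0 _] := tT.
have -> : dphi w t = (1 - expR (- t) - t)%:C - t%:C * (cexp (w * t%:C) - 1).
  by rewrite /dphi !rmorphB/=; ring.
apply: (le_trans (ler_rnormB _ _)); rewrite rnormM (rnormR t) (ger0_norm t0).
have h1 := expRN_taylor tT W0.
have h2 := cexp_taylor0 (w * t%:C).
rewrite rnormM rnormR ger0_norm// in h2.
have h3 : expR (rnorm w * t) <= expR (T * (W + 1)).
  by rewrite mulrC expR_le_mul ?rnorm_ge0// (le_trans wW)// lerDl.
rewrite /phi_cst; set E := expR (T * (W + 1)) in h1 h3 *.
have E0 : 0 <= E := expR_ge0 _.
have r0 := rnorm_ge0 w.
have h5 : t * rnorm (cexp (w * t%:C) - 1) <= t ^+ 2 * (3 * W * E).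
  rewrite expr2 -mulrA ler_wpM2l//; apply: (le_trans h2).
  have -> : t * (3 * W * E) = 3 * (W * t) * E by ring.
  by rewrite ler_pM ?mulr_ge0 ?expR_ge0// ler_wpM2l// ler_wpM2r.
apply: (le_trans (lerD h1 h5)); rewrite -mulrDr ler_wpM2l ?sqr_ge0//.
have : 0 <= W * E by rewrite mulr_ge0.
by rewrite mulrDr mulrDl; lra.
Qed.

(** Apart from its exponential, [phi] is affine in [w]; the remainder is therefore that of e^(v t),
    multiplied by -e^(w t). *)
Lemma phi_taylor w v t W T : 0 <= t <= T -> rnorm w <= W -> rnorm v <= 1 ->
  rnorm (phi (w + v) t - phi w t - dphi w t * v) <=
  rnorm v ^+ 2 * (t ^+ 2 * phi_cst W T).
Proof.
move=> tT wW v1; have W0 : 0 <= W := le_trans (rnorm_ge0 w) wW.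
have /andP[t0 _] := tT.
have -> : phi (w + v) t - phi w t - dphi w t * v =
    - (cexp (w * t%:C) * (cexp (v * t%:C) - 1 - v * t%:C)).
  by rewrite /dphi /phi (mulrDl w v t%:C) cexpD; ring.
rewrite rnormN rnormM.
have h2 := cexp_taylor1 (v * t%:C).
rewrite rnormM rnormR ger0_norm// in h2.
have h1 := rnorm_cexp_le (w * t%:C).
rewrite rnormM rnormR ger0_norm// in h1.
apply: (@le_trans _ _ (expR (rnorm w * t) * (4 * (rnorm v * t) ^+ 2 * expR
  (rnorm v * t)))).
  by rewrite ler_pM ?rnorm_ge0.
have -> : expR (rnorm w * t) * (4 * (rnorm v * t) ^+ 2 * expR (rnorm v * t)) =
   rnorm v ^+ 2 * (t ^+ 2 * (4 * (expR (rnorm w * t) * expR (rnorm v * t))))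
     by ring.
rewrite ler_wpM2l ?sqr_ge0// ler_wpM2l ?sqr_ge0//.
rewrite -expRD -mulrDl (mulrC _ t).
have h3 : expR (t * (rnorm w + rnorm v)) <= expR (T * (W + 1)).
  by apply: expR_le_mul => //; [exact: lerD | rewrite addr_ge0 ?rnorm_ge0].
rewrite /phi_cst; have E0 : 0 <= expR (T * (W + 1)) := expR_ge0 _.
have : 0 <= W * expR (T * (W + 1)) by rewrite mulr_ge0.
by rewrite (mulrDr 8) mulrDl; lra.
Qed.

Definition euler_term l t w : C := cexp (- (w * l%:C)) * phi w t.
Definition deuler_term l t w : C :=
  cexp (- (w * l%:C)) * dphi w t - l%:C * cexp (- (w * l%:C)) * phi w t.

Lemma rnorm_cexpN w l : rnorm (cexp (- (w * l%:C))) =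
  expR (- (complex.Re w * l)).
Proof. by rewrite rnorm_cexp cReN cReM /= mulr0 subr0. Qed.

Lemma euler_term_bound w l t W T : 0 <= t <= T -> rnorm w <= W ->
  rnorm (euler_term l t w) <=
  expR (- (complex.Re w * l)) * (rnorm w * (t ^+ 2 * phi_cst W T)).
Proof.
by move=> tT wW; rewrite rnormM rnorm_cexpN ler_wpM2l ?expR_ge0// phi_bound.
Qed.

Definition euler_cst W T d := 4 * (1 + W) * phi_cst W T / d ^+ 2.

(** The slack 3 d in the exponent is spent as follows: one d on e^(-v l) for |v| <= d, and two on (1
    + l)^2 <= e^(2 d l) / d^2, where the powers of l come from expanding e^(-w l) to second order in
    w. *)
Definition euler_majorant l t w W T d :=
  euler_cst W T d * (t ^+ 2 * expR (- (complex.Re w * l) + 3 * d * l)).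

Lemma expR_ge_lin l d : 0 <= l -> 0 < d <= 1 -> 1 + l <= expR (d * l) / d.
Proof.
move=> l0 /andP[d0 d1]; rewrite ler_pdivlMr//.
by rewrite (le_trans _ (expR_ge1Dx _))// mulrDl mul1r mulrC lerD2r.
Qed.

(** The bounds on value, derivative and remainder are all brought to this shape; [expR_ge_lin] then
    absorbs the polynomial in l into the exponential. *)
Lemma le_euler_majorant l t w W T d (x : R) : 0 <= l -> 0 < d <= 1 -> 0 <= W ->
  x <= expR (- (complex.Re w * l)) * expR (l * d) *
       (t ^+ 2 * phi_cst W T * (4 * (1 + W) * (1 + l) ^+ 2)) ->
  x <= euler_majorant l t w W T d.
Proof.
move=> l0 d01 W0 /le_trans; apply; rewrite /euler_majorant /euler_cst.
have /andP[d0 d1] := d01.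
have -> : - (complex.Re w * l) + 3 * d * l =
  - (complex.Re w * l) + l * d + (d * l + d * l) by ring.
rewrite !expRD.
have h := expR_ge_lin l0 d01.
set X := expR (- _); set Y := expR (l * d); set Z := expR (d * l) in h *.
have -> : 4 * (1 + W) * phi_cst W T / d ^+ 2 * (t ^+ 2 * (X * Y * (Z * Z))) =
  X * Y * (t ^+ 2 * phi_cst W T * (4 * (1 + W) * (Z / d) ^+ 2)).
  by rewrite expr_div_n; field; rewrite gt_eqF.
rewrite ler_wpM2l ?mulr_ge0 ?expR_ge0// ler_wpM2l ?sqr_phi_cst_ge0//.
rewrite ler_wpM2l ?mulr_ge0 ?addr_ge0// lerXn2r ?nnegrE ?addr_ge0//
  divr_ge0 ?expR_ge0//.
exact: ltW.
Qed.

Lemma euler_term_le_majorant w l t W T d :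
  0 <= t <= T -> rnorm w <= W -> 0 <= l -> 0 < d <= 1 ->
  rnorm (euler_term l t w) <= euler_majorant l t w W T d.
Proof.
move=> tT wW l0 d01; have W0 : 0 <= W := le_trans (rnorm_ge0 w) wW.
have /andP[d0 d1] := d01.
apply: le_euler_majorant => //; apply: (le_trans (euler_term_bound l tT wW)).
rewrite -mulrA ler_wpM2l ?expR_ge0//.
have e1 : 1 <= expR (l * d).
  by rewrite (le_trans _ (expR_ge1Dx _))// lerDl mulr_ge0// ltW.
rewrite -[leLHS]mul1r ler_pM ?(mulr_ge0 (rnorm_ge0 _)) ?sqr_phi_cst_ge0//.
rewrite mulrC ler_wpM2l ?sqr_phi_cst_ge0//.
rewrite (le_trans wW)//.
have : 1 <= (1 + l) ^+ 2 by rewrite exprn_ege1// lerDl.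
nra.
Qed.

Lemma deuler_term_le_majorant w l t W T d :
  0 <= t <= T -> rnorm w <= W -> 0 <= l -> 0 < d <= 1 ->
  rnorm (deuler_term l t w) <= euler_majorant l t w W T d.
Proof.
move=> tT wW l0 d01; have W0 : 0 <= W := le_trans (rnorm_ge0 w) wW.
have /andP[d0 d1] := d01.
apply: le_euler_majorant => //; apply: (le_trans (ler_rnormB _ _)).
rewrite !rnormM rnorm_cexpN rnormR (ger0_norm l0).
have e1 : 1 <= expR (l * d).
  by rewrite (le_trans _ (expR_ge1Dx _))// lerDl mulr_ge0// ltW.
have h1 := phi_bound tT wW; have h2 := dphi_bound tT wW.
set P := t ^+ 2 * phi_cst W T in h1 h2 *.
have P0 : 0 <= P by rewrite mulr_ge0 ?sqr_ge0 ?phi_cst_ge0.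
set X := expR (- _).
have X0 : 0 <= X := expR_ge0 _.
have -> : X * rnorm (dphi w t) + l * X * rnorm (phi w t) =
  X * (rnorm (dphi w t) + l * rnorm (phi w t)) by ring.
rewrite -mulrA ler_wpM2l//.
have h3 : rnorm w * P <= W * P by rewrite ler_wpM2r.
have h4 : l * rnorm (phi w t) <= l * (W * P) by rewrite ler_wpM2l//
  (le_trans h1).
apply: (@le_trans _ _ (1 * (P * (1 + l * W)))).
  by rewrite mul1r mulrDr mulr1; nra.
have lW : 0 <= l * W by rewrite mulr_ge0.
apply: ler_pM => //; first by rewrite mulr_ge0 ?addr_ge0.
by rewrite ler_wpM2l// sqrrD; nra.
Qed.

Lemma euler_term_taylor w v l t W T d :
  0 <= t <= T -> rnorm w <= W -> 0 <= l -> 0 < d <= 1 -> rnorm v <= d ->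
  rnorm (euler_term l t (w + v) - euler_term l t w - deuler_term l t w * v) <=
  rnorm v ^+ 2 * euler_majorant l t w W T d.
Proof.
move=> tT wW l0 d01 vd; have W0 : 0 <= W := le_trans (rnorm_ge0 w) wW.
have /andP[d0 d1] := d01.
have v1 : rnorm v <= 1 := le_trans vd d1.
have rv0 := rnorm_ge0 v.
have h1 := phi_bound tT wW; have h2 := dphi_bound tT wW.
have h3 := phi_taylor tT wW v1.
have h4 := cexp_taylor1 (- (v * l%:C)).
have h5 := rnorm_cexp_le (- (v * l%:C)).
rewrite rnormN rnormM rnormR ger0_norm// in h4 h5.
have elv : expR (rnorm v * l) <= expR (l * d).
  by rewrite ler_expR mulrC ler_wpM2l.
set f0 := cexp (- (w * l%:C)).
set f1 := cexp (- (v * l%:C)) in h4 h5 *.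
(* Product rule with remainders: [Rf] and [Rg] are the second-order remainders of the two factors,
   and the cross term of the two linear parts yields [l * dphi w t * v ^ 2]. *)
pose Rf := f1 - 1 - - (v * l%:C).
pose Rg := phi (w + v) t - phi w t - dphi w t * v.
have -> : euler_term l t (w + v) - euler_term l t w - deuler_term l t w * v =
   f0 * (f1 * Rg + Rf * (phi w t + dphi w t * v) - l%:C * dphi w t * (v * v)).
  rewrite /euler_term /deuler_term (mulrDl w v l%:C) opprD cexpD -/f0 -/f1 /Rf
    /Rg.
  by ring.
rewrite rnormM rnorm_cexpN.
set P := t ^+ 2 * phi_cst W T in h1 h2 h3 *.
have P0 : 0 <= P by rewrite mulr_ge0 ?sqr_ge0 ?phi_cst_ge0.
set Y := expR (l * d) in elv.
have Y1 : 1 <= Y.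
  by rewrite (le_trans _ (expR_ge1Dx _))// lerDl mulr_ge0// ltW.
have g1 : rnorm (f1 * Rg) <= rnorm v ^+ 2 * (Y * P).
  rewrite rnormM (_ : _ * (Y * P) = Y * (rnorm v ^+ 2 * P)); last by ring.
  by rewrite ler_pM ?rnorm_ge0// (le_trans h5).
have g2 : rnorm (Rf * (phi w t + dphi w t * v)) <=
    rnorm v ^+ 2 * (Y * P * (4 * l ^+ 2 * (1 + W))).
  rewrite rnormM.
  have -> : rnorm v ^+ 2 * (Y * P * (4 * l ^+ 2 * (1 + W))) =
     (4 * (rnorm v * l) ^+ 2 * Y) * ((1 + W) * P) by ring.
  rewrite ler_pM ?rnorm_ge0//.
    by rewrite (le_trans h4)// ler_wpM2l// mulr_ge0// sqr_ge0.
  apply: (le_trans (ler_rnormD _ _)); rewrite rnormM.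
  have a1 : rnorm w * P <= W * P by rewrite ler_wpM2r.
  have a2 : rnorm (dphi w t) * rnorm v <= P * 1 by rewrite ler_pM ?rnorm_ge0.
  lra.
have g3 : rnorm (l%:C * dphi w t * (v * v)) <= rnorm v ^+ 2 * (Y * P * l).
  rewrite !rnormM rnormR ger0_norm// -expr2.
  rewrite (mulrC _ (rnorm v ^+ 2)) ler_wpM2l ?sqr_ge0// mulrC ler_wpM2r//.
  by rewrite (le_trans h2)// ler_peMl.
apply: (@le_trans _ _ (expR (- (complex.Re w * l)) *
   (rnorm v ^+ 2 * (Y * P) + rnorm v ^+ 2 * (Y * P * (4 * l ^+ 2 * (1 + W))) +
    rnorm v ^+ 2 * (Y * P * l)))).
  rewrite ler_wpM2l ?expR_ge0//; apply: (le_trans (ler_rnormB _ _)).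
  by rewrite lerD// (le_trans (ler_rnormD _ _))// lerD.
set X := expR (- _).
have -> : X * (rnorm v ^+ 2 * (Y * P) + rnorm v ^+ 2 * (Y * P * (4 * l ^+ 2 * (1
  + W))) +
    rnorm v ^+ 2 * (Y * P * l)) =
  rnorm v ^+ 2 * (X * Y * (P * (1 + 4 * l ^+ 2 * (1 + W) + l))) by ring.
rewrite ler_wpM2l ?sqr_ge0//; apply: le_euler_majorant => //.
rewrite ler_wpM2l ?mulr_ge0 ?expR_ge0// ler_wpM2l//.
have lW : 0 <= l * W by rewrite mulr_ge0.
rewrite sqrrD; nra.
Qed.

End euler_term.

(** * Telescoping of the Dirichlet series *)

Section dirichlet_series.
Context {R : realType}.
Local Notation C := (Cplx R).
Implicit Types s : C.
Variable m : R^nat.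
Hypothesis m_ge1 : forall k, 1 <= m k.

Definition psum (k : nat) : R := \sum_(j < k.+1) m j.
Definition lpsum k : R := ln (psum k).
(** Belongs to the step from [psum k] to [psum k.+1], hence to the term of index [k.+1] of the
    series; the term of index 0 has no predecessor and is treated apart in [eulerG]. *)
Definition lratio k : R := lpsum k.+1 - lpsum k.
Definition dirichlet_term (s : C) (k : nat) : C :=
  (m k)%:C * cpow (psum k) (- s).

Local Notation M := psum.
Local Notation l := lpsum.
Local Notation t := lratio.

Lemma psum0 : M 0 = m 0. Proof. by rewrite /M big_ord1. Qed.
Lemma psumS k : M k.+1 = M k + m k.+1. Proof. by rewrite /M big_ord_recr. Qed.

Lemma psum_ge k : k.+1%:R <= M k.
Proof.
elim: k => [|k ih]; first by rewrite psum0 m_ge1.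
by rewrite psumS -addn1 natrD lerD.
Qed.

Lemma psum_ge1 k : 1 <= M k.
Proof. by rewrite (le_trans _ (psum_ge k))// ler1n. Qed.

Lemma psum_gt0 k : 0 < M k.
Proof. by rewrite (lt_le_trans _ (psum_ge1 k)). Qed.

Lemma expR_lpsum k : expR (l k) = M k.
Proof. by rewrite lnK// posrE psum_gt0. Qed.

Lemma lpsum_ge0 k : 0 <= l k.
Proof. by rewrite ln_ge0// psum_ge1. Qed.

Lemma lratio_ge0 k : 0 <= t k.
Proof.
rewrite subr_ge0 -ler_expR !expR_lpsum psumS lerDl.
exact: le_trans ler01 (m_ge1 _).
Qed.

Lemma lpsumS k : l k.+1 = l k + t k. Proof. by rewrite addrC subrK. Qed.

Lemma expRN_lratio k : 1 - expR (- t k) = m k.+1 * expR (- l k.+1).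
Proof.
rewrite /t opprB expRD !expRN !expR_lpsum psumS mulrC.
have := psum_gt0 k.+1; rewrite psumS => h.
by field; rewrite gt_eqF.
Qed.

Lemma dirichlet_termE s k : dirichlet_term s k =
  (m k)%:C * cexp (- (s * (l k)%:C)).
Proof. by rewrite /dirichlet_term cpow_cexp ?psum_gt0// mulNr. Qed.

Lemma rnorm_dirichlet_term s k : rnorm (dirichlet_term s k) =
  m k * expR (- (complex.Re s * l k)).
Proof.
by rewrite dirichlet_termE rnormM rnormR rnorm_cexpN ger0_norm//
  (le_trans ler01).
Qed.

(** Discrete form of the integral test: a (1 - e^(-t)) <= a t <= e^(a t) - 1 compares each term with
    a difference of consecutive M_k^(-a). Since the bound stays finite as a tends to 0, it also
    controls the pole at s = 1 in [real_dirichlet_pole]. *)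
Lemma telescoped_sum_le (a : R) n : 0 < a ->
  a * \sum_(k < n.+1) m k * expR (- ((1 + a) * l k)) <=
  (a + 1) * expR (- (a * l 0)) - expR (- (a * l n)).
Proof.
move=> a0; elim: n => [|n ih].
  rewrite big_ord1; set X := expR (- (a * l 0)).
  have -> : (a + 1) * X - X = a * X by ring.
  rewrite ler_wpM2l ?(ltW a0)//= mulrDl mul1r opprD expRD mulrA.
  rewrite expRN expR_lpsum psum0 mulfV ?mul1r ?lexx//.
  by rewrite gt_eqF// (lt_le_trans ltr01).
rewrite big_ord_recr/= mulrDr.
have -> : m n.+1 * expR (- ((1 + a) * l n.+1)) =
    (1 - expR (- t n)) * expR (- (a * l n.+1)).
  by rewrite expRN_lratio mulrDl mul1r opprD expRD mulrA.
have e : expR (- (a * l n)) = expR (- (a * l n.+1)) * expR (a * t n).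
  by rewrite -expRD lpsumS; congr expR; ring.
have h1 := expR_ge1Dx (a * t n); have h2 := expR_ge1Dx (- t n).
have h3 : a * (1 - expR (- t n)) <= expR (a * t n) - 1.
  apply: (@le_trans _ _ (a * t n)); last by lra.
  by rewrite ler_wpM2l ?(ltW a0)//; lra.
have := ler_wpM2l (expR_ge0 (- (a * l n.+1))) h3.
move: ih; rewrite e; set X := expR (- (a * l n.+1)).
lra.
Qed.

Lemma is_cvg_dirichlet_abs (a : R) : 0 < a ->
  cvgn (series (fun k => m k * expR (- ((1 + a) * l k)))).
Proof.
move=> a0; apply: nondecreasing_is_cvgn.
  apply: nondecreasing_series => k _ _.
  by rewrite mulr_ge0 ?expR_ge0// (le_trans ler01).
exists ((a + 1) * expR (- (a * l 0)) / a) => _ [n _ <-].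
rewrite ler_pdivlMr// mulrC.
case: n => [|n].
  by rewrite /series/= big_nil mulr0 mulr_ge0 ?expR_ge0// addr_ge0// ltW.
rewrite /series/= big_mkord (le_trans (telescoped_sum_le n a0))//.
by rewrite gerBl expR_ge0.
Qed.

Lemma is_cvg_dirichlet_term_abs s : 1 < complex.Re s ->
  cvgn (series (fun k => rnorm (dirichlet_term s k))).
Proof.
move=> s1; rewrite (_ : (fun _ => _) =
  fun k => m k * expR (- ((1 + (complex.Re s - 1)) * l k))).
  by apply: is_cvg_dirichlet_abs; rewrite subr_gt0.
by apply/funext => k; rewrite rnorm_dirichlet_term subrKC.
Qed.

Lemma is_cvg_dirichlet_term s : 1 < complex.Re s ->
  cvgn (series (dirichlet_term s)).
Proof. by move=> s1; apply: cvg_cseries_rnorm;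
  exact: is_cvg_dirichlet_term_abs. Qed.

Lemma cvg_expRN_lpsum (a : R) : 0 < a -> expR (- (a * l k)) @[k --> \oo] -->
  (0:R).
Proof.
move=> a0; apply: (@cvg_comp _ _ _ (fun k => a * l k) (fun x => expR (- x)) _
  +oo).
  apply/cvgryPge => A; near=> k.
  rewrite -ler_pdivrMl// -ler_expR expR_lpsum (le_trans _ (psum_ge k))//.
  rewrite -natr1 (@le_trans _ _ k%:R)//; last by rewrite lerDl.
  near: k; exact: nbhs_infty_ger.
exact: cvgr_expR.
Unshelve. all: by end_near. Qed.

Definition euler_summand (s : C) (k : nat) : C :=
  euler_term (l k.+1) (t k) (s - 1).

(* This is (s - 1) zeta(s), continued: (s - 1) m_k M_k^(-s) is split as
   euler_summand + M_(k-1)^(1-s) - M_k^(1-s), and the last two terms telescope.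
     *)
Definition eulerG (s : C) : C :=
  s * cexp (- ((s - 1) * (l 0)%:C)) + limn (series (euler_summand s)).

(** A finite identity, valid for every s. As m_0 = M_0, the first Dirichlet term equals (s - 1)
    M_0^(1 - s); together with the initial boundary term M_0^(1 - s) it gives the s M_0^(1 - s) of
    [eulerG]. The final boundary term tends to 0 when Re s > 1. *)
Lemma sum_euler_summand s n : series (euler_summand s) n =
  (s - 1) * series (dirichlet_term s) n.+1 - s * cexp (- ((s - 1) * (l 0)%:C)) +
  cexp (- ((s - 1) * (l n)%:C)).
Proof.
have dE k : (s - 1) * dirichlet_term s k = ((s - 1) * (m k * expR (- l k))%:C) *
    cexp (- ((s - 1) * (l k)%:C)).
  rewrite dirichlet_termE; have -> : - (s * (l k)%:C) =
    (- l k)%:C + - ((s - 1) * (l k)%:C) :> C.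
    by rewrite rmorphN/=; ring.
  by rewrite cexpD cexpR rmorphM/=; ring.
elim: n => [|n ih].
  rewrite /series/= big_nil big_nat1 dE expRN expR_lpsum psum0 mulfV ?rmorph1.
    ring.
  by rewrite gt_eqF// (lt_le_trans ltr01).
rewrite seriesSr ih (seriesSr _ n.+1) mulrDr dE -expRN_lratio /euler_summand
  /euler_term /phi.
have -> : cexp (- ((s - 1) * (l n)%:C)) =
    cexp (- ((s - 1) * (l n.+1)%:C)) * cexp ((s - 1) * (t n)%:C).
  by rewrite -cexpD lpsumS rmorphD/=; congr cexp; ring.
ring.
Qed.

Lemma cvg_sum_euler_summand s : 1 < complex.Re s ->
  series (euler_summand s) @ \oo -->
  (s - 1) * limn (series (dirichlet_term s)) - s * cexp (- ((s - 1) * (l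
    0)%:C)).
Proof.
move=> s1; set Z := limn _; rewrite -[X in _ --> X]addr0.
have -> : series (euler_summand s) = fun n => (s - 1) * series (dirichlet_term
  s) n.+1 -
    s * cexp (- ((s - 1) * (l 0)%:C)) + cexp (- ((s - 1) * (l n)%:C)).
  by apply/funext => n; exact: sum_euler_summand.
apply: ccvgD; first apply: ccvgB.
- apply: ccvgM; first exact: cvg_cst.
  have := is_cvg_dirichlet_term s1; rewrite -/Z => h.
  by move: (h); rewrite -(@cvg_shiftS C).
- exact: cvg_cst.
- apply/rcvg0P; under eq_fun do rewrite sub0r rnormN rnorm_cexpN.
  by apply: cvg_expRN_lpsum; rewrite cReD cReN subr_gt0.
Qed.

Lemma dirichlet_eulerG s : 1 < complex.Re s ->
  (s - 1) * limn (series (dirichlet_term s)) = eulerG s.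
Proof.
by move=> s1; rewrite /eulerG (cvg_lim _ (cvg_sum_euler_summand s1))//; ring.
Qed.

End dirichlet_series.

(** * The limit at s = 1 along the real axis *)

Section euler_continuation.
Context {R : realType}.
Local Notation C := (Cplx R).
Implicit Types s : C.
Variable m : R^nat.
Hypothesis m_ge1 : forall k, 1 <= m k.

Local Notation M := (psum m).
Local Notation l := (lpsum m).
Local Notation t := (lratio m).
Local Notation q := (fun k => m k.+1 / M k.+1).

Let m_ge0 k : 0 <= m k := le_trans ler01 (m_ge1 k).

Lemma qratio_ge0 k : 0 <= q k.
Proof. by rewrite divr_ge0 ?(ltW (psum_gt0 m_ge1 _))// m_ge0. Qed.

(** Since e^(-t_k) = 1 - q_k tends to 1, e^(t_k) is bounded; and t_k <= e^(t_k) - 1 = e^(t_k)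
    q_k. *)
Lemma lratio_bound : q @ \oo --> 0 ->
  exists D, [/\ 0 < D, forall k, t k <= D & forall k, t k <= D * q k].
Proof.
move=> q0.
have eN k : expR (- t k) = 1 - q k.
  have := expRN_lratio m_ge1 k; rewrite (expRN (l k.+1)) expR_lpsum//; lra.
have et : expR (t k) @[k --> \oo] --> (1 : R).
  have -> : (fun k => expR (t k)) = (fun k => (1 - q k)^-1).
    by apply/funext => k; rewrite -eN expRN invrK.
  rewrite -[X in _ --> X]invr1; apply: cvgV; first by rewrite oner_eq0.
  rewrite -[X in _ --> X]subr0; apply: cvgB => //; exact: cvg_cst.
have /cvg_seq_bounded[B [_ hB]] : cvgn (fun k => expR (t k)) by apply/cvg_ex;
  exists 1.
have eB k : expR (t k) <= `|B| + 1.
  have := hB (`|B| + 1); rewrite (le_lt_trans (ler_norm _)) ?ltrDl//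
    => /(_ isT k I) /=.
  by rewrite ger0_norm ?expR_ge0.
exists (`|B| + 1); split => [|k|k]; first by rewrite ltr_wpDl.
  by rewrite (le_trans _ (eB k))// (le_trans _ (expR_ge1Dx _))// lerDr.
have h : t k <= expR (t k) * q k.
  have : q k = 1 - expR (- t k) by rewrite eN subKr.
  move=> ->; rewrite mulrBr mulr1 expRN mulfV ?gt_eqF ?expR_gt0//.
  by have := expR_ge1Dx (t k); lra.
by rewrite (le_trans h)// ler_wpM2r// qratio_ge0.
Qed.

Lemma cvg_lratio : q @ \oo --> 0 -> t @ \oo --> 0.
Proof.
move=> q0; have [D [D0 _ tD]] := lratio_bound q0.
have : D * q k @[k --> \oo] --> (0 : R).
  by rewrite -[X in _ --> X](mulr0 D); apply: cvgM => //; exact: cvg_cst.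
move=> /cvgrPdist_lt Dq; apply/cvgrPdist_lt => e /Dq; apply: filterS => k.
rewrite !sub0r !normrN => /(le_lt_trans (ler_norm _)); apply: le_lt_trans.
by rewrite ger0_norm ?(lratio_ge0 m_ge1).
Qed.

Lemma cvg_main_term : s * cexp (- ((s - 1) * (l 0)%:C)) @[s --> (1 : C)] --> (1
  : C).
Proof.
pose r (s : C) : R := rnorm (1 - s : C).
have h0 : r s @[s --> (1 : C)] --> (0 : R) := cvg_rdist (1 : C).
pose g (s : C) : R := 3 * (r s * l 0) * expR (r s * l 0).
have g0 : g s @[s --> (1 : C)] --> (0 : R).
  have h1 : r s * l 0 @[s --> (1 : C)] --> (0 * l 0 : R).
    exact: (cvgM h0 (cvg_cst _)).
  have h2 : expR (r s * l 0) @[s --> (1 : C)] --> expR (0 * l 0 : R).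
    by apply: (cvg_comp _ _ h1); exact: continuous_expR.
  have := cvgM (cvgM (cvg_cst (3 : R)) h1) h2; rewrite mul0r mulr0 mul0r; exact.
have h : cexp (- ((s - 1) * (l 0)%:C)) @[s --> (1 : C)] --> (1 : C).
  apply: (rcvg_squeeze g0); near=> s; rewrite rdistC.
  apply: (le_trans (cexp_taylor0 _)).
  by rewrite rnormN rnormM rnormR (ger0_norm (lpsum_ge0 m_ge1 _)) rdistC.
rewrite -[X in _ --> X]mulr1; by apply: ccvgM h => A.
Unshelve. all: by end_near. Qed.

(** Every summand carries a factor w, so a fixed head of the series is O(w). The tail is small
    compared with w times the sum of the m_k M_k^(-1-w), which [telescoped_sum_le] bounds uniformly
    in w. *)
Lemma real_dirichlet_pole : q @ \oo --> 0 ->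
  ((s - 1)%:C * limn (series (dirichlet_term m s%:C)) : C) @[s --> (1 : R)^'+]
    --> (1 : C).
Proof.
move=> q0; have [D [D0 tD tqD]] := lratio_bound q0.
have t0 := cvg_lratio q0.
pose K := D * phi_cst 1 D.
have K0 : 0 <= K by rewrite mulr_ge0 ?phi_cst_ge0// ltW.
apply/rcvgP => e e0.
have e4 : 0 < e / 4 by rewrite divr_gt0.
have Kt0 k : 0 <= K * t k by apply: mulr_ge0 => //; exact: (lratio_ge0 m_ge1).
have e8 : 0 < e / 8 by rewrite divr_gt0.
(* The weighted tail below is at most 2, so e / 8 contributes e / 4. *)
have [N _ tN] : \forall k \near \oo, K * t k <= e / 8.
  have : K * t k @[k --> \oo] --> (0:R).
    by rewrite -[X in _ --> X](mulr0 K); apply: cvgM => //; exact: cvg_cst.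
  move=> /cvgrPdist_le/(_ _ e8).
  by apply: filterS => k; rewrite sub0r normrN => /(le_trans (ler_norm _)).
pose CN := \sum_(0 <= k < N) K * t k * m k.+1.
have CN0 : 0 <= CN.
  by apply: sumr_ge0 => k _; exact: (mulr_ge0 (Kt0 k) (m_ge0 _)).
pose mainf (s : C) : C := s * cexp (- ((s - 1) * (l 0)%:C)).
have mainf1 : mainf s @[s --> (1 : C)] --> (1 : C) := cvg_main_term.
have : \forall s \near (1 : C), rnorm (1 - mainf s) < e / 4.
  exact: (proj1 (@rcvgP R C C (nbhs (1 : C)) _ mainf 1) mainf1).
move=> /nbhs_ballP[d' /= /gt0_C[d d0 ->]] main.
(* [d] serves the main term, 1 the choice W = 1 in [phi_cst], and the last quotient makes the head
   at most e / 4. *)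
pose a := Num.min (Num.min d 1) (e / 4 / (CN + 1)).
have a0 : 0 < a by rewrite !lt_min d0 ltr01 divr_gt0// ltr_wpDl.
near=> s.
have s1 : 1 < s by near: s; exact: nbhs_right_gt.
have sa : s - 1 < a.
  by rewrite ltrBlDl; near: s; apply: nbhs_right_lt; rewrite ltrDl.
have : s - 1 < a by [].
rewrite !lt_min => /andP[/andP[sd sm1] sCN].
pose w := s - 1; have w0 : 0 < w by rewrite subr_gt0.
have := main s%:C; rewrite -ball_normE /= rnormE ltcRC => /(_ _).
have -> : rnorm (1 - s%:C : C) < d.
  by rewrite rdistC -[1]/(1%:C) -rmorphB rnormR gtr0_norm.
move=> /(_ isT); set Mn := (X in rnorm (1 - X)) => main_e.
set Z := limn _.
have sR1 : 1 < complex.Re (s%:C : C) by [].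
have /rcvgP/(_ _ e4) := cvg_sum_euler_summand m_ge1 sR1;
  rewrite -/Z -/Mn => -[N' _ N'P].
(* One partial sum replaces the limit: [N'] keeps the error below e / 4, and [N] separates head from
   tail. *)
pose n := maxn N N'.
have /N'P h : (N' <= n)%N by rewrite leq_maxr.
pose y k := m k * expR (- ((1 + w) * l k)).
have y0 k : 0 <= y k by rewrite mulr_ge0 ?expR_ge0// m_ge0.
have eterm_le k : rnorm (euler_summand m s%:C k) <= w * (K * t k * y k.+1).
  have tk : 0 <= t k <= D by rewrite (lratio_ge0 m_ge1)// tD.
  have w1 : rnorm (s%:C - 1 : C) <= 1.
    by rewrite -[1]/(1%:C) -rmorphB rnormR gtr0_norm// ltW.
  apply: (le_trans (euler_term_bound (l k.+1) tk w1)).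
  rewrite -[1]/(1%:C) -rmorphB rnormR (gtr0_norm w0) /= -/w.
  have -> : y k.+1 = q k * expR (- (w * l k.+1)).
    by rewrite /y mulrDl mul1r opprD expRD mulrA (expRN (l k.+1)) expR_lpsum.
  rewrite /K; set X := expR _; set P := phi_cst _ _.
  have P0 : 0 <= P by exact: phi_cst_ge0.
  have -> : X * (w * (t k ^+ 2 * P)) = (w * X * t k * P) * t k by ring.
  have -> : w * (D * P * t k * (q k * X)) = (w * X * t k * P) * (D * q k)
    by ring.
  rewrite ler_wpM2l// !mulr_ge0 ?expR_ge0 ?(ltW w0)//.
  exact: (lratio_ge0 m_ge1).
have sum_le : rnorm (series (euler_summand m s%:C) n) <= w * CN + e / 4.
  rewrite /series/= (big_cat_nat (n := N))//=; last exact: leq_maxl.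
  apply: (le_trans (ler_rnormD _ _)); apply: lerD.
    apply: (le_trans (rnorm_sum _ _ _)); rewrite mulr_sumr.
    apply: ler_sum => k _; apply: (le_trans (eterm_le k)).
    rewrite ler_wpM2l ?(ltW w0)// ler_wpM2l ?Kt0//.
    rewrite ler_piMr ?m_ge0// expR_le1 oppr_le0; apply: mulr_ge0;
      last exact: lpsum_ge0.
    by rewrite addr_ge0// ltW.
  apply: (le_trans (rnorm_sum _ _ _)).
  apply: (@le_trans _ _ (\sum_(N <= k < n) e / 8 * (w * y k.+1))).
    rewrite big_nat_cond [leRHS]big_nat_cond.
    apply: ler_sum => k; rewrite andbT => /andP[Nk _].
    apply: (le_trans (eterm_le k)).
    have -> : w * (K * t k * y k.+1) = K * t k * (w * y k.+1) by ring.
    by rewrite ler_wpM2r ?(mulr_ge0 (ltW w0))//; exact: tN.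
  rewrite -mulr_sumr -mulr_sumr.
  have : w * \sum_(N <= k < n) y k.+1 <= 2.
    apply: (@le_trans _ _ (w * \sum_(k < n.+1) y k)).
      rewrite ler_wpM2l ?(ltW w0)// -(big_mkord xpredT y) big_nat_recl//.
      rewrite (@le_trans _ _ (\sum_(0 <= k < n) y k.+1))// ?lerDr//.
      rewrite [leRHS](big_cat_nat (n := N))//= ?leq_maxl// lerDr.
      by apply: sumr_ge0.
    apply: (le_trans (telescoped_sum_le m_ge1 n w0)).
    rewrite (@le_trans _ _ (w + 1))//; last by rewrite /w; lra.
    rewrite (@le_trans _ _ ((w + 1) * expR (- (w * l 0))))// ?gerBl ?expR_ge0//.
    rewrite ler_piMr ?(addr_ge0 (ltW w0) ler01)// expR_le1 oppr_le0.
    exact: (mulr_ge0 (ltW w0) (lpsum_ge0 m_ge1 _)).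
  by move=> h2; have := ler_wpM2l (ltW e8) h2; lra.
have wCN : w * CN <= e / 4.
  have : w * (CN + 1) < e / 4 by rewrite -ltr_pdivlMr// ltr_wpDl.
  rewrite mulrDr; lra.
have -> : (s - 1)%:C = s%:C - 1 :> C by rewrite rmorphB.
set wZ := (s%:C - 1) * Z in h *.
have -> : 1 - wZ = (1 - Mn) - (wZ - Mn - series (euler_summand m s%:C) n) -
    series (euler_summand m s%:C) n by ring.
have := ler_rnormB (1 - Mn) (wZ - Mn - series (euler_summand m s%:C) n).
have := ler_rnormB ((1 - Mn) - (wZ - Mn - series (euler_summand m s%:C) n))
  (series (euler_summand m s%:C) n).
lra.
Unshelve. all: by end_near. Qed.

End euler_continuation.

(** * Holomorphy under the quadratic summability condition *)

Section quadratic_condition.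
Context {R : realType}.
Local Notation C := (Cplx R).
Implicit Types s z : C.
Variable m : R^nat.
Hypothesis m_ge1 : forall k, 1 <= m k.

Local Notation M := (psum m).
Local Notation l := (lpsum m).
Local Notation t := (lratio m).
Local Notation q := (fun k => m k.+1 / M k.+1).

Variable a : R.
Hypothesis a01 : 0 < a <= 1.
Hypothesis quad : cvgn (series (fun k => m k ^+ 2 / M k `^ (1 + a))).

Let quad_term k : m k ^+ 2 / M k `^ (1 + a) = (m k / M k) ^+ 2 * expR ((1 - a) *
  l k).
Proof.
rewrite /powR gt_eqF ?psum_gt0// -/(l k) -expRN expr_div_n -(expR_lpsum m_ge1).
rewrite -(expRM_natl 2) -expRN -[RHS]mulrA -expRD; congr (_ * expR _).
ring.
Qed.

(** The terms of [quad] tend to 0, and they dominate (m_k / M_k)^2 because M_k >= 1 and a <= 1. *)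
Lemma cvg_qratio : q @ \oo --> 0.
Proof.
have h := cvg_series_cvg_0 quad.
have : (m k / M k) ^+ 2 @[k --> \oo] --> (0 : R).
  apply/cvgrPdist_lt => e e0; move/cvgrPdist_lt/(_ _ e0) : h.
  apply: filterS => k; rewrite !sub0r !normrN quad_term; apply: le_lt_trans.
  rewrite !ger0_norm ?sqr_ge0//; last by rewrite mulr_ge0 ?sqr_ge0 ?expR_ge0.
  rewrite ler_peMr ?sqr_ge0// (le_trans _ (expR_ge1Dx _))// lerDl.
  by case/andP : a01 => _ a1; rewrite mulr_ge0 ?subr_ge0// lpsum_ge0.
move=> h2; have : (m k / M k) @[k --> \oo] --> (0 : R).
  apply/cvgrPdist_lt => e e0; have e2 : 0 < e ^+ 2 by rewrite exprn_gt0.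
  move/cvgrPdist_lt/(_ _ e2) : h2; apply: filterS => k.
  rewrite !sub0r !normrN normrX ltr_pXn2r// ?nnegrE//; exact: ltW.
by rewrite -(@cvg_shiftS R).
Qed.

Lemma is_cvg_lratio_sqr :
  cvgn (series (fun k => t k ^+ 2 * expR ((1 - a) * l k.+1))).
Proof.
have [D [D0 _ tD]] := lratio_bound m_ge1 cvg_qratio.
pose u k := m k ^+ 2 / M k `^ (1 + a).
have cu : cvgn (series (fun k => u k.+1)).
  have -> : series (fun k => u k.+1) = (fun n => series u n.+1 - u 0).
    by apply/funext => n; rewrite /series/= big_nat_recl//= addrC addKr.
  apply/cvg_ex; exists (limn (series u) - u 0).
  apply: cvgB; last exact: cvg_cst.
  have h : series u @ \oo --> limn (series u) by exact: quad.
  by move: (h); rewrite -(@cvg_shiftS R).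
have cu2 : cvgn (series (fun k => D ^+ 2 * u k.+1)) by exact: is_cvg_seriesZ.
apply: series_le_cvg cu2 => k.
- by rewrite mulr_ge0 ?sqr_ge0 ?expR_ge0.
- rewrite mulr_ge0 ?sqr_ge0// /u quad_term.
  by rewrite mulr_ge0 ?sqr_ge0 ?expR_ge0.
- rewrite /u quad_term mulrA -exprMn.
  rewrite ler_wpM2r ?expR_ge0// lerXn2r ?nnegrE ?lratio_ge0//.
  by rewrite mulr_ge0 ?(ltW D0)// qratio_ge0.
Qed.

Lemma eulerG1 : eulerG m 1 = 1.
Proof.
rewrite /eulerG subrr mul0r oppr0 cexp0 mulr1.
have -> : series (euler_summand m 1) = fun=> 0.
  apply/funext => n; rewrite /series/= big1// => i _.
  by rewrite /euler_summand subrr /euler_term /phi !mul0r cexp0 add0r subrr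
    mulr0.
by rewrite lim_cst// addr0.
Qed.

Lemma derivable_cexp_affine (b : R) z :
  derivable ((fun s => cexp (- ((s - 1) * b%:C))) : C^o -> C^o) z 1.
Proof.
pose e := cexp (- ((z - 1) * b%:C)).
apply: (@derivable_taylor R _ z (- b%:C * e) (rnorm e * (4 * b ^+ 2 * expR
  `|b|)) 1) => // v v1.
have -> : - ((z + v - 1) * b%:C) = - ((z - 1) * b%:C) + - (v * b%:C) :> C
  by ring.
rewrite cexpD -/e.
have -> : e * cexp (- (v * b%:C)) - e - - b%:C * e * v =
  e * (cexp (- (v * b%:C)) - 1 - - (v * b%:C)) by ring.
rewrite rnormM.
have h := cexp_taylor1 (- (v * b%:C)); rewrite rnormN rnormM rnormR in h.
have -> : rnorm v ^+ 2 * (rnorm e * (4 * b ^+ 2 * expR `|b|)) =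
   rnorm e * (4 * (rnorm v * `|b|) ^+ 2 * expR `|b|).
  by rewrite exprMn real_normK ?num_real//; ring.
rewrite ler_wpM2l ?rnorm_ge0// (le_trans h)// ler_wpM2l//.
  by rewrite mulr_ge0// sqr_ge0.
by rewrite ler_expR ler_piMl.
Qed.

Lemma derivable_eulerG z : a < complex.Re z ->
  derivable (eulerG m : C^o -> C^o) z 1.
Proof.
move=> az; have [T [T0 tT _]] := lratio_bound m_ge1 cvg_qratio.
have [a0 a1] := andP a01.
(* A third of the distance to the line Re s = a, because [euler_majorant] gives away 3 d in the
   exponent. *)
pose d := Num.min 1 ((complex.Re z - a) / 3).
have d01 : 0 < d <= 1.
  by rewrite lt_min ltr01 divr_gt0 ?subr_gt0//= ge_min lexx.
have /andP[d0 d1] := d01.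
have d3 : 3 * d <= complex.Re z - a.
  by rewrite mulrC -ler_pdivlMr// ge_min lexx orbT.
pose W := rnorm (z - 1 : C).
have W0 : 0 <= W by exact: rnorm_ge0.
pose b k := euler_cst W T d * (t k ^+ 2 * expR ((1 - a) * l k.+1)).
have cst0 : 0 <= euler_cst W T d.
  by rewrite /euler_cst divr_ge0 ?sqr_ge0// mulr_ge0 ?phi_cst_ge0//
    mulr_ge0 ?addr_ge0.
have cb : cvgn (series b) by apply: is_cvg_seriesZ; exact: is_cvg_lratio_sqr.
have tkT k : 0 <= t k <= T by rewrite lratio_ge0// tT.
have l0 k : 0 <= l k by exact: lpsum_ge0.
have majb k : euler_majorant (l k.+1) (t k) (z - 1) W T d <= b k.
  rewrite /euler_majorant /b ler_wpM2l// ler_wpM2l ?sqr_ge0// ler_expR.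
  have -> : - (complex.Re (z - 1) * l k.+1) + 3 * d * l k.+1 =
    (3 * d - (complex.Re z - 1)) * l k.+1.
    by rewrite cReD cReN /=; ring.
  by rewrite ler_wpM2r//; lra.
have dser : derivable ((fun s => limn (series (fun k => euler_summand m s k))) :
  C^o -> C^o) z 1.
  apply: (@derivable_series R (fun k s => euler_summand m s k)
     (fun k => deuler_term (l k.+1) (t k) (z - 1)) b z d) => //.
  - by move=> k; apply: (le_trans _ (majb k)); exact: euler_term_le_majorant.
  - by move=> k; apply: (le_trans _ (majb k)); exact: deuler_term_le_majorant.
  - move=> k v vd; rewrite /euler_summand.
    have -> : z + v - 1 = (z - 1) + v :> C by ring.
    apply: (@le_trans _ _ (rnorm v ^+ 2 * euler_majorant (l k.+1) (t k) (z - 1)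
      W T d)).
      exact: euler_term_taylor.
    by rewrite ler_wpM2l ?sqr_ge0.
apply: (@derivableD C C^o C^o (fun s => s * cexp (- ((s - 1) * (l 0)%:C))) _ z 1
  _ dser).
apply: (@derivableM C C^o id _ z 1 (@derivable_id _ _ _ _)).
exact: derivable_cexp_affine.
Qed.

End quadratic_condition.

(** * The limit at s = 1 within the half-plane *)

Section euler_limit.
Context {R : realType}.
Local Notation C := (Cplx R).
Implicit Types s z : C.
Variable m : R^nat.
Hypothesis m_ge1 : forall k, 1 <= m k.
Hypothesis quad : cvgn (series (fun k => m k ^+ 2 / psum m k `^ (1 + 1))).

(** For Re s > 1 the factor M_k^(1 - s) has modulus at most 1, so near 1 the series is bounded by |s
    - 1| times a convergent sum that is independent of s. *)
Lemma cvg_eulerG :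
  eulerG m s @[s --> within (half_plane 1) (nbhs (1 : C))] --> (1 : C).
Proof.
have a01 : 0 < (1 : R) <= 1 by rewrite ltr01 lexx.
have q0 := cvg_qratio m_ge1 a01 quad.
have [T [T0 tT _]] := lratio_bound m_ge1 q0.
have csq := is_cvg_lratio_sqr m_ge1 a01 quad.
pose b k := lratio m k ^+ 2 * phi_cst 1 T.
have cb : cvgn (series b).
  have -> : b = phi_cst 1 T *: (fun k => lratio m k ^+ 2 * expR ((1 - 1) * lpsum
    m k.+1)).
    apply/funext => k; rewrite /b -[RHS]/(_ * _) subrr mul0r expR0 mulr1; ring.
  exact: is_cvg_seriesZ.
pose mainf (s : C) : C := s * cexp (- ((s - 1) * (lpsum m 0)%:C)).
have mainf1 : mainf s @[s --> (1 : C)] --> (1 : C) := cvg_main_term m_ge1.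
pose B := limn (series b).
have FF : Filter (within (half_plane 1) (nbhs (1 : C))) by exact: within_filter.
apply: (proj2 (@rcvgP R C C _ FF (eulerG m) 1)) => e e0.
have e2 : 0 < e / 2 by rewrite divr_gt0.
have h1 : \forall s \near (1 : C), rnorm (1 - mainf s) < e / 2.
  exact: (proj1 (@rcvgP R C C (nbhs (1 : C)) _ mainf 1) mainf1).
have BB : 0 < `|B| + 1 by rewrite ltr_wpDl.
have h2 := near_rnorm_lt (1 : C) (divr_gt0 e2 BB).
have h3 := near_rnorm_lt (1 : C) (@ltr01 R).
rewrite near_withinE; near=> s => s1; rewrite /half_plane/= in s1.
have ms : rnorm (1 - mainf s) < e / 2 by near: s.
have sB : rnorm (1 - s : C) < e / 2 / (`|B| + 1) by near: s.
have sle1 : rnorm (1 - s : C) < 1 by near: s.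
have s0 : 0 < complex.Re (s - 1 : C) by rewrite cReD cReN subr_gt0.
have eb k : rnorm (euler_summand m s k) <= rnorm (s - 1 : C) * b k.
  have tk : 0 <= lratio m k <= T by rewrite lratio_ge0// tT.
  have w1 : rnorm (s - 1 : C) <= 1 by rewrite rdistC ltW.
  apply: (le_trans (euler_term_bound _ tk w1)).
  rewrite -[leRHS]mul1r ler_wpM2r ?(mulr_ge0 (rnorm_ge0 _)) ?sqr_phi_cst_ge0//.
  by rewrite expR_le1 oppr_le0 mulr_ge0 ?lpsum_ge0// ltW.
have cbs : cvgn (series (fun k => rnorm (s - 1 : C) * b k)).
  by apply: is_cvg_seriesZ; exact: cb.
have ce : cvgn (series (euler_summand m s)).
  apply: cvg_cseries_rnorm; apply: series_le_cvg cbs => k; rewrite ?rnorm_ge0//.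
  by rewrite (le_trans _ (eb k))// rnorm_ge0.
have le := rnorm_lim_series ce cbs eb.
have limE : limn (series (fun k => rnorm (s - 1 : C) * b k)) =
  rnorm (s - 1 : C) * B.
  by rewrite lim_seriesZ.
rewrite limE in le.
rewrite /eulerG -/(mainf s).
have -> : 1 - (mainf s + limn (series (euler_summand m s))) =
  (1 - mainf s) - limn (series (euler_summand m s)) by ring.
apply: (le_lt_trans (ler_rnormB _ _)).
have : rnorm (s - 1 : C) * B <= e / 2.
  rewrite (le_trans (ler_wpM2l (rnorm_ge0 _) (ler_norm B)))//.
  rewrite (@le_trans _ _ (rnorm (s - 1 : C) * (`|B| + 1)))//.
    by rewrite ler_wpM2l ?rnorm_ge0// lerDl.
  by rewrite -ler_pdivlMr// rdistC ltW.
lra.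
Unshelve. all: by end_near. Qed.

End euler_limit.

(** * Meromorphic continuation *)

Section meromorphic_continuation.
Context {R : realType}.
Local Notation C := (Cplx R).
Implicit Types s z : C.

Lemma open_half_plane (a : R) : open (half_plane a : set C).
Proof.
rewrite openE => s; rewrite /half_plane/= => sa.
have sa0 : 0 < complex.Re s - a by rewrite subr_gt0.
apply: filterS (near_rnorm_lt s sa0) => z sz; rewrite /half_plane/=.
have := le_lt_trans (ler_Re_rnorm _) sz; rewrite cReD cReN ltr_norml.
by move=> /andP[_]; lra.
Qed.

Variable m : R^nat.
Hypothesis m_ge1 : forall k, 1 <= m k.
Variable a : R.
Hypothesis a01 : 0 < a <= 1.
Hypothesis quad : cvgn (series (fun k => m k ^+ 2 / psum m k `^ (1 + a))).

Lemma derivable_euler_quotient z : a < complex.Re z -> z != 1 ->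
  derivable ((fun s => eulerG m s / (s - 1)) : C^o -> C^o) z 1.
Proof.
move=> az z1; apply: (@derivableM C C^o (eulerG m) (fun s => (s - 1)^-1) z 1
  (derivable_eulerG m_ge1 a01 quad az)).
apply: (@derivableV C C^o (fun s => s - 1)); first by rewrite subr_eq0.
exact: (@derivableB C C^o C^o id (cst 1) _ _ (@derivable_id _ _ _ _)
  (@derivable_cst _ _ _ _ _ _)).
Qed.

Lemma dirichlet_euler_quotient s : 1 < complex.Re s ->
  limn (series (dirichlet_term m s)) = eulerG m s / (s - 1).
Proof.
move=> s1; rewrite -dirichlet_eulerG// mulrC mulKf// subr_eq0.
by apply: contraTneq s1 => ->; rewrite ltxx.
Qed.

(** The quotient [eulerG m s / (s - 1)] agrees with the series only for Re s > 1; openness of this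
    half-plane makes the agreement local, which transfers differentiability. *)
Lemma holomorphic_dirichlet :
  holomorphic_on (half_plane 1) (fun s => limn (series (dirichlet_term m s))).
Proof.
move=> z z1; rewrite /half_plane/= in z1.
apply: (@near_eq_derivable C C^o C^o (fun s => eulerG m s / (s - 1))).
  have : nbhs z (half_plane 1 : set C).
    by apply: open_nbhs_nbhs; split => //; exact: open_half_plane.
  apply: filterS => s s1; apply/esym.
  exact: dirichlet_euler_quotient.
apply: derivable_euler_quotient; last by apply: contraTneq z1 => ->;
  rewrite ltxx.
by apply: le_lt_trans z1; case/andP : a01.
Qed.

Lemma pole_euler_quotient : a < 1 -> pole (fun s => eulerG m s / (s - 1)) 1 1%N
  1.
Proof.
move=> a1; split => //.
exists (half_plane a), (eulerG m); split => //.
- by split; [exact: open_half_plane | exact: a1].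
- by move=> z az; exact: (derivable_eulerG m_ge1 a01 quad az).
- exact: eulerG1.
Qed.

Lemma meromorphic_euler_quotient : a < 1 ->
  meromorphic_on (half_plane a) (fun s => eulerG m s / (s - 1)).
Proof.
move=> a1; exists [set 1]; split => [_ ->||z [az /eqP z1]|_ ->].
- exact: a1.
- move=> z az; have [->|z1] := eqVneq z 1.
    by move=> /(_ setT filterT)[y [+ yE _]]; rewrite yE eqxx.
  have z10 : 0 < rnorm (z - 1).
    by rewrite lt_neqAle rnorm_ge0 eq_sym rnorm_eq0 subr_eq0 z1.
  move=> /(_ _ (near_rnorm_lt z z10))[y [_ ->]].
  by rewrite /= ltxx.
- exact: derivable_euler_quotient.
- by exists 1%N, 1; exact: pole_euler_quotient.
Qed.

End meromorphic_continuation.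

(** * Hilbert spaces and traces *)

Lemma cRe_sum (R : realType) I (r : seq I) (P : pred I) (F : I -> Cplx R) :
  complex.Re (\sum_(i <- r | P i) F i) = \sum_(i <- r | P i) complex.Re (F i).
Proof. by elim/big_rec2 : _ => // i x y _ <-; rewrite cReD. Qed.

Lemma cIm_sum (R : realType) I (r : seq I) (P : pred I) (F : I -> Cplx R) :
  complex.Im (\sum_(i <- r | P i) F i) = \sum_(i <- r | P i) complex.Im (F i).
Proof. by elim/big_rec2 : _ => // i x y _ <-; rewrite cImD. Qed.

Section inner_product.
Context {R : realType} {h : hilbertType R}.
Local Notation C := (Cplx R).
Implicit Types (x y z : h) (a b : C).
Local Notation ip := (inner h).

Lemma conj_cplx a : Num.conj a = (complex.Re a -i* complex.Im a) :> C.
Proof. by case: a. Qed.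

Lemma conj_RC (r : R) : Num.conj (r%:C : C) = r%:C.
Proof. by rewrite conj_cplx /= oppr0. Qed.

Lemma ipDl x y z : ip (x + y) z = ip x z + ip y z.
Proof. exact: linearDl. Qed.
Lemma ipDr x y z : ip z (x + y) = ip z x + ip z y.
Proof. exact: linearDr. Qed.
Lemma ipNr x z : ip z (- x) = - ip z x.
Proof. exact: linearNr. Qed.
Lemma ipBl x y z : ip (x - y) z = ip x z - ip y z.
Proof. exact: linearBl. Qed.
Lemma ipBr x y z : ip z (x - y) = ip z x - ip z y.
Proof. exact: linearBr. Qed.
Lemma ip0l z : ip 0 z = 0.
Proof. exact: linear0l. Qed.
Lemma ip0r z : ip z 0 = 0.
Proof. exact: linear0r. Qed.
Lemma ipZl a x z : ip (a *: x) z = a * ip x z.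
Proof. exact: linearZl_LR. Qed.
Lemma ipZr a x z : ip z (a *: x) = Num.conj a * ip z x.
Proof. exact: linearZr_LR. Qed.
Lemma ipC x y : ip x y = Num.conj (ip y x).
Proof. by rewrite [LHS]hermC expr0 mul1r. Qed.

Lemma ip_norm x : ip x x = (rnorm x ^+ 2)%:C.
Proof. by rewrite -inner_norm rnormE rmorphXn. Qed.

Lemma ip_suml I (r : seq I) (P : pred I) (F : I -> h) z :
  ip (\sum_(i <- r | P i) F i) z = \sum_(i <- r | P i) ip (F i) z.
Proof. by elim/big_rec2 : _ => [|i y1 y2 _ <-]; rewrite ?ip0l ?ipDl. Qed.
Lemma ip_sumr I (r : seq I) (P : pred I) (F : I -> h) z :
  ip z (\sum_(i <- r | P i) F i) = \sum_(i <- r | P i) ip z (F i).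
Proof. by elim/big_rec2 : _ => [|i y1 y2 _ <-]; rewrite ?ip0r ?ipDr. Qed.

Lemma ip_eq0C x y : ip x y = 0 -> ip y x = 0.
Proof. by move=> xy; rewrite ipC xy rmorph0. Qed.

Lemma rnormD_ortho x y : ip x y = 0 -> rnorm (x + y) ^+ 2 =
  rnorm x ^+ 2 + rnorm y ^+ 2.
Proof.
move=> xy; apply: complexI; rewrite -ip_norm ipDl !ipDr xy (ip_eq0C xy).
by rewrite !ip_norm rmorphD/= addr0 add0r.
Qed.

Lemma cauchy_schwarz x y : rnorm (ip x y) <= rnorm x * rnorm y.
Proof.
have [->|y0] := eqVneq y 0; first by rewrite ip0r !rnorm0 mulr0.
have ry : 0 < rnorm y by rewrite lt_neqAle eq_sym rnorm_eq0 y0 rnorm_ge0.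
pose a := ip x y / ip y y.
have yy : ip y y != 0.
  by rewrite ip_norm; apply: contra_neq y0 => -[/eqP];
    rewrite expf_eq0/= rnorm_eq0 => /eqP.
have o : ip (x - a *: y) (a *: y) = 0.
  by rewrite ipZr ipBl ipZl divfK// subrr mulr0.
have := rnormD_ortho o; rewrite subrK => e.
have : rnorm (a *: y) ^+ 2 <= rnorm x ^+ 2 by rewrite e lerDr sqr_ge0.
rewrite ler_pXn2r ?nnegrE ?rnorm_ge0// rnormZ rnormM rnormV ip_norm rnormR.
rewrite ger0_norm ?sqr_ge0// expr2 invfM mulrA divfK ?gt_eqF//.
by rewrite ler_pdivrMr.
Qed.

Lemma ip_inj x y : (forall z, ip x z = ip y z) -> x = y.
Proof.
move=> xy; apply/eqP; rewrite -subr_eq0 -rnorm_eq0 -sqrf_eq0; apply/eqP.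
by apply: complexI; rewrite -ip_norm ipBl xy subrr.
Qed.

Lemma cvg_ipl T (F : set_system T) (FF : Filter F) (f : T -> h) x y :
  f @ F --> x -> ip (f t) y @[t --> F] --> ip x y.
Proof.
move=> /rcvg0P fx; pose g t := rnorm (x - f t) * rnorm y.
have g0 : g t @[t --> F] --> (0 : R).
  by rewrite -(mul0r (rnorm y)); apply: cvgM => //; exact: cvg_cst.
apply: (rcvg_squeeze g0); apply: nearW => t.
by rewrite -ipBl cauchy_schwarz.
Qed.

(** If x were nonzero, some y in D would be closer to x than |x|, and then |x|^2 = <x - y, x> <
    |x|^2. *)
Lemma dense_ortho0 (D : set h) x : dense D -> (forall y,
  D y -> ip x y = 0) -> x = 0.
Proof.
move=> dD xD; apply/eqP; rewrite -rnorm_eq0; apply/negPn/negP => x0.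
have rx : 0 < rnorm x by rewrite lt_neqAle eq_sym x0 rnorm_ge0.
have [] := dD ([set y | rnorm (x - y) < rnorm x]).
- by exists x; rewrite /= subrr rnorm0.
- rewrite openE => y /= xy.
  have e0 : 0 < rnorm x - rnorm (x - y) by rewrite subr_gt0.
  apply: filterS (near_rnorm_lt y e0) => z /= yz.
  by have := ler_rnormD (x - y) (y - z); rewrite addrA subrK; lra.
move=> y [/= xy /xD xy0].
have : rnorm x ^+ 2 <= rnorm (x - y) * rnorm x.
  have : rnorm (ip (x - y) x) <= rnorm (x - y) * rnorm x
    by exact: cauchy_schwarz.
  by rewrite ipBl (ip_eq0C xy0) subr0 ip_norm rnormR ger0_norm ?sqr_ge0.
by rewrite expr2 ler_pM2r// leNgt xy.
Qed.

(** Polarization with x + y and x + i y. It is stated on a subspace because L is linear only on its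
    domain. *)
Lemma polar0 (V : set h) (S : h -> h) :
  (forall x y, V x -> V y -> V (x + y)) -> (forall a x, V x -> V (a *: x)) ->
  (forall x y, V x -> V y -> S (x + y) = S x + S y) ->
  (forall a x, V x -> S (a *: x) = a *: S x) ->
  (forall x, V x -> ip (S x) x = 0) ->
  forall x y, V x -> V y -> ip (S x) y = 0.
Proof.
move=> VD VZ SD SZ q0 x y Vx Vy.
have h1 : ip (S x) y + ip (S y) x = 0.
  have := q0 _ (VD _ _ Vx Vy); rewrite SD// ipDl !ipDr (q0 x)// (q0 y)//.
  by rewrite addr0 add0r.
have h2 : ip (S x) y - ip (S y) x = 0.
  have := q0 _ (VD _ _ Vx (VZ 'i%R _ Vy)); rewrite SD//; last exact: VZ.
  rewrite SZ// ipDl !ipDr (q0 x)// !ipZl !ipZr (q0 y)//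
    !mulr0 addr0 add0r conjCi.
  have ii : 'i%R * 'i%R = -1 :> C by rewrite -expr2 sqrCi.
  move=> /(congr1 (fun c => 'i%R * c)); rewrite mulr0 mulrDr !mulrA mulrN ii.
  by rewrite opprK mul1r mulN1r.
have : ip (S x) y + ip (S x) y = 0.
  by rewrite -[X in X = _](_ : (ip (S x) y + ip (S y) x) +
    (ip (S x) y - ip (S y) x) = _);
     [rewrite h1 h2 addr0 | ring].
by rewrite -mulr2n => /eqP; rewrite mulrn_eq0/= => /eqP.
Qed.

End inner_product.

(** * Orthonormal bases and the Parseval identity *)

Section orthonormal_bases.
Context {R : realType} {h : hilbertType R}.
Local Notation C := (Cplx R).
Implicit Types (x y z : h) (a b : C) (F G : {fset h}).
Local Notation ip := (inner h).
Local Notation totally := (@summability.totally h).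
Local Notation psumF := summability.partial_sum.

Local Instance totally_proper : ProperFilter totally :=
  summability.totally_filter.

Lemma near_totally (P : {fset h} -> Prop) F0 :
  (forall F, fsubset F0 F -> P F) -> \forall F \near totally, P F.
Proof. by move=> H; exists F0. Qed.

Lemma partial_sumE (V : zmodType) (f : h -> V) F : psumF f F =
  \sum_(e <- F) f e.
Proof. by rewrite /psumF big_seq_fsetE. Qed.

Lemma partial_sum_le (f : h -> R) F G : (forall x, 0 <= f x) -> fsubset F G ->
  psumF f F <= psumF f G.
Proof.
move=> f0 FG; rewrite !partial_sumE (big_fsetID _ (mem F) G)/=.
have -> : [fset x in G | x \in F]%fset = F.
  apply/fsetP => x; rewrite !inE/=.
  by have [xF|] := boolP (x \in F); rewrite ?andbF// andbT (fsubsetP FG).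
by rewrite lerDl sumr_ge0.
Qed.

(** As in [is_trace], the finite sets range over all of [h]; vectors outside [B] are neutralized by
    the coefficient 0. *)
Definition coef (B : set h) x e : C := if e \in B then ip x e else 0.
Definition expansion (B : set h) x F : h := psumF (fun e => coef B x e *: e) F.
Definition energy (B : set h) x F : R := psumF (fun e => rnorm (coef B x e) ^+
  2) F.

(** [is_trace] quantifies over all bases, so uniqueness of the trace needs at least one. A family
    that is maximal by Zorn is one, since a nonzero vector orthogonal to it could be normalized and
    added. *)
Lemma exists_orthonormal_basis : exists B : set h, orthonormal_basis B.
Proof.
pose P (A : set h) := (forall e, A e -> ip e e = 1) /\
  (forall e e', A e -> A e' -> e != e' -> ip e e' = 0).
have [F FP Ftot|A [[A1 A2] Amax]] := @Zorn_bigcup h P.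
  split=> [e [X FX Xe]|e e' [X FX Xe] [Y FY Ye] ee'].
    by have [+ _] := FP _ FX; exact.
  have [XY|YX] := Ftot _ _ FX FY.
    by have [_] := FP _ FY; apply => //; exact: XY.
  by have [_] := FP _ FX; apply => //; exact: YX.
exists A; split => //; apply/seteqP; split => [x Ax|x ->]; last by move=> y _;
  rewrite ip0l.
apply/eqP/negPn/negP => x0.
have rx : rnorm x != 0 by rewrite rnorm_eq0.
pose u := (rnorm x)^-1%:C *: x.
have uu : ip u u = 1.
  rewrite ip_norm rnormZ rnormR ger0_norm ?invr_ge0 ?rnorm_ge0// mulVf//.
  by rewrite expr1n.
have uA y : A y -> ip u y = 0 by move=> Ay; rewrite ipZl (Ax y Ay) mulr0.
apply: (Amax (A `|` [set u])); last first.
  split=> [e [/A1//|->//]|e e' [Ae|->] [Ae'|->]]; rewrite ?eqxx//.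
  - exact: A2.
  - by move=> _; apply: ip_eq0C; exact: uA.
  - by move=> _; exact: uA.
split; first by move=> e Ae; left.
move=> /(_ u (or_intror erefl)) /uA; rewrite uu => /eqP.
by rewrite oner_eq0.
Qed.

Section with_basis.
Variable B : set h.
Hypothesis onB : orthonormal_basis B.

Lemma ip_expansion x F e : B e ->
  ip (expansion B x F) e = if e \in F then ip x e else 0.
Proof.
move=> Be; have [B1 B2 _] := onB.
rewrite /expansion partial_sumE ip_suml.
have E i : i != e -> ip (coef B x i *: i) e = 0.
  rewrite ipZl /coef => ie; case: ifPn => [/set_mem Bi|_];
    last by rewrite mul0r.
  by rewrite (B2 i e)// mulr0.
have [eF|eF] := boolP (e \in F).
  rewrite (bigD1_seq e eF (fset_uniq F))/= big1 ?addr0; last by move=> i ie;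
    exact: E.
  by rewrite ipZl (B1 e)// mulr1 /coef mem_set.
by rewrite big_seq big1// => i iF; apply: E; apply: contraNneq eF => <-.
Qed.

Lemma ip_expansion_sub x F G : fsubset F G ->
  ip (expansion B x G) (expansion B x F) = (energy B x F)%:C.
Proof.
move=> FG; rewrite {2}/expansion /energy !partial_sumE ip_sumr rmorph_sum/=.
apply: eq_big_seq => e eF; rewrite ipZr /coef.
case: ifPn => [/set_mem Be|_]; last by rewrite rmorph0 mul0r rnorm0 expr0n.
rewrite ip_expansion// (fsubsetP FG _ eF).
by rewrite mulrC -normCK rnormE rmorphXn.
Qed.

Lemma energy_norm x F : rnorm (expansion B x F) ^+ 2 = energy B x F.
Proof. by apply: complexI; rewrite -ip_norm ip_expansion_sub//
  fsubset_refl. Qed.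

Lemma ip_x_expansion x F : ip x (expansion B x F) = (energy B x F)%:C.
Proof.
rewrite /expansion /energy !partial_sumE ip_sumr rmorph_sum/=.
apply: eq_big_seq => e eF; rewrite ipZr /coef.
case: ifPn => [/set_mem Be|_]; last by rewrite rmorph0 mul0r rnorm0 expr0n.
by rewrite mulrC -normCK rnormE rmorphXn.
Qed.

Lemma dist_expansion x F G : fsubset F G ->
  rnorm (expansion B x G - expansion B x F) ^+ 2 = energy B x G - energy B x F.
Proof.
move=> FG; apply: complexI; rewrite -ip_norm ipBl !ipBr.
rewrite (ip_expansion_sub x (fsubset_refl G)) (ip_expansion_sub x (fsubset_refl
  F)).
rewrite (ip_expansion_sub x FG) (ipC (expansion B x F)) (ip_expansion_sub x FG).
by rewrite conj_RC rmorphB/=; ring.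
Qed.

Lemma energy_le x F : energy B x F <= rnorm x ^+ 2.
Proof.
have o : ip (x - expansion B x F) (expansion B x F) = 0.
  by rewrite ipBl ip_x_expansion ip_expansion_sub ?fsubset_refl// subrr.
by have := rnormD_ortho o; rewrite subrK energy_norm => ->;
  rewrite lerDr sqr_ge0.
Qed.

(** The energies are bounded by the Bessel inequality [energy_le], which makes the expansions a
    Cauchy net; its limit has the same coefficients as x, hence equals x. *)
Lemma parseval x : energy B x F @[F --> totally] --> rnorm x ^+ 2.
Proof.
pose E := [set energy B x F | F in setT].
have E0 F : E (energy B x F) by exists F.
have supE : has_sup E.
  split; first by exists (energy B x fset0).
  by exists (rnorm x ^+ 2) => _ [F _ <-]; exact: energy_le.
pose s := sup E.
have Es F : energy B x F <= s by apply: sup_upper_bound.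
(* By [dist_expansion], once the energy at [F0] is within r^2 of its supremum, every larger
   expansion stays within r. *)
have cauchy : cauchy (expansion B x @ totally).
  apply: cauchy_exP => e /gt0_C[r r0 ->].
  have r20 : 0 < r ^+ 2 by rewrite exprn_gt0.
  have [_ [F0 _ <-] F0s] := sup_adherent r20 supE.
  exists (expansion B x F0).
  apply: (@near_totally (fun F => ball (expansion B x F0) r%:C (expansion B x
    F)) F0).
  move=> F F0F; rewrite -ball_normE /= rnormE ltcRC.
  rewrite -(ltr_pXn2r (_ : (0 < 2)%N))// ?nnegrE ?rnorm_ge0 ?(ltW r0)//.
  rewrite rdistC dist_expansion//; have := Es F; rewrite -/s in F0s; lra.
have [y xy] : exists y : h, expansion B x @ totally --> y.
  by exists (lim (expansion B x @ totally)); apply: cauchy_cvg cauchy.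
have xE : x = y.
  apply/eqP; rewrite -subr_eq0; apply/eqP.
  have [_ _ onB0] := onB.
  have : orthogonal_set B (x - y).
    move=> e Be; rewrite ipBl.
    have h1 : ip (expansion B x F) e @[F --> totally] --> ip y e
      by exact: cvg_ipl.
    have h2 : ip (expansion B x F) e @[F --> totally] --> ip x e.
      apply/rcvgP => r r0; apply: (@near_totally _ [fset e]%fset) => F.
      by rewrite fsub1set ip_expansion// => ->; rewrite subrr rnorm0.
    have -> : ip x e = ip y e := rcvg_unique h2 h1.
    by rewrite subrr.
  by case/seteqP : onB0 => H _ o; exact: (H _ o).
have : rnorm (expansion B x F) @[F --> totally] --> rnorm x.
  by rewrite [X in _ --> rnorm X]xE; exact: (cvg_rnorm xy).
move=> hx; have := cvgM hx hx; rewrite -expr2.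
have -> : energy B x = (fun F => rnorm (expansion B x F)) \* (fun F => rnorm
  (expansion B x F)).
  by apply/funext => F; rewrite -energy_norm expr2.
exact.
Qed.

End with_basis.

Lemma is_trace_unique (T : h -> h) (a : C) : is_trace T a -> Tr T = a.
Proof.
move=> Ta; rewrite /Tr; apply: xget_unique => // b Tb.
have [B onB] := exists_orthonormal_basis.
exact: rcvg_unique (Tb B onB) (Ta B onB).
Qed.

End orthonormal_bases.

(** * Traces of finite-rank operators and of series of positive operators *)

Section traces.
Context {R : realType} {h : hilbertType R}.
Local Notation C := (Cplx R).
Implicit Types (x y z : h) (a b : C) (F G : {fset h}) (B : set h).
Local Notation ip := (inner h).
Local Notation totally := (@summability.totally h).
Local Notation psumF := summability.partial_sum.
Local Existing Instance totally_proper.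

(** Only the values below [n] matter; total functions on [nat] make it easy to lengthen a family. *)
Definition orthonormal_seq (n : nat) (u : nat -> h) :=
  forall i j, (i < n)%N -> (j < n)%N -> ip (u i) (u j) = (i == j)%:R.

(** <P e, e> is the sum of the |<u_i, e>|^2; after exchanging the sums, Parseval in the given basis
    yields 1 for each u_i. *)
Lemma is_trace_finite_rank (P : h -> h) n (u : nat -> h) :
  (forall x, P x = \sum_(i < n) ip x (u i) *: u i) -> orthonormal_seq n u ->
  is_trace P n%:R.
Proof.
move=> PE on B onB.
have -> : summability.partial_sum (fun e : h => if e \in B then ip (P e) e else
  0) =
    (fun F => (\sum_(i < n) energy B (u i) F)%:C).
  apply/funext => F; rewrite /energy.
  under eq_bigr do rewrite partial_sumE.
  rewrite exchange_big/= partial_sumE rmorph_sum/=.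
  apply: eq_bigr => e _; rewrite rmorph_sum/= /coef.
  case: ifPn => eB; last by rewrite big1// => i _; rewrite rnorm0 expr0n.
  rewrite PE ip_suml; apply: eq_bigr => i _; rewrite ipZl (ipC e (u i)).
  by rewrite mulrC -normCK rnormE rmorphXn.
have -> : n%:R = (\sum_(i < n) rnorm (u i) ^+ 2)%:C :> C.
  rewrite rmorph_sum/= (eq_bigr (fun=> 1)) ?sumr_const ?card_ord// => i _.
  by rewrite -ip_norm on// eqxx.
apply: cvg_RC; apply: (@cvg_bigsum R R) => i; exact: parseval.
Qed.

Lemma is_trace_eq (T S : h -> h) a : T =1 S -> is_trace T a -> is_trace S a.
Proof. by move=> /funext ->. Qed.

Lemma is_traceD (T S : h -> h) a b : is_trace T a -> is_trace S b ->
  is_trace (fun x => T x + S x) (a + b).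
Proof.
move=> Ta Sb B onB.
have -> : psumF (fun e => if e \in B then ip (T e + S e) e else 0) = (fun F =>
    psumF (fun e => if e \in B then ip (T e) e else 0) F +
    psumF (fun e => if e \in B then ip (S e) e else 0) F).
  apply/funext => F; rewrite !partial_sumE -big_split/=; apply: eq_bigr => e _.
  by case: ifPn => _; rewrite ?addr0// ipDl.
exact: (ccvgD (Ta B onB) (Sb B onB)).
Qed.

Lemma is_trace0 : is_trace (fun=> 0 : h) 0.
Proof.
move=> B onB; set f := psumF _; suff -> : f = fun=> 0 by exact: cvg_cst.
apply/funext => F; rewrite /f partial_sumE big1// => e _.
by rewrite ip0l if_same.
Qed.

(** Dominated convergence along the net of finite sets. As [r] is nonnegative, the partial traces
    [p k F] never exceed [t k]. The error is at most the sum of the |c_k| (t_k - p_k(F)); its first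
    N terms tend to 0, and the others are below the tail of a convergent series. *)
Lemma is_trace_series (T : h -> h) (P : nat -> h -> h) (c : nat -> C)
    (r : nat -> h -> R) (t : nat -> R) :
  (forall k, is_trace (P k) (t k)%:C) ->
  (forall k e, ip (P k e) e = (r k e)%:C) -> (forall k e, 0 <= r k e) ->
  cvgn (series (fun k => rnorm (c k) * t k)) ->
  (forall e, series (fun k => c k * ip (P k e) e) @ \oo --> ip (T e) e) ->
  is_trace T (limn (series (fun k => c k * (t k)%:C))).
Proof.
move=> trP Pr r0 csum Tser B onB.
pose p k F := psumF (fun e => if e \in B then r k e else 0) F.
have p0 k F : 0 <= p k F.
  by rewrite /p partial_sumE sumr_ge0// => e _; case: ifP.
have pt k : p k F @[F --> totally] --> t k.
  have -> : p k = fun F =>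
      complex.Re (psumF (fun e => if e \in B then ip (P k e) e else 0) F).
    apply/funext => F; rewrite /p !partial_sumE.
    have -> : \sum_(e <- F) (if e \in B then ip (P k e) e else 0) =
        (\sum_(e <- F) (if e \in B then r k e else 0))%:C :> C.
      by rewrite rmorph_sum; apply: eq_bigr => e _; case: ifPn => // _;
        rewrite Pr.
    by [].
  exact: (cvg_Re (trP k B onB)).
have ple k F : p k F <= t k.
  rewrite -(cvg_lim _ (pt k))//; apply: limr_ge; first by apply: cvgP (pt k).
  apply: (@near_totally _ _ _ F) => G FG; apply: partial_sum_le => // e.
  by case: ifP.
have TE F : series (fun k => c k * (p k F)%:C) @ \oo -->
    psumF (fun e => if e \in B then ip (T e) e else 0) F.
  rewrite partial_sumE.
  have -> : series (fun k => c k * (p k F)%:C) = (fun n =>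
     \sum_(e <- F) (if e \in B then series (fun k => c k * ip (P k e) e) n else
       0)).
    apply/funext => n; rewrite /series/= (eq_bigr (fun k =>
        \sum_(e <- F) (if e \in B then c k * ip (P k e) e else 0))).
      rewrite exchange_big/=; apply: eq_bigr => e _.
      by case: ifPn => // _; rewrite big1.
    move=> k _; rewrite /p partial_sumE rmorph_sum/= mulr_sumr.
    by apply: eq_bigr => e _; case: ifPn => // _; rewrite ?Pr ?rmorph0 ?mulr0.
  apply: (@cvg_bigsum C C) => e; case: ifPn => _; first exact: Tser.
  exact: cvg_cst.
pose b k F := rnorm (c k) * (t k - p k F).
have b0 k F : 0 <= b k F by rewrite mulr_ge0 ?rnorm_ge0// subr_ge0.
have bt k F : b k F <= rnorm (c k) * t k.
  by rewrite ler_wpM2l ?rnorm_ge0// gerBl.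
have ct0 k : 0 <= rnorm (c k) * t k := le_trans (b0 k fset0) (bt k fset0).
have cb F : cvgn (series (fun k => b k F)) by apply: series_le_cvg csum.
have cct : cvgn (series (fun k => c k * (t k)%:C)).
  apply: cvg_cseries_rnorm; apply: series_le_cvg csum => // k;
    first exact: rnorm_ge0.
  rewrite rnormM rnormR ger0_norm// (le_trans _ (ple k fset0))//.
pose S := limn (series (fun k => rnorm (c k) * t k)).
have ser_nd : nondecreasing_seq (series (fun k => rnorm (c k) * t k)).
  by apply: nondecreasing_series.
apply/rcvgP => e e0; have e2 : 0 < e / 2 by rewrite divr_gt0.
have [N _ SN] : \forall n \near \oo, S - series (fun k => rnorm (c k) * t k) n <
  e / 2.
  have : series (fun k => rnorm (c k) * t k) @ \oo --> S by exact: csum.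
  move=> /cvgrPdist_lt/(_ _ e2); apply: filterS => n.
  by apply: le_lt_trans; exact: ler_norm.
have bN : \sum_(0 <= k < N) b k F @[F --> totally] --> (0 : R).
  have bk k : b k F @[F --> totally] --> (0 : R).
    have h0 : t k - p k F @[F --> totally] --> (t k - t k : R).
      by apply: cvgB (pt k); exact: cvg_cst.
    have h1 : b k F @[F --> totally] --> (rnorm (c k) * (t k - t k) : R).
      exact: (cvgM (cvg_cst _) h0).
    by move: h1; rewrite subrr mulr0.
  have := @cvg_bigsum R R _ totally _ nat (index_iota 0 N) b (fun=> 0) bk.
  rewrite big1_eq; exact.
move/cvgrPdist_lt : bN => /(_ _ e2); apply: filterS => F.
rewrite sub0r normrN => /(le_lt_trans (ler_norm _)) bNF.
have lim_diff : series (fun k => c k * (t k - p k F)%:C) @ \oo -->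
   limn (series (fun k => c k * (t k)%:C)) - psumF (fun e => if e \in B then ip
     (T e) e else 0) F.
  have -> : series (fun k => c k * (t k - p k F)%:C) =
      (fun n => series (fun k => c k * (t k)%:C) n - series (fun k => c k * (p k
        F)%:C) n).
    apply/funext => n; rewrite /series/= -sumrB; apply: eq_bigr => k _.
    by rewrite rmorphB mulrBr.
  exact: (ccvgB cct (TE F)).
rewrite -(cvg_lim _ lim_diff)//.
apply: (@le_lt_trans _ _ (limn (series (fun k => b k F)))).
  apply: rnorm_lim_series; [by apply: cvgP lim_diff | exact: cb |].
  by move=> k; rewrite rnormM rnormR ger0_norm// subr_ge0.
apply: (@le_lt_trans _ _ (\sum_(0 <= k < N) b k F +
    (S - series (fun k => rnorm (c k) * t k) N))); last first.
  have := SN N (leqnn N); rewrite -/S; lra.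
apply: limr_le; first exact: cb.
exists N => // n /= Nn; rewrite {1}/series/= (big_cat_nat (n := N))//= lerD2l.
apply: (@le_trans _ _ (\sum_(N <= k < n) rnorm (c k) * t k)).
  by apply: ler_sum.
rewrite -(sub_series_geq _ Nn) lerD2r.
exact: nondecreasing_cvgn_le.
Qed.

End traces.

(** * Spectral measures *)

Section second_moment.
Context {R : realType}.
Variable mu : {measure set (measurableTypeR R) -> \bar R}.
Hypothesis mu_fin : (mu setT < +oo)%E.

Lemma integrable_cst_fin (c : R) : mu.-integrable setT (fun=> c%:E).
Proof.
apply/integrableP; split; first exact: measurable_cst.
rewrite (_ : (fun _ => _) = cst `|c|%:E); last by apply/funext.
rewrite integral_cst//; apply: lte_mul_pinfty => //; rewrite ?lee_fin//.
Qed.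

Lemma measurable_EFin_sqr : measurable_fun [set: measurableTypeR R] (fun t : R
  => (t ^+ 2)%:E).
Proof. by apply/measurable_EFinP; exact: measurable_funX. Qed.

Hypothesis mu_sqr : (\int[mu]_t (t ^+ 2)%:E < +oo)%E.

Lemma integrable_sqr : mu.-integrable setT (fun t => (t ^+ 2)%:E).
Proof.
apply/integrableP; split; first exact: measurable_EFin_sqr.
have -> : (\int[mu]_t `|(t ^+ 2)%:E| = \int[mu]_t (t ^+ 2)%:E)%E.
  by apply: eq_integral => t _; rewrite gee0_abs// lee_fin sqr_ge0.
exact: mu_sqr.
Qed.

Lemma integrable_EFin : mu.-integrable setT EFin.
Proof.
apply: (@le_integrable _ _ _ mu setT measurableT _ (fun t => (1 + t ^+ 2)%:E)).
- by apply/measurable_EFinP; exact: measurable_id.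
- move=> t _; rewrite /= lee_fin (@ger0_norm _ (1 + _)) ?addr_ge0 ?sqr_ge0//.
  rewrite -real_normK ?num_real//; have := normr_ge0 t.
  have : 0 <= (`|t| - 1) ^+ 2 by exact: sqr_ge0.
  by rewrite sqrrB1 => h; nra.
- apply: eq_integrable (integrableD measurableT (integrable_cst_fin 1)
    integrable_sqr) => //.
Qed.

Lemma Rintegral_id_ge (A : set (measurableTypeR R)) (a : R) : measurable A ->
  mu (~` A) = 0%E -> (forall t, A t -> a <= t) ->
    a * fine (mu setT) <= \int[mu]_t t.
Proof.
move=> mA A0 aA; rewrite -Rintegral_cst//.
have iA f : mu.-integrable setT f -> (\int[mu]_t f t = \int[mu]_(t in A) f t)%E.
  by move=> fi; rewrite (negligible_integral (measurableC mA) measurableT fi A0)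
    setTD setCK.
rewrite /Rintegral iA; last exact: integrable_cst_fin.
rewrite iA; last exact: integrable_EFin.
apply: (@le_Rintegral _ _ _ mu A (cst a) id) => //.
- exact: (integrableS measurableT mA (@subsetT _ _) (integrable_cst_fin a)).
- exact: (integrableS measurableT mA (@subsetT _ _) integrable_EFin).
Qed.

Lemma Rintegral_id_le (A : set (measurableTypeR R)) (a : R) : measurable A ->
  mu (~` A) = 0%E -> (forall t, A t -> t <= a) ->
    \int[mu]_t t <= a * fine (mu setT).
Proof.
move=> mA A0 aA; rewrite -Rintegral_cst//.
have iA f : mu.-integrable setT f -> (\int[mu]_t f t = \int[mu]_(t in A) f t)%E.
  by move=> fi; rewrite (negligible_integral (measurableC mA) measurableT fi A0)
    setTD setCK.
rewrite /Rintegral iA; last exact: integrable_EFin.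
rewrite iA; last exact: integrable_cst_fin.
apply: (@le_Rintegral _ _ _ mu A id (cst a)) => //.
- exact: (integrableS measurableT mA (@subsetT _ _) integrable_EFin).
- exact: (integrableS measurableT mA (@subsetT _ _) (integrable_cst_fin a)).
Qed.

End second_moment.

(** * Algebra of projection-valued measures *)

Section projection_valued.
Context {R : realType} {h : hilbertType R} (E : spectral_measure h).
Local Notation C := (Cplx R).
Local Notation ip := (inner h).
Local Notation mu := (scalar_measure E).
Implicit Types (x y : h) (A B : set (measurableTypeR R)).

Lemma proj_ipE A x y : measurable A -> ip (E A x) y = ip (E A x) (E A y).
Proof. by move=> mA; rewrite -proj_sym// Defs.projK. Qed.

Lemma muE A x : measurable A -> mu x A = (rnorm (E A x) ^+ 2)%:E.
Proof. by move=> mA; rewrite scalar_measureE// proj_ipE// ip_norm. Qed.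

Lemma mu_fin x : (mu x setT < +oo)%E.
Proof. by rewrite muE// ltry. Qed.

Lemma fine_muT x : fine (mu x setT) = rnorm x ^+ 2.
Proof. by rewrite muE// projT. Qed.

Lemma mu_eq0 A x : measurable A -> mu x A = 0%E <-> E A x = 0.
Proof.
move=> mA; rewrite muE//; split=> [[/eqP]|->]; last by rewrite rnorm0 expr0n.
by rewrite expf_eq0/= rnorm_eq0 => /eqP.
Qed.

Lemma proj0 x : E set0 x = 0.
Proof. by apply/mu_eq0 => //; rewrite measure0. Qed.

Lemma proj_sub A B x : measurable A -> measurable B -> A `<=` B -> E B x = 0 ->
  E A x = 0.
Proof.
move=> mA mB AB Bx; rewrite -(setIidl AB) projI// Bx linear0//.
Qed.

Lemma proj_fix A B x : measurable A -> measurable B -> A `<=` B -> E A x = x ->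
  E B x = x.
Proof.
by move=> mA mB AB Ax; rewrite -{1}Ax -projI// setIC (setIidl AB).
Qed.

Lemma proj_disj A B x : measurable A -> measurable B -> A `&` B = set0 ->
  E A x = x -> E B x = 0.
Proof. by move=> mA mB AB Ax; rewrite -Ax -projI// setIC AB proj0. Qed.

(** The defect v of additivity is fixed by E(A U B) but killed by E(A) and E(B); additivity of its
    scalar measure then gives |v|^2 = 0. *)
Lemma projD A B x : measurable A -> measurable B -> A `&` B = set0 ->
  E (A `|` B) x = E A x + E B x.
Proof.
move=> mA mB AB; have mAB := measurableU _ _ mA mB.
pose v := E (A `|` B) x - E A x - E B x.
have vA : E A v = 0.
  rewrite /v !linearB/= -!projI// AB proj0 setIid subr0.
  by rewrite setIC setUK subrr.
have vB : E B v = 0.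
  rewrite /v !linearB/= -!projI// (setIC B A) AB proj0 setIid subr0.
  by rewrite (setUC A) setIC setUK subrr.
have vv : E (A `|` B) v = v.
  rewrite /v !linearB/= Defs.projK// -!projI//.
  by rewrite setUK (setUC A B) setUK.
have : mu v (A `|` B) = 0%E.
  have hA : mu v A = 0%E by apply/mu_eq0.
  have hB : mu v B = 0%E by apply/mu_eq0.
  by have := measureU (mu v) mA mB AB; rewrite [X in _ = (X + _)%E]hA [X in _ =
    (_ + X)%E]hB adde0.
move/(mu_eq0 _ mAB); rewrite vv /v => /eqP; rewrite -addrA -opprD subr_eq0.
by move=> /eqP.
Qed.

Lemma projCE A x : measurable A -> x = E A x + E (~` A) x.
Proof.
move=> mA; rewrite -projD//; [|exact: measurableC|exact: setICr].
by rewrite setUCr projT.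
Qed.

Lemma proj_bigcup0 (F : (set (measurableTypeR R))^nat) x :
  (forall n, measurable (F n)) -> (forall n, E (F n) x = 0) ->
    E (\bigcup_n F n) x = 0.
Proof.
move=> mF F0; have mU : measurable (\bigcup_n F n) by exact: bigcupT_measurable.
apply/mu_eq0 => //; apply/eqP; rewrite eq_le measure_ge0 andbT.
apply: (le_trans (measure_sigma_subadditive (mu x) mF mU (@subset_refl _ _))).
rewrite eseries0//= => n _ _; apply/mu_eq0 => //.
Qed.

Lemma muD_ortho A B x y : measurable A -> measurable B ->
  E A x = x -> E A y = 0 -> mu (x + y) B = (mu x B + mu y B)%E.
Proof.
move=> mA mB Ax Ay; rewrite !muE// -EFinD linearD/=; congr _%:E.
apply: rnormD_ortho; rewrite -Ax -projI// setIC projI// proj_sym//.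
by rewrite -projI// setIC projI// Ay linear0 ip0r.
Qed.

End projection_valued.

(** * The quadratic form of L and the spectral projections of points *)

Section spectral_operator.
Context {R : realType} {h : hilbertType R} (L : linear_op h) (E :
  spectral_measure h).
Local Notation C := (Cplx R).
Local Notation ip := (inner h).
Local Notation mu := (scalar_measure E).
Implicit Types (x y : h) (A B : set (measurableTypeR R)).
Hypothesis saL : self_adjoint L.
Hypothesis EL : is_spectral_measure_of L E.

Lemma domD x y : dom L x -> dom L y -> dom L (x + y).
Proof. by move=> dx dy; have := domP 1 dx dy; rewrite scale1r. Qed.
Lemma domZ (a : C) x : dom L x -> dom L (a *: x).
Proof. by move=> dx; have := domP a dx (dom0 L); rewrite addr0. Qed.
Lemma lopD x y : dom L x -> dom L y -> L (x + y) = L x + L y.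
Proof. by move=> dx dy; have := lopP 1 dx dy; rewrite !scale1r. Qed.
Lemma lop0 : L 0 = 0.
Proof.
have := lopP 1 (dom0 L) (dom0 L); rewrite !scale1r addr0 => /eqP.
by rewrite -subr_eq subrr eq_sym => /eqP.
Qed.
Lemma lopZ (a : C) x : dom L x -> L (a *: x) = a *: L x.
Proof. by move=> dx; have := lopP a dx (dom0 L); rewrite lop0 !addr0. Qed.

Lemma lop_sym x y : dom L x -> dom L y -> ip (L x) y = ip x (L y).
Proof.
move=> dx dy; have [_ /(_ y (L y))[_ H]] := saL.
exact: (H (conj dy erefl)).
Qed.

Lemma dom_sqr x : dom L x -> (\int[mu x]_t (t ^+ 2)%:E < +oo)%E.
Proof. by move/(EL.1 x). Qed.

Lemma form_int x : dom L x -> ip (L x) x = (\int[mu x]_t t)%:C.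
Proof. exact: EL.2. Qed.

Lemma integrable_id x : dom L x -> (mu x).-integrable setT EFin.
Proof. by move=> dx; apply: integrable_EFin; [exact: mu_fin | exact: dom_sqr].
  Qed.

Lemma mu_projD A x B : measurable A -> measurable B ->
  mu x B = (mu (E A x) B + mu (E (~` A) x) B)%E.
Proof.
move=> mA mB; rewrite {1}(projCE E x mA); apply: (muD_ortho mA) => //.
  exact: Defs.projK.
by rewrite -projI//; [rewrite setICr proj0 | exact: measurableC].
Qed.

(** The scalar measure of x is the sum of those of E(A) x and of E(~A) x, so projecting does not
    increase the second moment. *)
Lemma dom_proj A x : measurable A -> dom L x -> dom L (E A x).
Proof.
move=> mA dx; apply/(EL.1 _); apply: le_lt_trans (dom_sqr dx).
have -> : (\int[mu x]_t (t ^+ 2)%:E = \int[measure_add (mu (E A x)) (mu (E (~`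
  A) x))]_t (t ^+ 2)%:E)%E.
  apply: eq_measure_integral => B mB _; rewrite (mu_projD _ mA)//.
  exact/esym/measure_addE.
rewrite ge0_integral_measure_add//.
- by rewrite leeDl// integral_ge0// => t _; rewrite lee_fin sqr_ge0.
- by move=> t _; rewrite lee_fin sqr_ge0.
- exact: measurable_EFin_sqr.
Qed.

Lemma mu_compl A x : measurable A -> E A x = x -> mu x (~` A) = 0%E.
Proof.
move=> mA Ax; apply/mu_eq0; first exact: measurableC.
by rewrite -Ax -projI// ?setICl ?proj0//; exact: measurableC.
Qed.

Lemma dom_bounded A x c : measurable A -> (forall t,
  A t -> `|t| <= c) -> E A x = x -> dom L x.
Proof.
move=> mA Ac Ax; apply/(EL.1 _).
rewrite (@ge0_negligible_integral _ _ _ (mu x) setT (~` A))//.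
- rewrite setTD setCK.
  apply: (@le_lt_trans _ _ (\int[mu x]_(t in A) (cst (c ^+ 2)%:E t))%E).
    apply: ge0_le_integral => //.
    + by move=> t _; rewrite lee_fin sqr_ge0.
    + exact: measurable_funTS measurable_EFin_sqr.
    + by move=> t At; rewrite lee_fin -real_normK ?num_real//
        lerXn2r ?nnegrE ?Ac// (le_trans _ (Ac t At)).
  rewrite integral_cst//; apply: lte_mul_pinfty => //.
  + by rewrite lee_fin sqr_ge0.
  + by rewrite muE// ltry.
- exact: measurableC.
- exact: measurable_EFin_sqr.
- by move=> t _; rewrite lee_fin sqr_ge0.
- exact: mu_compl.
Qed.

Lemma formD_ortho A x y : measurable A -> dom L x -> dom L y ->
  E A x = x -> E A y = 0 -> ip (L (x + y)) (x + y) = ip (L x) x + ip (L y) y.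
Proof.
move=> mA dx dy Ax Ay; rewrite !form_int//; last exact: domD.
rewrite -rmorphD/=; congr (_%:C); rewrite /Rintegral.
have -> : (\int[mu (x + y)%R]_t t%:E = \int[measure_add (mu x) (mu y)]_t
  t%:E)%E.
  apply: eq_measure_integral => B mB _; rewrite (muD_ortho mA mB Ax Ay).
  exact/esym/measure_addE.
rewrite integral_measure_add//; [|exact: integrable_id|exact: integrable_id].
by rewrite fineD//; apply: integrable_fin_num => //; exact: integrable_id.
Qed.

(** Additivity of the form over orthogonal spectral parts gives <L x, y> + <L y, x> = 0; the same
    identity for i y gives the difference, so both terms vanish. *)
Lemma form_ortho A x y : measurable A -> dom L x -> dom L y ->
  E A x = x -> E A y = 0 -> ip (L x) y = 0.
Proof.
move=> mA dx dy Ax Ay.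
have h1 (z : h) : dom L z -> E A z = 0 -> ip (L x) z + ip (L z) x = 0.
  move=> dz Az; have := formD_ortho mA dx dz Ax Az.
  rewrite lopD// ipDl !ipDr.
  move/(congr1 (fun c => c - (ip (L x) x + ip (L z) z))); rewrite subrr => <-.
  by ring.
have e1 := h1 y dy Ay.
have := h1 ('i%R *: y) (domZ _ dy).
rewrite linearZ/= Ay scaler0 => /(_ erefl); rewrite lopZ//
  ipZl ipZr conjCi => e2.
have ii : 'i%R * 'i%R = -1 :> C by rewrite -expr2 sqrCi.
move: e2 => /(congr1 (fun c => 'i%R * c)); rewrite mulr0 mulrDr !mulrA mulrN ii.
rewrite opprK mul1r mulN1r => e2.
have : ip (L x) y *+ 2 = 0.
  rewrite mulr2n; have -> : ip (L x) y + ip (L x) y =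
    (ip (L x) y + ip (L y) x) +
     (ip (L x) y - ip (L y) x) by ring.
  by rewrite e1 e2 addr0.
by move=> /eqP; rewrite mulrn_eq0/= => /eqP.
Qed.

Lemma form_ortho_r A x y : measurable A -> dom L x -> dom L y ->
  E A x = 0 -> E A y = y -> ip (L x) y = 0.
Proof.
move=> mA dx dy Ax Ay; rewrite lop_sym// ipC (form_ortho mA dy dx)// rmorph0//.
Qed.

Lemma form_ge A x a : measurable A -> dom L x -> E A x = x ->
  (forall t, A t -> a <= t) -> a * rnorm x ^+ 2 <= complex.Re (ip (L x) x).
Proof.
move=> mA dx Ax aA; rewrite form_int//= -(fine_muT E).
exact: (Rintegral_id_ge (mu_fin E x) (dom_sqr dx) mA (mu_compl mA Ax) aA).
Qed.

Lemma form_le A x a : measurable A -> dom L x -> E A x = x ->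
  (forall t, A t -> t <= a) -> complex.Re (ip (L x) x) <= a * rnorm x ^+ 2.
Proof.
move=> mA dx Ax aA; rewrite form_int//= -(fine_muT E).
exact: (Rintegral_id_le (mu_fin E x) (dom_sqr dx) mA (mu_compl mA Ax) aA).
Qed.

Lemma Im_form x : dom L x -> complex.Im (ip (L x) x) = 0.
Proof. by move=> dx; rewrite form_int. Qed.

(** On the range of E({a}) the two form bounds meet in <L z, z> = a |z|^2. Polarization kills L x -
    a x against this range and [form_ortho] against its complement; the domain is dense. *)
Lemma proj_set1_eigen (a : R) x : E [set a] x = x -> dom L x /\ L x = a%:C *: x.
Proof.
have measurable_point : measurable ([set a] : set (measurableTypeR R))
  by exact: measurable_set1.
have dA y : E [set a] y = y -> dom L y.
  by apply: (@dom_bounded _ _ `|a|) => // t ->.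
move=> Ax; have dx := dA x Ax; split => //.
apply/eqP; rewrite -subr_eq0; apply/eqP.
apply: (dense_ortho0 saL.1) => y dy.
have q0 z : E [set a] z = z -> ip (L z - a%:C *: z) z = 0.
  move=> Az; have dz := dA z Az; rewrite ipBl ipZl ip_norm.
  apply: Cext; rewrite !(cReD, cReN, cImD, cImN, cReM, cImM) /= ?Im_form//;
    last by ring.
  have ge_ : a * rnorm z ^+ 2 <= complex.Re (ip (L z) z).
    by apply: form_ge measurable_point dz Az _ => t ->.
  have le_ : complex.Re (ip (L z) z) <= a * rnorm z ^+ 2.
    by apply: form_le measurable_point dz Az _ => t ->.
  rewrite mul0r subr0; apply/eqP; rewrite subr_eq0 eq_le.
  by rewrite ge_ le_.
rewrite (projCE E y measurable_point) ipDr.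
have -> : ip (L x - a%:C *: x) (E (~` [set a]) y) = 0.
  have A0 : E [set a] (E (~` [set a]) y) = 0.
    by rewrite -projI// ?setICr ?proj0//; exact: measurableC.
  rewrite ipBl ipZl (form_ortho measurable_point)//;
    last by apply: dom_proj => //; exact: measurableC.
  by rewrite -Ax proj_sym// A0 ip0r mulr0 subrr.
rewrite addr0.
apply: (@polar0 R h [set z | E [set a] z = z] (fun z => L z - a%:C *: z)) =>
  //=.
- by move=> u v Au Av; rewrite linearD/= Au Av.
- by move=> c u Au; rewrite linearZ/= Au.
- move=> u v Au Av; rewrite lopD ?scalerDr//; [|exact: dA|exact: dA].
  by rewrite opprD addrACA.
- move=> c u Au; rewrite lopZ; last exact: dA.
  by rewrite scalerBr !scalerA mulrC.
- exact: Defs.projK.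
Qed.

(** For every A the vector E(A) x has form value a |E(A) x|^2. If A lies strictly on one side of a,
    at positive distance, a form bound contradicts this unless E(A) x = 0; countably many such A
    exhaust the complement of a. *)
Lemma eigen_proj_set1 (a : R) x : dom L x -> L x = a%:C *: x -> E [set a] x = x.
Proof.
move=> dx Lx.
have measurable_point : measurable ([set a] : set (measurableTypeR R))
  by exact: measurable_set1.
have key A : measurable A -> complex.Re (ip (L (E A x)) (E A x)) =
  a * rnorm (E A x) ^+ 2.
  move=> mA; have dA := dom_proj mA dx.
  have dAc : dom L (E (~` A) x) by apply: dom_proj => //; exact: measurableC.
  have : ip (L x) (E A x) = ip (L (E A x)) (E A x).
    rewrite {1}(projCE E x mA) lopD// ipDl [X in _ +
      X](form_ortho_r mA) ?addr0//.
      by rewrite -projI// ?setICr ?proj0//; exact: measurableC.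
    exact: Defs.projK.
  move=> <-; rewrite Lx ipZl -proj_sym// proj_ipE// ip_norm.
  by rewrite cReM /= mul0r subr0.
have lo n : E `]-oo, a - n.+1%:R^-1]%classic x = 0.
  set A := (X in E X x); have mA : measurable A by exact: measurable_itv.
  apply/eqP; rewrite -rnorm_eq0 -sqrf_eq0 eq_le sqr_ge0 andbT.
  have H : a * rnorm (E A x) ^+ 2 <= (a - n.+1%:R^-1) * rnorm (E A x) ^+ 2.
    rewrite -key//; apply: (form_le mA (dom_proj mA dx) (Defs.projK E x mA)) =>
      t.
    by rewrite /A/= in_itv/=.
  have n0 : 0 < n.+1%:R^-1 :> R by rewrite invr_gt0.
  rewrite -(pmulr_rle0 _ n0); move: H.
  by move: (n.+1%:R^-1) (rnorm (E A x) ^+ 2) => i r; lra.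
have hi n : E `[a + n.+1%:R^-1, +oo[%classic x = 0.
  set A := (X in E X x); have mA : measurable A by exact: measurable_itv.
  apply/eqP; rewrite -rnorm_eq0 -sqrf_eq0 eq_le sqr_ge0 andbT.
  have H : (a + n.+1%:R^-1) * rnorm (E A x) ^+ 2 <= a * rnorm (E A x) ^+ 2.
    rewrite -key//; apply: (form_ge mA (dom_proj mA dx) (Defs.projK E x mA)) =>
      t.
    by rewrite /A/= in_itv/= andbT.
  have n0 : 0 < n.+1%:R^-1 :> R by rewrite invr_gt0.
  rewrite -(pmulr_rle0 _ n0); move: H.
  by move: (n.+1%:R^-1) (rnorm (E A x) ^+ 2) => i r; lra.
rewrite [RHS](projCE E x measurable_point) (_ : E (~` [set a]) x = 0) ?addr0//.
pose F n := (`]-oo, a - n.+1%:R^-1] `|` `[a + n.+1%:R^-1,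
  +oo[)%classic : set (measurableTypeR R).
have mF n : measurable (F n) by apply: measurableU; exact: measurable_itv.
have mU : measurable (\bigcup_n F n) by exact: bigcupT_measurable.
rewrite (@proj_sub _ _ E _ _ x (measurableC measurable_point) mU)//.
  move=> t /= /eqP ta; have d0 : 0 < `|t - a| by rewrite normr_gt0 subr_eq0.
  have [n _ /(_ n (leqnn n)) nd] := near_infty_natSinv_lt (PosNum d0).
  exists n => //; rewrite /F /= !in_itv/= andbT; move: nd => /=.
  have [ta0|ta0] := leP 0 (t - a).
    by rewrite ger0_norm// => nd; right; move: nd; move: (n.+1%:R^-1) => i; lra.
  by rewrite ltr0_norm// => nd; left; move: nd; move: (n.+1%:R^-1) => i; lra.
apply: proj_bigcup0 => // n; rewrite projD//; first by rewrite lo hi addr0.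
- apply/seteqP; split => // t [] /=; rewrite !in_itv/= andbT => t1 t2.
  have : 0 < n.+1%:R^-1 :> R by rewrite invr_gt0.
  by move: t1 t2; move: (n.+1%:R^-1) => i; lra.
Qed.

End spectral_operator.

(** * Discrete spectrum *)

Section discrete_spectrum.
Context {R : realType} {h : hilbertType R} (L : linear_op h) (E :
  spectral_measure h).
Local Notation C := (Cplx R).
Local Notation ip := (inner h).
Local Notation mu := (scalar_measure E).
Implicit Types (x y : h) (A B : set (measurableTypeR R)).
Hypothesis saL : self_adjoint L.
Hypothesis posL : nonnegative_op L.
Hypothesis discrL : discrete_off_ker L.
Hypothesis EL : is_spectral_measure_of L E.
Variable lam : R^nat.
Hypothesis lamP : enumerates_eigenvalues L lam.

Lemma mem_eigenvalue k : ((lam k)%:C : C) != 0 /\ eigenvalue_op L (lam k)%:C.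
Proof.
have [_ /seteqP[_ H]] := lamP.
by apply: (H (lam k)%:C); exists k.
Qed.

Lemma rnorm_normalize x : x != 0 -> rnorm ((rnorm x)^-1%:C *: x) = 1.
Proof.
by move=> x0; rewrite rnormZ rnormR ger0_norm ?invr_ge0 ?rnorm_ge0// mulVf//
  rnorm_eq0.
Qed.

Lemma eigenvector_lam k : exists x, rnorm x = 1 /\ E [set lam k] x = x.
Proof.
have [_ [x [dx x0 Lx]]] := mem_eigenvalue k.
exists ((rnorm x)^-1%:C *: x); split; first exact: rnorm_normalize.
by rewrite linearZ/= (eigen_proj_set1 saL EL dx Lx).
Qed.

Lemma lam_gt0 k : 0 < lam k.
Proof.
have [l0 [x [dx x0 Lx]]] := mem_eigenvalue k.
have lk0 : lam k != 0 by apply: contra_neq l0 => ->.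
rewrite lt_neqAle eq_sym lk0/=.
have := posL dx; rewrite Lx ipZl ip_norm -rmorphM ler0c pmulr_lge0//.
by rewrite exprn_gt0// lt_neqAle eq_sym rnorm_eq0 x0 rnorm_ge0.
Qed.

Lemma lam_lt i j : (i < j)%N -> lam i < lam j.
Proof. by have [+ _] := lamP; exact. Qed.

Lemma lam_inj : injective lam.
Proof.
move=> i j ij; have [ij'|ij'|//] := ltngtP i j;
  by have := lam_lt ij'; rewrite ij ltxx.
Qed.

Lemma eigen_is_lam (a : R) x : a != 0 -> x != 0 -> E [set a] x = x ->
  exists k, a = lam k.
Proof.
move=> a0 x0 Ax; have [dx Lx] := proj_set1_eigen saL EL Ax.
have [_ /seteqP[H _]] := lamP.
have [] := H a%:C; last by move=> k _ [ak]; exists k.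
by split; [apply: contra_neq a0 => -[] | exists x].
Qed.

Lemma ge0_Re (z : C) : 0 <= z -> 0 <= complex.Re z.
Proof. by rewrite lecE => /andP[]. Qed.

Lemma measurable_itvR (i : interval R) : measurable ([set` i] : set
  (measurableTypeR R)).
Proof. exact: measurable_itv. Qed.

Local Notation I c := (`]0, c]%classic : set (measurableTypeR R)).

Lemma dom_itv c x : E (I c) x = x -> dom L x.
Proof.
apply: (dom_bounded EL (c := c)); first exact: measurable_itvR.
by move=> t; rewrite /= in_itv/= => /andP[t0 tc]; rewrite ger0_norm// ltW.
Qed.

(* Positivity of L is tested on the vector K x - x / c. *)
Lemma inverse_lower_bound (K : {linear h -> h}) c x : is_inverse_off_ker L K ->
  0 < c -> E (I c) x = x -> rnorm x <= c * rnorm (K x).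
Proof.
move=> [_ KL] c0 Ax; have measurable_oc : measurable (I c)
  by exact: measurable_itvR.
have mIc := measurableC measurable_oc.
have dx := dom_itv Ax.
have m0 : measurable ([set 0] : set (measurableTypeR R))
  by exact: measurable_set1.
have I0 : I c `&` [set 0] = set0.
  by apply/seteqP; split => // t [/= + t0]; rewrite t0 in_itv/= ltxx.
have xker : orthogonal_set (ker L) x.
  move=> z [dz Lz]; have zz : E [set 0] z = z.
    by apply: (eigen_proj_set1 saL EL dz); rewrite Lz scale0r.
  by rewrite -Ax proj_sym// (proj_disj m0 measurable_oc _ zz) ?ip0r// setIC.
have [dy yker Ly] := KL x xker.
set y := K x in dy yker Ly *.
pose y1 := E (I c) y; pose y2 := E (~` I c) y.
have yE : y = y1 + y2 by exact: projCE.
have dy1 : dom L y1 by exact: dom_proj.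
have dy2 : dom L y2 by exact: dom_proj.
have y1A : E (I c) y1 = y1 by exact: Defs.projK.
have y2A : E (I c) y2 = 0 by rewrite -projI// setICr proj0.
(* Since L y = x lies in the range of E(]0, c]), the outer part [y2] of y belongs to the kernel of
   L, while y is orthogonal to that kernel; so [y2] is 0. *)
have Ly2 : L y2 = 0.
  apply: (dense_ortho0 saL.1) => v dv.
  rewrite (projCE E v measurable_oc) ipDr (form_ortho_r saL EL measurable_oc
    dy2) ?add0r//; last first.
  - exact: Defs.projK.
  - exact: dom_proj.
  have v2 : E (I c) (E (~` I c) v) = 0 by rewrite -projI// setICr proj0.
  have dv2 : dom L (E (~` I c) v) by exact: dom_proj.
  have : ip (L y) (E (~` I c) v) = ip (L y1) (E (~` I c) v) +
    ip (L y2) (E (~` I c) v).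
    by rewrite {1}yE lopD// ipDl.
  rewrite Ly (form_ortho EL measurable_oc dy1 dv2 y1A v2) add0r => <-.
  by rewrite -Ax proj_sym// v2 ip0r.
have y20 : y2 = 0.
  have := yker y2 (conj dy2 Ly2).
  rewrite {1}yE ipDl -y1A proj_sym// y2A ip0r add0r ip_norm => -[/eqP].
  by rewrite expf_eq0/= rnorm_eq0 => /eqP.
have Ay : E (I c) y = y by rewrite [RHS]yE y20 addr0.
have lec t : I c t -> t <= c by rewrite /= in_itv/= => /andP[].
have q1 := form_le EL measurable_oc dy Ay lec.
have q2 := form_le EL measurable_oc dx Ax lec.
pose w := y - c^-1%:C *: x.
have dw : dom L w.
  by rewrite /w -scaleN1r; apply: domD => //; apply: domZ; apply: domZ.
have Lw : L w = x - c^-1%:C *: L x.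
  rewrite /w -scaleNr lopD//; last exact: domZ.
  by rewrite lopZ// Ly scaleNr.
have := posL dw; rewrite Lw /w ipBl !ipBr !ipZl !ipZr conj_RC.
rewrite (lop_sym saL dx dy) Ly ip_norm => w0.
have {w0} := ge0_Re w0.
rewrite !(cReD, cReN, cReM) /= ?(mul0r, mulr0, subr0, addr0).
rewrite Ly in q1.
set X := rnorm x ^+ 2 in q1 q2 *; set Y := rnorm y ^+ 2 in q1 *.
set u := complex.Re _ in q1 *; set v := complex.Re _ in q2 *.
(* Positivity reads 2 X / c <= u + v / c^2. As u <= c Y and v <= c X, this gives X <= c u <= c^2
   Y. *)
move=> H.
have cV : c * c^-1 = 1 by rewrite mulfV// gt_eqF.
have H2 : 0 <= c * (u - c^-1 * X - (c^-1 * X - c^-1 * (c^-1 * v))).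
  by rewrite mulr_ge0// ltW.
have H3 : c * (u - c^-1 * X - (c^-1 * X - c^-1 * (c^-1 * v))) =
   c * u - (c * c^-1) * X * 2 + (c * c^-1) * (c^-1 * v) by ring.
rewrite H3 cV !mul1r in H2.
have H4 : c^-1 * v <= X.
  by rewrite mulrC ler_pdivrMr// mulrC.
have H5 : X <= c ^+ 2 * Y.
  have : c * u <= c * (c * Y) by rewrite ler_wpM2l// ltW.
  by rewrite expr2 -mulrA; lra.
rewrite -(ler_pXn2r (_ : (0 < 2)%N))// ?nnegrE ?rnorm_ge0 ?(mulr_ge0 (ltW c0))
  ?rnorm_ge0//.
by rewrite exprMn.
Qed.

Lemma orthonormal_seq_sub n (u : nat -> h) i j : orthonormal_seq n u ->
  (i < n)%N ->
  (j < n)%N -> i != j -> 1 <= rnorm (u i - u j).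
Proof.
move=> ou ni nj ij.
have o : ip (u i) (- u j) = 0 by rewrite ipNr ou// (negbTE ij) oppr0.
have := rnormD_ortho o; rewrite rnormN.
have r1 k : (k < n)%N -> rnorm (u k) ^+ 2 = 1.
  by move=> kn; apply: complexI; rewrite -ip_norm ou// eqxx.
rewrite !r1// => e; rewrite -(ler_pXn2r (_ : (0 < 2)%N))// ?nnegrE ?rnorm_ge0//.
by rewrite e expr1n lerDl.
Qed.

(** Pigeonhole: finitely many balls of radius 1 / (2 c) cover the image of the unit ball under K.
    Two orthonormal vectors whose images share a ball would satisfy |K (u_i - u_j)| < 1 / c, against
    [inverse_lower_bound]. *)
Lemma orthonormal_seq_bound c : 0 < c -> exists N, forall n (u : nat -> h),
  orthonormal_seq n u -> (forall i, (i < n)%N -> E (I c) (u i) = u i) ->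
    (n <= N)%N.
Proof.
move=> c0; have [K [invK cK]] := discrL.
pose e := c^-1 / 2; have e0 : 0 < e by rewrite divr_gt0// invr_gt0.
pose V (y : h) : set h := [set z | rnorm (y - z) < e].
have oV y : open (V y).
  rewrite openE => z /= yz; have d0 : 0 < e - rnorm (y - z) by rewrite subr_gt0.
  apply: filterS (near_rnorm_lt z d0) => t /= zt.
  by have := ler_rnormD (y - z) (z - t); rewrite addrA subrK /V/=; lra.
move: cK; rewrite /compact_op precompactE compact_cover.
move=> /(_ h setT V (fun y _ => oV y))[|D' _ D'P].
  by move=> y _; exists y => //; rewrite /V/= subrr rnorm0.
exists #|` D'|%fset => n u ou uI.
have near_center (i : 'I_n) : exists y : D', rnorm (val y - K (u i)) < e.
  have [|y yD yV] := D'P (K (u i)).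
    apply: subset_closure; exists (u i) => //=.
    have : rnorm (u i) ^+ 2 = 1 by apply: complexI; rewrite -ip_norm ou// eqxx.
    move=> /eqP; rewrite sqrp_eq1 ?rnorm_ge0// => /eqP u1.
    by rewrite rnormE u1.
  by exists [` yD]%fset.
have [f fP] := choice near_center.
suff finj : injective f by have := leq_card f finj; rewrite card_ord -cardfE.
move=> i j fij; apply/eqP/negPn/negP => ij.
have h1 := orthonormal_seq_sub ou (ltn_ord i) (ltn_ord j) ij.
have uij : E (I c) (u i - u j) = u i - u j by rewrite linearB/= !uI.
have h2 := inverse_lower_bound invK c0 uij.
have h3 : rnorm (K (u i - u j)) < c^-1.
  rewrite linearB/= (_ : K (u i) - K (u j) = (val (f j) - K (u j)) - (val (f i)
    - K (u i))).
    apply: (le_lt_trans (ler_rnormB _ _)); have := fP i; have := fP j.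
    have : c^-1 = e + e by rewrite /e; field; rewrite gt_eqF.
    by move=> ->; lra.
  by rewrite fij opprB [RHS]addrC addrA subrK.
have : c * rnorm (K (u i - u j)) < 1 by rewrite mulrC -ltr_pdivlMr// div1r.
lra.
Qed.

End discrete_spectrum.

(** * Finite multiplicities and absence of other spectrum *)

Section multiplicities.
Context {R : realType} {h : hilbertType R} (L : linear_op h) (E :
  spectral_measure h).
Local Notation C := (Cplx R).
Local Notation ip := (inner h).
Local Notation mu := (scalar_measure E).
Implicit Types (x y : h) (A B : set (measurableTypeR R)).
Hypothesis saL : self_adjoint L.
Hypothesis posL : nonnegative_op L.
Hypothesis discrL : discrete_off_ker L.
Hypothesis EL : is_spectral_measure_of L E.
Variable lam : R^nat.
Hypothesis lamP : enumerates_eigenvalues L lam.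
Local Notation I a c := (`]a, c]%classic : set (measurableTypeR R)).

Lemma measurable_oc a c : measurable (I a c).
Proof. exact: measurable_itv. Qed.

Lemma measurable_point (a : R) : measurable ([set a] : set (measurableTypeR R)).
Proof. exact: measurable_set1. Qed.

Lemma proj_rnorm_sqr A x : measurable A -> ip (E A x) x =
  (rnorm (E A x) ^+ 2)%:C.
Proof. by move=> mA; rewrite proj_ipE// ip_norm. Qed.

Lemma proj_ortho A B x y : measurable A -> measurable B -> A `&` B = set0 ->
  E A x = x -> E B y = y -> ip x y = 0.
Proof.
move=> mA mB AB Ax By; rewrite -Ax proj_sym// (proj_disj mB mA _ By) ?ip0r//.
by rewrite setIC.
Qed.

Definition extend_seq (u : nat -> h) n x : nat ->
  h := fun i => if (i < n)%N then u i else x.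

Lemma orthonormal_extend u n x : orthonormal_seq n u -> rnorm x = 1 ->
  (forall i, (i < n)%N -> ip (u i) x = 0) -> orthonormal_seq n.+1 (extend_seq u
    n x).
Proof.
move=> ou x1 ux i j; rewrite /extend_seq !ltnS => ni nj.
have [i_n|] := ltnP i n; have [j_n|] := ltnP j n.
- exact: ou.
- move=> nj'; have -> : j = n by apply/eqP; rewrite eqn_leq nj.
  by rewrite ux// (ltn_eqF i_n).
- move=> ni'; have -> : i = n by apply/eqP; rewrite eqn_leq ni.
  by rewrite (ip_eq0C (ux _ j_n)) gtn_eqF.
- move=> nj' ni'; have -> : j = n by apply/eqP; rewrite eqn_leq nj.
  have -> : i = n by apply/eqP; rewrite eqn_leq ni.
  by rewrite eqxx ip_norm x1 expr1n.
Qed.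

Lemma lam_unbounded c : exists k, c < lam k.
Proof.
apply: contrapT => /forallNP H.
have lc k : lam k <= c by rewrite leNgt; apply/negP/H.
have c0 : 0 < c := lt_le_trans (lam_gt0 posL lamP 0) (lc 0%N).
have [N NP] := orthonormal_seq_bound saL posL discrL EL c0.
have [u uP] := choice (eigenvector_lam saL EL lamP).
suff : (N.+1 <= N)%N by rewrite ltnn.
apply: (NP _ u) => [i j _ _|i _].
  have [u1 Eu] := uP i; have [v1 Ev] := uP j.
  have [<-|ij] := eqVneq i j; first by rewrite ip_norm u1 expr1n.
  apply: (proj_ortho (measurable_point _) (measurable_point _) _ Eu Ev).
  apply/seteqP; split => // t [/= -> /(lam_inj lamP) e].
  by rewrite e eqxx in ij.
have [_ Eu] := uP i; apply: (proj_fix (measurable_point _) (measurable_oc _ _) _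
  Eu) => t /= ->.
by rewrite in_itv/= lc (lam_gt0 posL lamP).
Qed.

Lemma near_lam c : \forall k \near \oo, c < lam k.
Proof.
have [k ck] := lam_unbounded c; exists k => // n /=.
by rewrite leq_eqVlt => /orP[/eqP<-//|/(lam_lt lamP)/(lt_trans ck)].
Qed.

(** Take a longest orthonormal family in the range of E(A); a nonzero residual of E(A) x could be
    normalized and appended. *)
Lemma finite_rank A c : measurable A -> A `<=` I 0 c -> 0 < c ->
  exists n u, orthonormal_seq n u /\ (forall x,
    E A x = \sum_(i < n) ip x (u i) *: u i).
Proof.
move=> mA AI c0.
have [N NP] := orthonormal_seq_bound saL posL discrL EL c0.
pose Q n := exists u, orthonormal_seq n u /\ (forall i,
  (i < n)%N -> E A (u i) = u i).
have QN n : `[< Q n >] -> (n <= N)%N.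
  move=> /asboolP[u [ou uA]]; apply: (NP n u) => // i ni.
  exact: (proj_fix mA (measurable_oc _ _) AI (uA i ni)).
have Q0 : exists n, `[< Q n >].
  by exists 0%N; apply/asboolP; exists (fun=> 0); split.
have [n /asboolP[u [ou uA]] nmax] := ex_maxnP Q0 QN.
exists n, u; split => // x.
pose y := E A x - \sum_(i < n) ip x (u i) *: u i.
have Ay : E A y = y.
  rewrite /y linearB/= Defs.projK// linear_sum/=; congr (_ - _).
  by apply: eq_bigr => i _; rewrite linearZ/= uA.
have yu i : (i < n)%N -> ip (u i) y = 0.
  move=> ni; apply: ip_eq0C; rewrite /y ipBl proj_sym// uA// ip_suml.
  rewrite (bigD1 (Ordinal ni))//= ipZl ou// eqxx mulr1 big1 ?addr0 ?subrr//.
  move=> j ji; rewrite ipZl ou// (_ : (_ == _) = false) ?mulr0//.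
  by apply: contra_neqF ji => /eqP e; apply/val_inj.
have [/eqP|y0] := eqVneq y 0; first by rewrite subr_eq0 => /eqP.
suff : (n.+1 <= n)%N by rewrite ltnn.
apply: nmax; apply/asboolP; exists (extend_seq u n ((rnorm y)^-1%:C *: y));
  split.
  apply: orthonormal_extend => //; first exact: rnorm_normalize.
  by move=> i ni; rewrite ipZr yu// mulr0.
move=> i; rewrite ltnS /extend_seq => ni; have [/uA//|_] := ltnP i n.
by rewrite linearZ/= Ay.
Qed.

(* Let a be the leftmost point of the support of E on A. It is not an atom, as
   atoms are eigenvalues, so arbitrarily many disjoint nonzero pieces of A
   accumulate at a from the right, against orthonormal_seq_bound. *)
Lemma proj_avoid_lam A c : measurable A -> A `<=` I 0 c -> 0 < c ->
  (forall k, ~ A (lam k)) -> forall x, E A x = 0.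
Proof.
move=> mA AI c0 Alam.
pose Z s := forall x, E (A `&` `]-oo, s]%classic) x = 0.
have mAs s : measurable (A `&` `]-oo, s]%classic : set (measurableTypeR R)).
  by apply: measurableI => //; exact: measurable_itv.
have Zmono s r : s <= r -> Z r -> Z s.
  move=> sr Zr x; apply: (proj_sub (mAs s) (mAs r) _ (Zr x)).
  move=> t [At]/=; rewrite !in_itv/= => ts; split => //; exact: le_trans sr.
have Z0 : Z 0.
  move=> x; rewrite (_ : A `&` _ = set0) ?proj0//.
  apply/seteqP; split => // t [/AI /=]; rewrite !in_itv/= => /andP[t0 _].
  by rewrite leNgt t0.
suff Zc : Z c.
  move=> x; rewrite -(Zc x); congr (E _ x).
  apply/seteqP; split => [t At|t []//]; split => //.
  by have := AI _ At; rewrite /= !in_itv/= => /andP[].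
apply: contrapT => nZc.
pose S := [set s | Z s].
have Sc s : S s -> s <= c.
  by move=> Zs; rewrite leNgt; apply/negP => cs; apply: nZc;
    exact: Zmono (ltW cs) Zs.
have supS : has_sup S by split; [exists 0 | exists c].
pose a := sup S.
have a0 : 0 <= a by apply: sup_upper_bound.
have Zlt s : s < a -> Z s.
  move=> sa; have d0 : 0 < a - s by rewrite subr_gt0.
  have [r Zr] := sup_adherent d0 supS; rewrite -/a subKr => sr.
  exact: Zmono (ltW sr) Zr.
have nZgt s : a < s -> ~ Z s.
  by move=> sa Zs; have := sup_upper_bound supS Zs; rewrite -/a leNgt sa.
have Za1 x : E (A `&` [set a]) x = 0.
  have mAa : measurable (A `&` [set a] : set (measurableTypeR R))
    by apply: measurableI.
  have [Aa|nAa] := pselect (A a); last first.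
    by rewrite (_ : A `&` _ = set0) ?proj0//; apply/seteqP;
      split => // t [/[swap]->].
  apply/eqP/negPn/negP => x0; have aN0 : a != 0.
    by have := AI _ Aa; rewrite /= in_itv/= => /andP[+ _];
      rewrite lt0r => /andP[].
  have fx : E [set a] (E (A `&` [set a]) x) = E (A `&` [set a]) x.
    by apply: (proj_fix mAa (measurable_point a));
      [move=> t [] | exact: Defs.projK].
  have [k ak] := eigen_is_lam saL EL lamP aN0 x0 fx.
  by apply: (Alam k); rewrite -ak.
have Za : Z a.
  move=> x.
  pose F n := (A `&` `]-oo, a - n.+1%:R^-1])%classic : set (measurableTypeR R).
  have mF n : measurable (F n) by exact: mAs.
  have mUF : measurable (\bigcup_n F n) by exact: bigcupT_measurable.
  have F0 : E (\bigcup_n F n) x = 0.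
    apply: proj_bigcup0 => // n; apply: Zlt.
    by rewrite ltrBlDr ltrDl invr_gt0.
  have mAa : measurable (A `&` [set a] : set (measurableTypeR R))
    by apply: measurableI.
  rewrite (_ : A `&` _ = (\bigcup_n F n) `|` (A `&` [set a])); last first.
    apply/seteqP; split => [t [At]|t [[n _ []]|[At ta]]].
    - rewrite /= in_itv/= le_eqVlt => /orP[/eqP ta|ta]; first by right; split.
      left; have d0 : 0 < a - t by rewrite subr_gt0.
      have [n _ /(_ n (leqnn n)) nd] := near_infty_natSinv_lt (PosNum d0).
      exists n => //; split => //; move: nd; rewrite /= in_itv/=.
      by move: (n.+1%:R^-1) => i; lra.
    - move=> At; rewrite /= !in_itv/= => tn; split => //; apply: (le_trans tn).
      by rewrite gerBl invr_ge0.
    - by split => //=; rewrite ta in_itv/= lexx.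
  rewrite projD// ?F0 ?Za1 ?addr0//; apply/seteqP;
    split => // t [[n _ [_ +]] [_ ta]].
  rewrite ta /= in_itv/= leNgt => /negP; apply.
  by rewrite ltrBlDr ltrDl invr_gt0.
have [N NP] := orthonormal_seq_bound saL posL discrL EL c0.
have mAI s r : measurable (A `&` I s r) by apply: measurableI => //;
  exact: measurable_oc.
(* The statement covers all s > a so that the new vector can be taken in ]s', s] and the earlier
   ones, by induction, in ]a, s']. *)
have fam n : forall s, a < s -> exists u, orthonormal_seq n u /\
    forall i, (i < n)%N -> E (A `&` I a s) (u i) = u i.
  elim: n => [|n ih] s sa; first by exists (fun=> 0); split.
  have /existsNP[x /eqP x0] := nZgt s sa.
  have [s' [sa' s's Es']] : exists s', [/\ a < s',
    s' < s & E (A `&` I s' s) x != 0].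
    apply: contrapT => nS; move/eqP: x0; apply.
    have Zs' s' : a < s' -> s' < s -> E (A `&` I s' s) x = 0.
      move=> as' s's; apply/eqP/negPn/negP => H; apply: nS; by exists s'; split.
    (* The denominators start at 2, which keeps the left end strictly below s. *)
    pose F n := (A `&` I (a + (s - a) / n.+2%:R) s).
    have mF k : measurable (F k) by exact: mAI.
    have mUF : measurable (\bigcup_k F k) by exact: bigcupT_measurable.
    have sa0 : 0 < s - a by rewrite subr_gt0.
    have F0 : E (\bigcup_n F n) x = 0.
      apply: proj_bigcup0 => // k; apply: Zs'.
        by rewrite ltrDl divr_gt0.
      rewrite -ltrBrDl ltr_pdivrMr// ltr_pMr// ltr1n//.
    rewrite (_ : A `&` _ = (A `&` `]-oo, a]%classic) `|` (\bigcup_k F k));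
      last first.
      apply/seteqP; split => [t [At]|t [[At]|[k _ [At]]]]; rewrite /= !in_itv/=.
      - move=> ts; have [ta|ta] := leP t a; [left|right] => //.
        have d0 : 0 < (t - a) / (s - a) by rewrite divr_gt0// subr_gt0.
        have [k _ /(_ k.+1 (leqnSn k)) /= nd] :=
          near_infty_natSinv_lt (PosNum d0).
        exists k => //; split => //; rewrite /= in_itv/= ts andbT -ltrBrDl.
        by move: nd; rewrite ltr_pdivlMr// mulrC.
      - by move=> ta; split => //; rewrite (le_trans ta)// ltW.
      - by move=> /andP[_ ts]; split.
    rewrite projD// ?F0 ?(Za x) ?addr0//.
    apply/seteqP; split => // t [[_ +] [k _ [_]]];
      rewrite /= !in_itv/= => ta /andP[+ _].
    have : 0 < (s - a) / k.+2%:R by rewrite divr_gt0.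
    by move: (_ / _) => d; lra.
  have [u [ou uI]] := ih s' sa'.
  pose y := E (A `&` I s' s) x.
  have Ey : E (A `&` I s' s) y = y by exact: Defs.projK.
  exists (extend_seq u n ((rnorm y)^-1%:C *: y)); split.
    apply: orthonormal_extend => //; first exact: rnorm_normalize.
    move=> i ni; rewrite ipZr (proj_ortho (mAI a s') (mAI s' s) _ (uI i ni) Ey)
      ?mulr0//.
    apply/seteqP; split => // t [[_ +] [_ +]]; rewrite /= !in_itv/=.
    by move=> /andP[_ ts'] /andP[s't _]; move: s't; rewrite ltNge ts'.
  move=> i; rewrite ltnS /extend_seq => ni; have [i_n|_] := ltnP i n.
    apply: (proj_fix (mAI a s') (mAI a s) _ (uI i i_n)) => t [At];
      rewrite /= !in_itv/=.
    by move=> /andP[-> ts]; split => //; rewrite (le_trans ts)// ltW.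
  rewrite linearZ/= (proj_fix (mAI s' s) (mAI a s) _ Ey)// => t [At];
    rewrite /= !in_itv/=.
  by move=> /andP[st ->]; split => //; rewrite (lt_trans sa' st).
have ac : a < a + 1 by rewrite ltrDl.
have [u [ou uI]] := fam N.+1 _ ac.
suff : (N.+1 <= N)%N by rewrite ltnn.
apply: (NP _ u) => // i ni.
by apply: (proj_fix (mAI _ _) (measurable_oc _ _) _ (uI i ni)) => t [/AI].
Qed.

End multiplicities.

(** * The counting function and integrals of step functions *)

Section counting_function.
Context {R : realType} {h : hilbertType R} (L : linear_op h) (E :
  spectral_measure h).
Local Notation C := (Cplx R).
Local Notation ip := (inner h).
Local Notation mu := (scalar_measure E).
Implicit Types (x y : h) (A B : set (measurableTypeR R)).
Hypothesis saL : self_adjoint L.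
Hypothesis posL : nonnegative_op L.
Hypothesis discrL : discrete_off_ker L.
Hypothesis EL : is_spectral_measure_of L E.
Variable lam : R^nat.
Hypothesis lamP : enumerates_eigenvalues L lam.
Local Notation I a c := (`]a, c]%classic : set (measurableTypeR R)).
Local Notation m := (mult E lam).
Local Notation M := (cumul E lam).

Lemma trace_eigenprojection k : exists n : nat,
  [/\ (0 < n)%N, is_trace (E [set lam k]) n%:R & m k = n%:R].
Proof.
have lk := lam_gt0 posL lamP k.
have sub : [set lam k] `<=` I 0 (lam k) by move=> t /= ->;
  rewrite in_itv/= lk lexx.
have [n [u [ou uE]]] := finite_rank saL posL discrL EL (measurable_point (lam
  k)) sub lk.
have tr := is_trace_finite_rank uE ou.
exists n; split => //; last first.
  by rewrite /mult (is_trace_unique tr) -(rmorph_nat (real_complex R)).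
have [x [x1 xE]] := eigenvector_lam saL EL lamP k.
rewrite lt0n; apply/negP => /eqP n0; move: x1;
  rewrite -xE uE n0 big_ord0 rnorm0.
by move/eqP; rewrite eq_sym oner_eq0.
Qed.

Lemma mult_ge1 k : 1 <= m k.
Proof. by have [n [n0 _ ->]] := trace_eigenprojection k; rewrite ler1n. Qed.

Lemma is_trace_mult k : is_trace (E [set lam k]) (m k)%:C.
Proof.
by have [n [_ tr ->]] := trace_eigenprojection k;
  rewrite (rmorph_nat (real_complex R)).
Qed.

Definition eigenset (k : nat) : set (measurableTypeR R) := [set t | exists2 j,
  (j <= k)%N & t = lam j].

Lemma eigensetS k : eigenset k.+1 = eigenset k `|` [set lam k.+1].
Proof.
apply/seteqP; split => t.
  move=> [j]; rewrite leq_eqVlt ltnS => /orP[/eqP->|jk] ->; first by right.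
  by left; exists j.
by move=> [[j jk ->]|->]; [exists j => //; rewrite (leq_trans jk) | exists
  k.+1].
Qed.

Lemma eigenset0 : eigenset 0 = [set lam 0].
Proof.
apply/seteqP; split => t; first by move=> [j]; rewrite leqn0 => /eqP -> ->.
by move=> ->; exists 0%N.
Qed.

Lemma measurable_eigenset k : measurable (eigenset k).
Proof.
elim: k => [|k ih]; first by rewrite eigenset0; exact: measurable_point.
by rewrite eigensetS; apply: measurableU => //; exact: measurable_point.
Qed.

Lemma proj_eigenset k x : E (eigenset k) x = \sum_(j < k.+1) E [set lam j] x.
Proof.
elim: k => [|k ih]; first by rewrite eigenset0 big_ord1.
rewrite eigensetS projD; first by rewrite ih [RHS]big_ord_recr.
- exact: measurable_eigenset.
- exact: measurable_point.
- apply/seteqP; split => // t [[j jk ->]] /= /(lam_inj lamP) jk1.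
  by rewrite jk1 ltnn in jk.
Qed.

(** What remains of ]0, t] outside [eigenset k] contains no eigenvalue, so [proj_avoid_lam] applies
    to it. *)
Lemma proj_itv_eigenset k t x : lam k <= t < lam k.+1 ->
  E (I 0 t) x = E (eigenset k) x.
Proof.
move=> /andP[kt tk]; have t0 : 0 < t := lt_le_trans (lam_gt0 posL lamP k) kt.
have mE := measurable_eigenset k.
have mD : measurable (I 0 t `\` eigenset k) by apply: measurableD => //;
  exact: measurable_oc.
have -> : I 0 t = eigenset k `|` (I 0 t `\` eigenset k).
  rewrite setDUK// => _ [j jk ->]; rewrite /= in_itv/= (lam_gt0 posL lamP).
  apply: le_trans kt; move: jk; rewrite leq_eqVlt => /orP[/eqP->//|jk].
  by rewrite ltW// (lam_lt lamP).
rewrite projD//; last by rewrite setDIK.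
suff -> : E (I 0 t `\` eigenset k) x = 0 by rewrite addr0.
apply: (proj_avoid_lam saL posL discrL EL lamP mD (@subDsetl _ _ _) t0).
move=> j [/=]; rewrite in_itv/= => /andP[_ jt] nj; apply: nj; exists j => //.
rewrite leqNgt; apply/negP => kj; have : lam k.+1 <= lam j.
  by move: kj; rewrite leq_eqVlt => /orP[/eqP->//|kj];
    rewrite ltW// (lam_lt lamP).
by rewrite leNgt (le_lt_trans jt tk).
Qed.

Lemma is_trace_sum k : is_trace (fun x => \sum_(j < k.+1) E [set lam j] x) (M
  k)%:C.
Proof.
rewrite /cumul; elim: k => [|k ih].
  rewrite big_ord1; apply: (@is_trace_eq _ _ (E [set lam 0]) _ (m 0)%:C);
    last exact: is_trace_mult.
  by move=> x; rewrite big_ord1.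
have tr := is_traceD ih (@is_trace_mult k.+1).
have -> : (fun x => \sum_(j < k.+2) E [set lam j] x) =
    (fun x => \sum_(j < k.+1) E [set lam j] x + E [set lam k.+1] x).
  by apply/funext => x; rewrite big_ord_recr.
have -> : (\sum_(j < k.+2) m j)%:C = (\sum_(j < k.+1) m j)%:C +
  (m k.+1)%:C :> C.
  by rewrite big_ord_recr rmorphD.
exact: tr.
Qed.

Lemma eigenvalue_countingE k t : lam k <= t < lam k.+1 ->
  eigenvalue_counting E t = M k.
Proof.
move=> kt; rewrite /eigenvalue_counting (is_trace_unique (a := (M k)%:C))//.
rewrite (_ : (E `]0, t]%classic : h -> h) = fun x => \sum_(j < k.+1) E [set lam
  j] x).
  exact: is_trace_sum.
by apply/funext => x; rewrite (proj_itv_eigenset x kt) proj_eigenset.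
Qed.

Lemma eigenvalue_counting0 t : t < lam 0 -> eigenvalue_counting E t = 0.
Proof.
move=> t0; rewrite /eigenvalue_counting (is_trace_unique (a := 0))//.
rewrite (_ : (E `]0, t]%classic : h -> h) = fun=> 0); first exact: is_trace0.
apply/funext => x.
have [tpos|tneg] := ltP 0 t; last first.
  rewrite (_ : `]0, t]%classic = set0) ?proj0//.
  by apply/seteqP; split => // s /=; rewrite in_itv/= => /andP[s0 st];
    move: s0; rewrite ltNge (le_trans st).
apply: (proj_avoid_lam saL posL discrL EL lamP (measurable_oc 0 t) _ tpos) =>
  //.
move=> k /=; rewrite in_itv/= => /andP[_]; rewrite leNgt (lt_le_trans t0)//.
by case: k => [//|k]; rewrite ltW// (lam_lt lamP).
Qed.

Lemma lam_cell t : lam 0 <= t -> exists k, lam k <= t < lam k.+1.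
Proof.
move=> t0; have ex : exists k, t < lam k.
  by have [k] := lam_unbounded saL posL discrL EL lamP t; exists k.
have [k tk kmin] := ex_minnP ex.
case: k tk kmin => [|k] tk kmin; first by move: t0; rewrite leNgt tk.
exists k; rewrite tk andbT leNgt; apply/negP => /kmin.
by rewrite ltnn.
Qed.

Lemma mu_off_lam x : mu x (`]0, +oo[%classic `\` range lam) = 0%E.
Proof.
have mr : measurable (range lam : set (measurableTypeR R)).
  rewrite (_ : range lam = \bigcup_k [set lam k]).
    by apply: bigcupT_measurable => k; exact: measurable_point.
  by apply/seteqP; split => t; [move=> [k _ <-]; exists k | move=> [k _ ->];
    exists k].
have mF n : measurable (I 0 n.+1%:R `\` range lam) by apply: measurableD => //;
  exact: measurable_oc.
apply/mu_eq0; first by apply: measurableD => //; exact: measurable_itv.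
rewrite (_ : _ `\` _ = \bigcup_n (I 0 n.+1%:R `\` range lam)).
  apply: proj_bigcup0 => // n.
  apply: (proj_avoid_lam saL posL discrL EL lamP (mF n) (@subDsetl _ _ _)
    (ltr0Sn _ n)).
  by move=> k [_ +]; apply; exists k.
apply/seteqP; split => t.
  move=> [/=]; rewrite in_itv/= andbT => t0 nt.
  have [n _ /(_ n (leqnn n)) tn] := nbhs_infty_ger t.
  exists n => //; split => //=; rewrite in_itv/= t0 (le_trans tn)// ler_nat.
  exact: leqnSn.
by move=> [n _ [/=]]; rewrite !in_itv/= andbT => /andP[].
Qed.

Section step_function.
Variables (g : R -> R) (c : R^nat) (G : R).
Hypothesis gc : forall k t, lam k <= t < lam k.+1 -> g t = c k.
Hypothesis g0 : forall t, 0 < t < lam 0 -> g t = 0.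
Hypothesis cG : forall k, `|c k| <= G.

Local Notation D := (`]0, +oo[%classic : set (measurableTypeR R)).

Lemma step_cases t : 0 < t -> g t = 0 \/ exists k, g t = c k.
Proof.
move=> t0; have [tl|lt] := ltP t (lam 0); first by left; apply: g0; rewrite t0.
by have [k kt] := lam_cell lt; right; exists k; exact: gc.
Qed.

Lemma measurable_step : @measurable_fun _ _ (measurableTypeR R) R D g.
Proof.
pose F n : set (measurableTypeR R) :=
  if n is k.+1 then `[lam k, lam k.+1[%classic else `]0, lam 0[%classic.
have -> : D = \bigcup_n F n.
  apply/seteqP; split => t /=.
    rewrite in_itv/= andbT => t0; have [tl|lt] := ltP t (lam 0).
      by exists 0%N => //=; rewrite in_itv/= t0.
    by have [k kt] := lam_cell lt; exists k.+1 => //=; rewrite in_itv/=.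
  move=> [[|k] _ /=]; rewrite !in_itv/= andbT => /andP[]//.
  by move=> + _; apply: lt_le_trans; exact: (lam_gt0 posL lamP).
apply/measurable_fun_bigcup; first by case=> [|n]; exact: measurable_itv.
case=> [|n].
- apply: (@eq_measurable_fun _ _ (measurableTypeR R) R (F 0%N) (cst 0));
    last exact: measurable_cst.
  by move=> t /set_mem; rewrite /= in_itv/= => tl; rewrite g0.
- apply: (@eq_measurable_fun _ _ (measurableTypeR R) R (F n.+1) (cst (c n)));
    last exact: measurable_cst.
  by move=> t /set_mem; rewrite /= in_itv/= => tl; rewrite (gc tl).
Qed.

Lemma integrable_step x : (mu x).-integrable D (fun t => (g t)%:E).
Proof.
apply: (@measurable_bounded_integrable _ _ _ (mu x) g D).
- exact: measurable_itv.
- by rewrite muE; [rewrite ltry | exact: measurable_itv].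
- exact: measurable_step.
- have G0 : 0 <= G := le_trans (normr_ge0 _) (cG 0).
  exists G; split; first exact: num_real.
  move=> r Gr t /=; rewrite in_itv/= andbT => t0.
  rewrite (le_trans _ (ltW Gr))//.
  by have [->|[k ->]] := step_cases t0; rewrite ?normr0.
Qed.

Lemma sum_proj_lam_le x n :
  \sum_(0 <= k < n) rnorm (E [set lam k] x) ^+ 2 <= rnorm x ^+ 2.
Proof.
case: n => [|n]; first by rewrite big_nil sqr_ge0.
have mE := measurable_eigenset n.
rewrite big_mkord.
have -> : \sum_(k < n.+1) rnorm (E [set lam k] x) ^+ 2 =
  rnorm (E (eigenset n) x) ^+ 2.
  apply: complexI; rewrite -proj_rnorm_sqr// proj_eigenset ip_suml rmorph_sum/=.
  by apply: eq_bigr => k _; rewrite proj_rnorm_sqr//; exact: measurable_point.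
rewrite [in leRHS](projCE E x mE) rnormD_ortho ?lerDl ?sqr_ge0//.
apply: (proj_ortho mE (measurableC mE) (setICr _)); apply: Defs.projK => //.
exact: measurableC.
Qed.

Lemma cvg_step_series x :
  cvgn (series (fun k => c k * rnorm (E [set lam k] x) ^+ 2)).
Proof.
have cs : cvgn (series (fun k => rnorm (E [set lam k] x) ^+ 2)).
  apply: nondecreasing_is_cvgn; first by apply: nondecreasing_series => k _ _;
    exact: sqr_ge0.
  by exists (rnorm x ^+ 2) => _ [n _ <-]; exact: sum_proj_lam_le.
have csG : cvgn (series (fun k => G * rnorm (E [set lam k] x) ^+ 2)).
  by apply: is_cvg_seriesZ; exact: cs.
apply: normed_cvg; apply: series_le_cvg csG => k.
- exact: normr_ge0.
- by rewrite mulr_ge0 ?sqr_ge0// (le_trans _ (cG 0)).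
- by rewrite /= normrM (ger0_norm (sqr_ge0 _)) ler_wpM2r ?sqr_ge0.
Qed.

(** On the positive half-line the scalar measure is carried by the countable set of eigenvalues, so
    the integral is a series of point masses. It is applied to the real and imaginary parts of f
    separately. *)
Lemma Rintegral_step x :
  series (fun k => c k * rnorm (E [set lam k] x) ^+ 2) @ \oo -->
  \int[mu x]_(t in D) g t.
Proof.
have mD : measurable D by exact: measurable_itv.
have mr : measurable (range lam : set (measurableTypeR R)).
  rewrite (_ : range lam = \bigcup_k [set lam k]).
    by apply: bigcupT_measurable => k; exact: measurable_point.
  by apply/seteqP; split => t; [move=> [k _ <-]; exists k | move=> [k _ ->];
    exists k].
have mDr : measurable (D `\` range lam) by exact: measurableD.
have ig := integrable_step x.
have DE : D `\` (D `\` range lam) = \bigcup_k [set lam k].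
  rewrite setDD; apply/seteqP; split => [t [_ [k _ <-]]|_ [k _ ->]].
    by exists k.
  split; last by exists k.
  by rewrite /= in_itv/= (lam_gt0 posL lamP).
suff -> : \int[mu x]_(t in D) g t = limn (series (fun k => c k * rnorm (E [set
  lam k] x) ^+ 2)).
  exact: cvg_step_series.
rewrite /Rintegral (negligible_integral mDr mD ig (mu_off_lam x)) DE.
rewrite integral_bigcup//; last 2 first.
- move=> i j _ _ [t [/= -> ]]; exact: (lam_inj lamP).
- by rewrite -DE; apply: (integrableS mD) => //; apply: measurableD.
have term k : (\int[mu x]_(t in [set lam k]) (g t)%:E =
    (c k * rnorm (E [set lam k] x) ^+ 2)%:E)%E.
  rewrite (eq_integral (cst (c k)%:E)); last first.
    move=> t /set_mem /= ->; rewrite (gc (k := k))// lexx/=.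
    exact: (lam_lt lamP).
  by rewrite integral_cst; [rewrite muE//; exact: measurable_point | exact:
    measurable_point].
rewrite (eq_eseriesr (fun k _ => term k)).
have -> : (\sum_(0 <= k <oo) (c k * rnorm (E [set lam k] x) ^+ 2)%:E)%E =
   (limn (series (fun k => c k * rnorm (E [set lam k] x) ^+ 2)))%:E.
  rewrite -EFin_lim; last exact: cvg_step_series.
  by congr (limn _); apply/funext => n; rewrite /= /series/= sumEFin.
by [].
Qed.

End step_function.

End counting_function.

(** * Functional calculus of step functions *)

Section spectral_weight.
Context {R : realType} {h : hilbertType R} (L : linear_op h) (E :
  spectral_measure h).
Local Notation C := (Cplx R).
Local Notation ip := (inner h).
Local Notation mu := (scalar_measure E).
Implicit Types (x y : h) (A B : set (measurableTypeR R)).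
Hypothesis saL : self_adjoint L.
Hypothesis posL : nonnegative_op L.
Hypothesis discrL : discrete_off_ker L.
Hypothesis EL : is_spectral_measure_of L E.
Variable lam : R^nat.
Hypothesis lamP : enumerates_eigenvalues L lam.
Local Notation m := (mult E lam).
Local Notation M := (cumul E lam).

Lemma rnorm_proj_le A x : measurable A -> rnorm (E A x) <= rnorm x.
Proof.
move=> mA; rewrite -(ler_pXn2r (_ : (0 < 2)%N))// ?nnegrE ?rnorm_ge0//.
rewrite [in leRHS](projCE E x mA) rnormD_ortho ?lerDl ?sqr_ge0//.
apply: (proj_ortho mA (measurableC mA) (setICr _)); apply: Defs.projK => //.
exact: measurableC.
Qed.

(** This is the uniqueness behind the [xget] in [functional_calculus]. *)
Lemma quadratic_form_inj (S T : h -> h) : linear S -> linear T ->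
  (forall x, ip (S x) x = ip (T x) x) -> S = T.
Proof.
move=> lS lT q; have D (U : h -> h) : linear U -> forall x y,
  U (x + y) = U x + U y.
  by move=> lU x y; have := lU 1 x y; rewrite !scale1r.
have Z (U : h -> h) : linear U -> forall (a : C) x, U (a *: x) = a *: U x.
  move=> lU a x; have U0 : U 0 = 0.
    by have /eqP := D U lU 0 0; rewrite addr0 -subr_eq subrr eq_sym => /eqP.
  by have := lU a x 0; rewrite U0 !addr0.
apply/funext => x; apply: ip_inj => y; apply/eqP; rewrite -subr_eq0 -ipBl;
  apply/eqP.
apply: (@polar0 R h setT (fun z => S z - T z)) => //.
- by move=> u v _ _; rewrite (D S lS) (D T lT) opprD addrACA.
- by move=> a u _; rewrite (Z S lS) (Z T lT) scalerBr.
- by move=> z _; rewrite ipBl q subrr.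
Qed.

Variables (f : measurableTypeR R -> C) (c : nat -> C).
Hypothesis fc : forall k t, lam k <= t < lam k.+1 -> f t = c k.
Hypothesis f0 : forall t : R, 0 < t < lam 0 -> f t = 0.
Hypothesis csum : cvgn (series (fun k => rnorm (c k))).

(** The candidate for f(L). The assumption [csum] makes the series converge in norm for every x. *)
Definition weighted_sum x : h := limn (series (fun k => c k *: E [set lam k]
  x)).

Lemma rnorm_weighted_le x k : rnorm (c k *: E [set lam k] x) <=
  rnorm x * rnorm (c k).
Proof.
by rewrite rnormZ mulrC ler_wpM2r ?rnorm_ge0// rnorm_proj_le//;
  exact: measurable_point.
Qed.

Lemma is_cvg_rnorm_bound x : cvgn (series (fun k => rnorm x * rnorm (c k))).
Proof. by apply: is_cvg_seriesZ; exact: csum. Qed.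

Lemma cvg_weighted_sum x :
  series (fun k => c k *: E [set lam k] x) @ \oo --> weighted_sum x.
Proof.
have : cvgn (series (fun k => c k *: E [set lam k] x)).
  apply: cvg_series_rnorm; apply: series_le_cvg (@is_cvg_rnorm_bound x) => k.
  - exact: rnorm_ge0.
  - by rewrite mulr_ge0 ?rnorm_ge0.
  - exact: rnorm_weighted_le.
exact.
Qed.

Lemma weighted_sum_linear : linear weighted_sum.
Proof.
move=> a x y; apply/esym.
have h1 : series (fun k => c k *: E [set lam k] (a *: x + y)) @ \oo -->
    a *: weighted_sum x + weighted_sum y.
  have -> : series (fun k => c k *: E [set lam k] (a *: x + y)) = (fun n =>
      a *: series (fun k => c k *: E [set lam k] x) n +
      series (fun k => c k *: E [set lam k] y) n).
    apply/funext => n; rewrite /series/= scaler_sumr -big_split/=.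
    apply: eq_bigr => k _; rewrite linearP scalerDr !scalerA.
    by rewrite (mulrC (c k)).
  apply: ccvgD; last exact: cvg_weighted_sum.
  exact: (@cvgZl_tmp C h _ _ _ _ _ _ (@cvg_weighted_sum x)).
exact: (rcvg_unique h1 (@cvg_weighted_sum _)).
Qed.

Lemma weighted_sum_bounded : exists K : C, forall x,
  `|weighted_sum x| <= K * `|x|.
Proof.
exists (limn (series (fun k => rnorm (c k))))%:C => x.
rewrite !rnormE -rmorphM lecRC mulrC.
have := rnorm_lim_series (@cvg_weighted_sum x) (@is_cvg_rnorm_bound x)
  (@rnorm_weighted_le x).
by rewrite lim_seriesZ.
Qed.

Lemma form_weighted_sum x :
  series (fun k => c k * ip (E [set lam k] x) x) @ \oo --> ip (weighted_sum x)
    x.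
Proof.
have -> : series (fun k => c k * ip (E [set lam k] x) x) =
    (fun n => ip (series (fun k => c k *: E [set lam k] x) n) x).
  apply/funext => n; rewrite /series/= ip_suml; apply: eq_bigr => k _.
  by rewrite ipZl.
by apply: cvg_ipl; exact: cvg_weighted_sum.
Qed.

Let cbound : exists G, forall k, rnorm (c k) <= G.
Proof.
have [G [_ GP]] := cvg_seq_bounded csum.
exists (`|G| + 1) => k.
have := GP (`|G| + 1); rewrite (le_lt_trans (ler_norm _)) ?ltrDl//
  => /(_ isT k.+1 I) /=.
apply: le_trans; apply: (le_trans _ (ler_norm _)).
rewrite seriesEord/= big_ord_recr/= lerDr.
by apply: sumr_ge0 => i _; exact: rnorm_ge0.
Qed.

Lemma is_functional_calculus_weighted_sum : is_functional_calculus E f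
  weighted_sum.
Proof.
have [G cG] := cbound.
have cGr k : `|complex.Re (c k)| <= G by rewrite (le_trans (ler_Re_rnorm _)).
have cGi k : `|complex.Im (c k)| <= G by rewrite (le_trans (ler_Im_rnorm _)).
have fr k t : lam k <= t < lam k.+1 -> complex.Re (f t) = complex.Re (c k).
  by move=> /fc ->.
have fi k t : lam k <= t < lam k.+1 -> complex.Im (f t) = complex.Im (c k).
  by move=> /fc ->.
have f0r t : 0 < t < lam 0 -> complex.Re (f t) = 0 by move=> /f0 ->.
have f0i t : 0 < t < lam 0 -> complex.Im (f t) = 0 by move=> /f0 ->.
split; [exact: weighted_sum_linear | exact: weighted_sum_bounded | move=> x;
  split].
- exact: (integrable_step saL posL discrL EL lamP fr f0r cGr).
- exact: (integrable_step saL posL discrL EL lamP fi f0i cGi).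
- have hr : series (fun k => complex.Re (c k) * rnorm (E [set lam k] x) ^+ 2) @
    \oo -->
      \int[mu x]_(t in `]0, +oo[) complex.Re (f t).
    exact: (Rintegral_step saL posL discrL EL lamP fr f0r cGr).
  have hi : series (fun k => complex.Im (c k) * rnorm (E [set lam k] x) ^+ 2) @
    \oo -->
      \int[mu x]_(t in `]0, +oo[) complex.Im (f t).
    exact: (Rintegral_step saL posL discrL EL lamP fi f0i cGi).
  apply: (rcvg_unique (@form_weighted_sum x)); apply: cvg_complex.
  + have -> : (fun n => complex.Re (series (fun k => c k * ip (E [set lam k] x)
      x) n)) =
       series (fun k => complex.Re (c k) * rnorm (E [set lam k] x) ^+ 2).
      apply/funext => n; rewrite /series/= cRe_sum.
      apply: eq_bigr => k _; rewrite proj_rnorm_sqr;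
        last exact: measurable_point.
      by rewrite cReM /= mulr0 subr0.
    exact: hr.
  + have -> : (fun n => complex.Im (series (fun k => c k * ip (E [set lam k] x)
      x) n)) =
       series (fun k => complex.Im (c k) * rnorm (E [set lam k] x) ^+ 2).
      apply/funext => n; rewrite /series/= cIm_sum.
      apply: eq_bigr => k _; rewrite proj_rnorm_sqr;
        last exact: measurable_point.
      by rewrite cImM /= mulr0 add0r.
    exact: hi.
Qed.

Lemma functional_calculusE : functional_calculus E f = weighted_sum.
Proof.
apply: xget_unique; first exact: is_functional_calculus_weighted_sum.
move=> T [lT _ Tint]; have [lW _ Wint] := is_functional_calculus_weighted_sum.
apply: quadratic_form_inj => // x.
by have [_ _ ->] := Tint x; have [_ _ ->] := Wint x.
Qed.

Hypothesis cmsum : cvgn (series (fun k => rnorm (c k) * m k)).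

Lemma is_trace_functional_calculus :
  is_trace (functional_calculus E f) (limn (series (fun k => c k * (m k)%:C))).
Proof.
rewrite functional_calculusE.
apply: (@is_trace_series _ _ _ (fun k => E [set lam k]) c
  (fun k e => rnorm (E [set lam k] e) ^+ 2) m) => //.
- by move=> k; exact: (is_trace_mult saL posL discrL EL lamP).
- by move=> k e; rewrite proj_rnorm_sqr//; exact: measurable_point.
- by move=> k e; exact: sqr_ge0.
- by move=> e; exact: form_weighted_sum.
Qed.

End spectral_weight.

(** * The zeta function as the trace of powers of the spectral weight *)

Section zeta_function.
Context {R : realType} {h : hilbertType R} (L : linear_op h) (E :
  spectral_measure h).
Local Notation C := (Cplx R).
Hypothesis saL : self_adjoint L.
Hypothesis posL : nonnegative_op L.
Hypothesis discrL : discrete_off_ker L.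
Hypothesis EL : is_spectral_measure_of L E.
Variable lam : R^nat.
Hypothesis lamP : enumerates_eigenvalues L lam.
Local Notation m := (mult E lam).
Local Notation M := (cumul E lam).
Implicit Types s : C.

Let m_ge1 : forall k, 1 <= m k := mult_ge1 saL posL discrL EL lamP.

Lemma is_trace_weight_pow s : 1 < complex.Re s ->
  is_trace (weight_pow E s) (zeta E lam s).
Proof.
move=> s1; pose c k : C := cpow (M k) (- s).
have dE k : rnorm (dirichlet_term m s k) = rnorm (c k) * m k.
  by rewrite /dirichlet_term rnormM rnormR ger0_norm 1?mulrC// (le_trans ler01).
have cmsum : cvgn (series (fun k => rnorm (c k) * m k)).
  have := is_cvg_dirichlet_term_abs m_ge1 s1.
  by rewrite (_ : (fun k => rnorm (dirichlet_term m s k)) =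
    fun k => rnorm (c k) * m k)//;
     apply/funext.
(* Multiplicities are at least 1, so summability with weights m_k implies summability without
   them. *)
have csum : cvgn (series (fun k => rnorm (c k))).
  apply: series_le_cvg cmsum => k.
  - exact: rnorm_ge0.
  - by rewrite mulr_ge0 ?rnorm_ge0// (le_trans ler01).
  - by rewrite ler_peMr ?rnorm_ge0.
have -> : zeta E lam s = limn (series (fun k => c k * (m k)%:C)).
  congr (limn (series _)); apply/funext => k; exact: mulrC.
apply: (is_trace_functional_calculus saL posL discrL EL lamP) => //.
- move=> k t kt; rewrite (eigenvalue_countingE saL posL discrL EL lamP kt).
  have M0 : 0 < M k by exact: psum_gt0 m_ge1 k.
  by rewrite /c !cpow_cexp ?invr_gt0// lnV// rmorphN mulrN mulNr.
(* Below the first eigenvalue N_L is 0; its inverse is 0 by convention, and the power of 0 is 0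
   because Re s is nonzero. *)
- move=> t /andP[_ tl]; rewrite (eigenvalue_counting0 saL posL discrL EL lamP
    tl) invr0.
  by rewrite /cpow powR0 ?rmorph0 ?mul0r// gt_eqF// (lt_trans ltr01).
Qed.

Lemma Tr_weight_pow s : 1 < complex.Re s -> Tr (weight_pow E s) =
  limn (series (dirichlet_term m s)).
Proof. by move=> s1; rewrite (is_trace_unique (is_trace_weight_pow s1)). Qed.

(* N_L(lam k.+1) = M k.+1 while the left limit of N_L there is M k; continuity
   of the comparison function makes the two asymptotically equal. *)
Lemma asymptotically_continuous_qratio :
  asymptotically_continuous (eigenvalue_counting E) ->
  m k.+1 / psum m k.+1 @[k --> \oo] --> (0 : R).
Proof.
move=> [phi [cphi phi0 Nphi]]; apply/cvgrPdist_lt => e e0.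
(* The bound 1 / 2 keeps [1 - d] positive; e / 4 leaves room for the two terms [d * M k] and
   [d * M k.+1]. *)
pose d := Num.min (e / 4) (1 / 2).
have d0 : 0 < d by rewrite lt_min !divr_gt0.
have d1 : d <= 1 / 2 by rewrite ge_min lexx orbT.
have de : d <= e / 4 by rewrite ge_min lexx.
move/cvgrPdist_lt : Nphi => /(_ d d0)[A [_ AP]].
apply: filterS (near_lam saL posL discrL EL lamP A) => k Ak.
have lk := lam_lt lamP (ltnSn k).
have Mk : psum m k = M k by [].
set b := lam k.+1 in lk *; have b0 : 0 < b by exact: (lam_gt0 posL lamP).
have key x a : A < x -> 0 < x -> eigenvalue_counting E x = a -> 0 < a ->
    (1 - d) * phi x <= a /\ a <= (1 + d) * phi x.
  move=> Ax x0 Nx a0; have := AP x Ax; rewrite /= Nx => H.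
  (* If [phi x] were 0, the quotient would be 0 by convention, at distance 1 from its limit. *)
  have px : 0 < phi x.
    rewrite lt_neqAle phi0 ?(ltW x0)// andbT eq_sym; apply/eqP => p0.
    by move: H; rewrite p0 invr0 mulr0 subr0 normr1; lra.
  move: H; rewrite ltr_norml => /andP[H1 H2].
  have E1 : a / phi x * phi x = a by rewrite divfK// gt_eqF.
  have [h1 h2] : 1 - d <= a / phi x /\ a / phi x <= 1 + d by split; lra.
  have := ler_wpM2r (ltW px) h1; have := ler_wpM2r (ltW px) h2.
  by rewrite E1; split.
have M0 j : 0 < M j by exact: psum_gt0 m_ge1 j.
have lk0 : 0 < lam k by exact: (lam_gt0 posL lamP).
have phib : (1 - d) * phi b <= M k.
  have [cin _] := (continuous_within_itvcyP 0 phi).1 cphi.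
  have cb : phi x @[x --> b] --> phi b by apply: cin; rewrite in_itv/= b0.
  have cbl : phi x @[x --> b^'-] --> phi b by exact: cvg_at_left_filter.
  have cbl2 : (1 - d) * phi x @[x --> b^'-] --> (1 - d) * phi b.
    by apply: cvgM => //; exact: cvg_cst.
  apply: (cvgr_to_le cbl2); near=> x.
  have xb : x < b by near: x; exact: nbhs_left_lt.
  have lx : lam k < x by near: x; exact: nbhs_left_gt.
  have Nx : eigenvalue_counting E x = M k.
    by apply: (eigenvalue_countingE saL posL discrL EL lamP);
      rewrite (ltW lx) xb.
  by have [] := key x _ (lt_trans Ak lx) (lt_trans lk0 lx) Nx (M0 k).
have [_ phib2] : (1 - d) * phi b <= M k.+1 /\ M k.+1 <= (1 + d) * phi b.
  apply: key => //; first exact: lt_trans lk.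
  apply: (eigenvalue_countingE saL posL discrL EL lamP).
  by rewrite lexx/= (lam_lt lamP).
have MS : M k.+1 = M k + m k.+1 by exact: psumS.
have mk0 : 0 <= m k.+1 := le_trans ler01 (m_ge1 _).
rewrite sub0r normrN ger0_norm; last exact: qratio_ge0.
rewrite ltr_pdivrMr; last exact: psum_gt0 m_ge1 _.
suff : m k.+1 < e * M k.+1 by [].
(* Eliminating [phi b] leads to m k.+1 <= d (M k.+1 + M k) <= (e / 2) M k.+1. *)
have h1 : (1 - d) * M k.+1 <= (1 + d) * M k.
  have a1 : (1 - d) * M k.+1 <= (1 - d) * ((1 + d) * phi b).
    by rewrite ler_wpM2l//; lra.
  have a2 : (1 + d) * ((1 - d) * phi b) <= (1 + d) * M k.
    by rewrite ler_wpM2l//; lra.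
  lra.
have h2 : d * M k.+1 <= e / 4 * M k.+1 by rewrite ler_wpM2r// ltW.
have h3 : d * M k <= e / 4 * M k by rewrite ler_wpM2r// ltW.
have h4 : 0 < e * M k by rewrite mulr_gt0.
have h5 : e * M k <= e * M k.+1 by rewrite ler_wpM2l ?(ltW e0)// MS lerDl.
have h6 : 0 < e * M k.+1 by rewrite mulr_gt0.
move: h1; rewrite mulrBl mulrDl !mul1r.
lra.
Unshelve. all: by end_near. Qed.

End zeta_function.

Unset Implicit Arguments.

Theorem proposition3p2 (R : realType) (h : hilbertType R)
    (L : linear_op h) (E : spectral_measure h) (lam : R^nat)
    (L_self_adjoint : self_adjoint L)
    (L_nonnegative : nonnegative_op L)
    (L_unbounded : ~ bounded_op L)
    (L_discrete : discrete_off_ker L)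
    (E_spectral : is_spectral_measure_of L E)
    (lam_eigenvalues : enumerates_eigenvalues L lam) :
  [/\ (forall s : Cplx R, half_plane 1 s -> zeta_defined E lam s ->
         is_trace (weight_pow E s) (zeta E lam s)),
      (asymptotically_continuous (eigenvalue_counting E) ->
         (forall s, half_plane 1 s -> zeta_defined E lam s) /\
         ((s - 1)%:C * Tr (weight_pow E s%:C) : Cplx R)
           @[s --> (1 : R)^'+] --> (1 : Cplx R)),
      (cvgn (series (fun k => mult E lam k ^+ 2 / cumul E lam k ^+ 2)) ->
         [/\ forall s, half_plane 1 s -> zeta_defined E lam s,
             holomorphic_on (half_plane 1) (zeta E lam) &
             ((s - 1) * Tr (weight_pow E s))
               @[s --> within (half_plane 1) (nbhs (1 : Cplx R))]
               --> (1 : Cplx R)]) &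
      (forall alpha : R, 0 < alpha < 1 ->
         cvgn (series
           (fun k => mult E lam k ^+ 2 / cumul E lam k `^ (1 + alpha))) ->
         exists F : Cplx R -> Cplx R,
           [/\ forall s, half_plane 1 s ->
                 zeta_defined E lam s /\ F s = zeta E lam s,
               meromorphic_on (half_plane alpha) F &
               pole F 1 1%N 1])].
Proof.
have m_ge1 := mult_ge1 L_self_adjoint L_nonnegative L_discrete E_spectral
  lam_eigenvalues.
have zdef s : half_plane 1 s -> zeta_defined E lam s.
  by move=> s1; exact: (is_cvg_dirichlet_term m_ge1 s1).
have TrE := Tr_weight_pow L_self_adjoint L_nonnegative L_discrete E_spectral
  lam_eigenvalues.
split.
- move=> s s1 _.
  exact: (is_trace_weight_pow L_self_adjoint L_nonnegative L_discrete E_spectral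
    lam_eigenvalues).
- move=> asc; split=> //.
  have q0 := asymptotically_continuous_qratio L_self_adjoint L_nonnegative
    L_discrete E_spectral lam_eigenvalues asc.
  apply: cvg_trans (real_dirichlet_pole m_ge1 q0).
  apply: near_eq_cvg; near=> s.
  have s1 : 1 < s by near: s; exact: nbhs_right_gt.
  by rewrite TrE.
(* The hypothesis of (ii) is the endpoint a = 1 of the quadratic condition, once the natural power
   is turned into a real one. *)
- move=> quad; have a01 : 0 < (1 : R) <= 1 by rewrite ltr01 lexx.
  have quad' : cvgn (series (fun k => mult E lam k ^+ 2 / psum (mult E lam) k `^
    (1 + 1))).
    rewrite (_ : (fun _ => _) = fun k => mult E lam k ^+ 2 / cumul E lam k ^+
      2)//.
    apply/funext => k; congr (_ / _).
    rewrite -[1 + 1]/(2%:R) powR_mulrn//; exact: ltW (psum_gt0 m_ge1 k).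
  split; [exact: zdef | exact: (holomorphic_dirichlet m_ge1 a01 quad') | ].
  apply: cvg_trans (cvg_eulerG m_ge1 quad').
  apply: near_eq_cvg; rewrite near_withinE; near=> s => s1.
  by rewrite TrE// dirichlet_eulerG.
- move=> a /andP[a0 a1] quad; have a01 : 0 < a <= 1 by rewrite a0 ltW.
  exists (fun s => eulerG (mult E lam) s / (s - 1)); split.
  + move=> s s1; split; first exact: zdef.
    by rewrite -(dirichlet_euler_quotient m_ge1).
  + exact: (meromorphic_euler_quotient m_ge1 a01 quad a1).
  + exact: (pole_euler_quotient m_ge1 a01 quad a1).
Unshelve. all: by end_near. Qed.
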